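(* Let $n\ge 2$, let $B_1\subset\mathbb{R}^n$ be the open unit ball, let $f\colon[0,+\infty)\to[0,\infty)$ be a $C^2$ function with $f'>0$ in $(0,+\infty)$, let $\lambda\ge 0$, and let $(\alpha_\lambda,\psi_\lambda)$ be a solution of the constrained problem on $\Omega=B_1$ described in the context, with associated weight $V_\lambda=f'(\alpha_\lambda+\lambda\psi_\lambda)$. Then any eigenvalue $\sigma$ of $L_\lambda$ in $B_1$ has at most one radial eigenfunction up to multiplication by constants; that is, any two radial eigenfunctions of the same eigenvalue $\sigma$ are linearly dependent.
   Context: Constrained problem. A solution is a pair $(\alpha_\lambda,\psi_\lambda)$ with $\alpha_\lambda\in\mathbb{R}$, $\alpha_\lambda>0$, and $\psi_\lambda\in C^2(\overline{B_1})$ such that $-\Delta\psi_\lambda=f(\alpha_\lambda+\lambda\psi_\lambda)$ in $B_1$, $\int_{B_1}f(\alpha_\lambda+\lambda\psi_\lambda)\,dx=1$, $\psi_\lambda>0$ in $B_1$, and $\psi_\lambda=0$ on $\partial B_1$. On the ball, $\psi_\lambda$ is radial by the theorem of Gidas–Ni–Nirenberg, so $V_\lambda:=f'(\alpha_\lambda+\lambda\psi_\lambda)$ is a radial function, and $V_\lambda>0$ on $\overline{B_1}$. Notation. $\langle\phi\rangle_\lambda:=\frac{\int_{B_1}V_\lambda\phi\,dx}{\int_{B_1}V_\lambda\,dx}$ and $[\phi]_\lambda:=\phi-\langle\phi\rangle_\lambda$. Eigenvalues. The linearized operator is $L_\lambda(\phi)=-\Delta\phi-\lambda V_\lambda[\phi]_\lambda$.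 A number $\sigma\in\mathbb{R}$ is an eigenvalue of $L_\lambda$ with eigenfunction $\phi\in H^1_0(B_1)\setminus\{0\}$ if $\phi$ is a weak solution of $-\Delta\phi-\lambda V_\lambda[\phi]_\lambda=\sigma V_\lambda[\phi]_\lambda$ in $B_1$. *)

(* Defs.v *)
From HB Require Import structures.
From mathcomp Require Import all_boot all_order all_algebra.
From mathcomp Require Import all_classical all_reals all_analysis.

Set Implicit Arguments.
Unset Strict Implicit.
Unset Printing Implicit Defensive.

Import Order.TTheory GRing.Theory Num.Theory.
Import numFieldNormedType.Exports.

Local Open Scope classical_set_scope.
Local Open Scope ring_scope.

(* The sigma-algebra generated by the coordinates; it is the Borel
   sigma-algebra of the product topology carried by 'rV[R]_n. *)
Section measurable_rV.
Context (R : realType) (n : nat).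

Let coord (i : 'I_n) (x : 'rV[R]_n) : measurableTypeR R := x ord0 i.

Let rV_set0 : g_sigma_preimage coord set0.
Proof. exact: sigma_algebra0. Qed.

Let rV_setC A : g_sigma_preimage coord A -> g_sigma_preimage coord (~` A).
Proof. exact: sigma_algebraC. Qed.

Let rV_bigcup (F : (set 'rV[R]_n)^nat) :
  (forall i, g_sigma_preimage coord (F i)) ->
  g_sigma_preimage coord (\bigcup_i (F i)).
Proof. exact: sigma_algebra_bigcup. Qed.

HB.instance Definition _ :=
  @isMeasurable.Build default_measure_display 'rV[R]_n
    (g_sigma_preimage coord) rV_set0 rV_setC rV_bigcup.

Lemma measurable_rV_coord (i : 'I_n) :
  measurable_fun [set: 'rV[R]_n]
    (fun x : 'rV[R]_n => x ord0 i : measurableTypeR R).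
Proof.
move=> _ Y mY; rewrite setTI; apply: sub_sigma_algebra => /=.
rewrite -bigcup_seq/=; exists i => /=; first by rewrite mem_index_enum.
by exists Y => //; rewrite setTI.
Qed.

Lemma measurable_fun_rV d (T : measurableType d) (f : T -> 'rV[R]_n) :
  (forall i, measurable_fun [set: T]
     (fun x => f x ord0 i : measurableTypeR R)) ->
  measurable_fun [set: T] f.
Proof.
move=> mf _ A mA; rewrite setTI.
have : preimage_set_system [set: T] f (g_sigma_preimage coord) (f @^-1` A).
  by exists A => //; rewrite setTI.
rewrite -g_sigma_preimage_comp; move: (f @^-1` A); apply: smallest_sub.
  exact: sigma_algebra_measurable.
by rewrite -bigcup_seq => B [i _ [C mC <-]]; exact: mf.
Qed.

End measurable_rV.

Definition cons_rV (R : realType) (n : nat)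
    (p : 'rV[R]_n * measurableTypeR R) : 'rV[R]_n.+1 :=
  \row_i if unlift ord0 i is Some j then p.1 ord0 j else p.2.

Lemma measurable_cons_rV (R : realType) (n : nat) :
  measurable_fun [set: 'rV[R]_n * measurableTypeR R] (@cons_rV R n).
Proof.
apply: measurable_fun_rV => i; rewrite /cons_rV.
under eq_fun do rewrite mxE.
case: (unlift ord0 i) => [j|]; last exact: measurable_snd.
exact: (measurableT_comp (measurable_rV_coord j) measurable_fst).
Qed.

Section lebesgue_rV.
Context (R : realType).
Local Open Scope ereal_scope.

(* Lebesgue measure on R^0 is the Dirac mass at its point, and the one on
   R^(n+1) is the image of the product measure under (x, t) |-> (t, x). *)
Fixpoint lebesgue_rV (n : nat) : {measure set 'rV[R]_n -> \bar R} :=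
  if n is n'.+1 then
    measure_function_pushforward__canonical__measure_function_Measure
      (lebesgue_rV n' \x @lebesgue_measure R) (@measurable_cons_rV R n')
  else dirac (0%R : 'rV[R]_0).

Let box n (a b : 'rV[R]_n) :=
  [set x : 'rV[R]_n | forall i, (a ord0 i <= x ord0 i <= b ord0 i)%R].

Lemma lebesgue_rV_box n (a b : 'rV[R]_n) :
  (forall i, a ord0 i <= b ord0 i)%R ->
  measurable (box a b) /\
  lebesgue_rV n (box a b) = (\prod_(i < n) (b ord0 i - a ord0 i))%:E.
Proof.
elim: n a b => [|n IH] a b ab.
  have -> : box a b = setT.
    by apply/seteqP; split => // x _ [].
  by split=> //; rewrite big_ord0 /= diracT.
split.
  have -> : box a b =
      \big[setI/setT]_(i < n.+1)
        ((fun x : 'rV[R]_n.+1 => x ord0 i : measurableTypeR R) @^-1`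
          `[a ord0 i, b ord0 i]).
    rewrite -bigcap_seq; apply/seteqP; split => x /=.
      by move=> h i _ /=; rewrite in_itv /=.
    by move=> h i; have := h i; rewrite /= in_itv /=; apply; rewrite mem_index_enum.
  apply: bigsetI_measurable => i _; rewrite -[X in measurable X]setTI.
  exact: measurable_rV_coord.
pose a' : 'rV[R]_n := \row_j a ord0 (lift ord0 j).
pose b' : 'rV[R]_n := \row_j b ord0 (lift ord0 j).
have ab' i : (a' ord0 i <= b' ord0 i)%R by rewrite !mxE.
have [mI HI] := IH _ _ ab'.
rewrite /= /pushforward big_ord_recl.
set S := _ @^-1` _.
have -> : S = box a' b' `*` `[a ord0 ord0, b ord0 ord0]%classic.
  apply/seteqP; split => -[x t] /=.
    rewrite /S /= => h; split.
      by move=> i; have := h (lift ord0 i); rewrite !mxE liftK.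
    by have := h ord0; rewrite /= in_itv /= !mxE unlift_none.
  move=> [h1 h2] i /=; rewrite !mxE; case: unliftP => [j ->|->].
    by have := h1 j; rewrite !mxE.
  by move: h2; rewrite /= in_itv.
rewrite product_measure1E//.
rewrite HI
  [X in _ * X](lebesgue_measure_itv `[a ord0 ord0, b ord0 ord0])/= lte_fin.
rewrite EFinM muleC; congr (_ * _); last first.
  by congr EFin; apply: eq_bigr => i _; rewrite !mxE.
by have := ab ord0; rewrite le_eqVlt => /orP[/eqP ->|->]; rewrite ?ltxx ?subrr.
Qed.

End lebesgue_rV.

Section domain.
Context (R : realType) (n : nat).
Implicit Types (Om : set 'rV[R]_n) (u v phi : 'rV[R]_n -> R) (s : seq 'I_n).

(* The norm `|x| of 'rV[R]_n is the sup norm, hence this definition. *)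
Definition enorm (x : 'rV[R]_n) : R := Num.sqrt (\sum_(i < n) x ord0 i ^+ 2).

Definition unit_ball : set 'rV[R]_n := [set x | enorm x < 1].

Definition ebasis (i : 'I_n) : 'rV[R]_n := delta_mx ord0 i.

(* partials [:: i1; ...; ik] u = D_i1 (... (D_ik u)) *)
Definition partials s u : 'rV[R]_n -> R :=
  foldr (fun i g => 'D_(ebasis i) g) u s.

Definition laplacian u (x : 'rV[R]_n) : R :=
  \sum_(i < n) partials [:: i; i] u x.

(* C^k of the closure of an open set: u is continuous on the closure, and its
   partial derivatives of order at most k exist in Om and extend continuously
   to the closure. *)
Definition Ck_closure (k : nat) Om u : Prop :=
  {within closure Om, continuous u} /\
  forall s, (size s <= k)%N ->
    (exists g : 'rV[R]_n -> R, {within closure Om, continuous g} /\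
       forall x, Om x -> partials s u x = g x) /\
    ((size s < k)%N ->
       forall x, Om x -> forall i, derivable (partials s u) x (ebasis i)).

Definition smooth u : Prop :=
  forall s, continuous (partials s u) /\
    forall x i, derivable (partials s u) x (ebasis i).

Definition test_function Om v : Prop :=
  smooth v /\
  exists K, [/\ compact K, K `<=` Om & forall x, ~ K x -> v x = 0].

Local Notation mu := (lebesgue_rV R n).

Definition sq_integrable Om phi : Prop :=
  measurable_fun Om (phi : 'rV[R]_n -> measurableTypeR R) /\
  (\int[mu]_(x in Om) (phi x ^+ 2)%:E < +oo)%E.

Definition L2_cvg Om (u_ : nat -> 'rV[R]_n -> R) phi : Prop :=
  (\int[mu]_(x in Om) ((u_ k x - phi x) ^+ 2)%:E)%E @[k --> \oo] --> 0%E.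

Definition weak_partial Om (i : 'I_n) phi (g : 'rV[R]_n -> R) : Prop :=
  forall v, test_function Om v ->
    \int[mu]_(x in Om) (phi x * 'D_(ebasis i) v x) =
    - \int[mu]_(x in Om) (g x * v x).

Definition weak_gradient Om phi (G : 'I_n -> 'rV[R]_n -> R) : Prop :=
  forall i, sq_integrable Om (G i) /\ weak_partial Om i phi (G i).

(* The closure of the test functions in H^1(Om). *)
Definition H10 Om phi : Prop :=
  sq_integrable Om phi /\
  exists2 G, weak_gradient Om phi G &
    exists u_ : nat -> 'rV[R]_n -> R,
      [/\ forall k, test_function Om (u_ k),
          L2_cvg Om u_ phi &
          forall i, L2_cvg Om (fun k => 'D_(ebasis i) (u_ k)) (G i)].

Definition wmean Om (V : 'rV[R]_n -> R) phi : R :=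
  (\int[mu]_(x in Om) (V x * phi x)) / (\int[mu]_(x in Om) V x).

Definition wcenter Om (V : 'rV[R]_n -> R) phi (x : 'rV[R]_n) : R :=
  phi x - wmean Om V phi.

(* - Delta phi - lambda V [phi] = sigma V [phi] in Om, tested against
   C_c^oo(Om). *)
Definition weak_eigen_solution Om (lambda : R) (V : 'rV[R]_n -> R)
    (sigma : R) phi : Prop :=
  exists2 G, weak_gradient Om phi G &
    forall v, test_function Om v ->
      \int[mu]_(x in Om) (\sum_(i < n) G i x * 'D_(ebasis i) v x)
      - lambda * \int[mu]_(x in Om) (V x * wcenter Om V phi x * v x)
      = sigma * \int[mu]_(x in Om) (V x * wcenter Om V phi x * v x).

Definition eigenfunction Om (lambda : R) (V : 'rV[R]_n -> R)
    (sigma : R) phi : Prop :=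
  [/\ H10 Om phi,
      ~ {ae mu, forall x, Om x -> phi x = 0} &
      weak_eigen_solution Om lambda V sigma phi].

Definition radial Om phi : Prop :=
  exists g : R -> R, {ae mu, forall x, Om x -> phi x = g (enorm x)}.

Record constrained_solution Om (f : R -> R) (lambda alpha : R)
    (psi : 'rV[R]_n -> R) : Prop := {
  solution_alpha_gt0 : 0 < alpha ;
  solution_C2 : Ck_closure 2 Om psi ;
  solution_eqn : forall x, Om x ->
    - laplacian psi x = f (alpha + lambda * psi x) ;
  solution_mass :
    (\int[mu]_(x in Om) (f (alpha + lambda * psi x))%:E = 1)%E ;
  solution_gt0 : forall x, Om x -> 0 < psi x ;
  solution_boundary : forall x, (closure Om `\` Om) x -> psi x = 0 }.

End domain.

Arguments unit_ball : clear implicits.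

(* C^2 on [0, +oo[: the values of f at negative reals are irrelevant, and
   derivatives of order at most 2 on ]0, +oo[ extend continuously to 0. *)
Definition C2_nonneg (R : realType) (f : R -> R) : Prop :=
  {within `[0, +oo[, continuous f} /\
  forall k, (k <= 2)%N ->
    (exists g : R -> R, {within `[0, +oo[, continuous g} /\
       forall t : R, 0 < t -> derive1n k f t = g t) /\
    ((k < 2)%N -> forall t : R, 0 < t -> derivable (derive1n k f) t 1).

(* Main.v *)
(** In the variable t = |x|^n a radial function is a function on ]0, 1[, and
    Lebesgue measure on the ball is pushed to a multiple of Lebesgue measure.
    With c = lambda + sigma, testing the equation against radial functions v,
    whose Laplacian is of the form 2 n p'(t), shows that u = phi - <phi>, seen as
    a function of t, satisfies
      |u(a) - u(b)| <= K b^(2/n) int_0^b |u(t)| / max(a, t) dt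
    at its Lebesgue points a < b.  For u square integrable this inequality forces
    u = 0 as soon as u vanishes at one small b: iterating it improves the bound
    on u below b, and a Volterra argument continues the zero set up to t = 1.
    Given two radial eigenfunctions, some nontrivial combination of u1 and u2
    vanishes at a prescribed small b; the same combination of phi1 and phi2 is then
    constant, and the constant is 0 because a function of H^1_0 has zero trace. *)

From HB Require Import structures.
Require Import Defs.
From mathcomp Require Import all_boot all_order all_algebra.
From mathcomp Require Import all_classical all_reals all_analysis.
From mathcomp Require Import measurable_realfun ring lra.
Import Order.TTheory GRing.Theory Num.Theory.
Import numFieldNormedType.Exports.

Set Implicit Arguments.
Unset Strict Implicit.
Unset Printing Implicit Defensive.

Local Open Scope classical_set_scope.
Local Open Scope ring_scope.

(** An eigenfunction is only a class in H^1_0, and [radial] only holds almost everywhere: there are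
    no point values, no radial derivative and no Cauchy data at the origin. Hence both derivatives
    are put on the test function, and point values are read at Lebesgue points of a measurable
    profile. The mean <phi> is treated as a mere number m, which turns the nonlocal equation into
    the local linear one -Delta phi = c V (phi - m) with bounded V and c of any sign. A regular
    radial solution would be fixed by its value at 0; since u might a priori blow up there, its
    value at one small b takes over this role. The factor b^(2/n) makes the constant small, and
    t^(-1/2) serves as comparison function: square integrability bounds the right-hand side by a
    multiple of a^(-1/2), and integrating t^(-1/2) against 1/max(a, t) gives back at most 4
    a^(-1/2). *)

(** * Borel measurability for the coordinate sigma-algebra *)

Lemma open_measurable_rV (R : realType) (n : nat) (U : set 'rV[R]_n) :
  open U -> measurable U.
Proof.
move=> oU.
(* Sup-norm balls are boxes, hence lie in the coordinate sigma-algebra; [U] is the union of the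
   countably many balls with rational centre and radius [1/(k+1)] that it contains. *)
pose q2r (q : 'rV[rat]_n) : 'rV[R]_n := \row_j ratr (q ord0 j).
pose cell (p : 'rV[rat]_n * nat) : set 'rV[R]_n := ball (q2r p.1) p.2.+1%:R^-1.
pose F p : set 'rV[R]_n := if `[< cell p `<=` U >] then cell p else set0.
have mcell p : measurable (cell p).
  have -> : cell p = \big[setI/setT]_(i < n)
      ((fun x : 'rV[R]_n => x ord0 i : measurableTypeR R) @^-1`
         (ball (q2r p.1 ord0 i) p.2.+1%:R^-1)).
    rewrite -bigcap_seq; apply/seteqP; split => x /=.
      by move=> [_ h] i _; exact: h.
    move=> h; split; first by rewrite invr_gt0.
    by move=> i j; rewrite (ord1 i); apply: h; rewrite /= mem_index_enum.
  apply: bigsetI_measurable => i _; rewrite -[X in measurable X]setTI.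
  exact: measurable_rV_coord (measurable_ball _ _).
have -> : U = \bigcup_p F p.
  apply/seteqP; split => [x Ux|x [p _]]; last first.
    by rewrite /F; case: ifPn => // /asboolP; apply.
  have /nbhs_ballP [e /= e0 xeU] := open_nbhs_nbhs (conj oU Ux).
  have [k ke] : exists k : nat, k.+1%:R^-1 < e / 2.
    have e20 : 0 < e / 2 by rewrite divr_gt0.
    exists (Num.truncn (e / 2)^-1).
    rewrite invf_plt ?posrE//.
    by have := Num.Theory.truncnS_gt (e / 2)^-1; rewrite ?realV ?gtr0_real.
  have k0 : 0 < k.+1%:R^-1 :> R by rewrite invr_gt0.
  set ek : R := k.+1%:R^-1 in ke k0.
  have /choice[q qP] (i : 'I_n) : exists q : rat, `|ratr q - x ord0 i| < ek.
    have [|q] := @rat_in_itvoo R (x ord0 i - ek) (x ord0 i + ek).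
      lra.
    by rewrite in_itv/= => /andP[q1 q2]; exists q; rewrite ltr_distl q1.
  pose qv : 'rV[rat]_n := \row_j q j.
  have xq : ball (q2r qv) ek x.
    by split => // i j; rewrite (ord1 i) -ball_normE /ball_/= /q2r !mxE; exact: qP.
  exists (qv, k) => //; rewrite /F ifT//; apply/asboolP => y /= qy.
  apply: xeU; apply: (@le_ball _ _ _ (ek + ek)); first by lra.
  exact: ball_triangle (ball_sym xq) qy.
apply: countable_bigcupT_measurable => [|p]; first exact: countableP.
by rewrite /F; case: ifPn.
Qed.

Lemma within_continuous_measurable_rV (R : realType) (n : nat)
    (D : set 'rV[R]_n) (f : 'rV[R]_n -> R) :
  open D -> {within D, continuous f} ->
  measurable_fun D (f : 'rV[R]_n -> measurableTypeR R).
Proof.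
move=> oD; rewrite continuous_open_subspace// => cf.
apply: (measurability _ (RGenOpens.measurableE R)) => _ [_ [a [b ->] <-]].
apply: open_measurable_rV; rewrite openE => x [Dx fx].
have : nbhs (f x) `]a, b[%classic by apply: open_nbhs_nbhs; split.
move=> /cf => /(_ (mem_set Dx)) h.
by apply: filterI => //; exact: open_nbhs_nbhs.
Qed.

Lemma continuous_measurable_rV (R : realType) (n : nat) (D : set 'rV[R]_n)
    (f : 'rV[R]_n -> R) :
  continuous f -> measurable D -> measurable_fun D (f : 'rV[R]_n -> measurableTypeR R).
Proof.
move=> cf mD; apply: (@measurable_funS _ _ _ _ setT) => //.
apply: within_continuous_measurable_rV; first exact: openT.
by apply: continuous_subspaceT.
Qed.

Lemma continuous_rV_coord (R : realType) (n : nat) (i : 'I_n) :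
  continuous (fun x : 'rV[R]_n => x ord0 i).
Proof. exact: coord_continuous. Qed.

Lemma continuous_sqnorm (R : realType) (n : nat) :
  continuous (fun x : 'rV[R]_n => \sum_(i < n) x ord0 i ^+ 2).
Proof.
elim: (index_enum _) => [|i s IH] /=.
  by under eq_fun do rewrite big_nil; exact: cst_continuous.
under eq_fun do rewrite big_cons.
have cf : continuous (fun x : 'rV[R]_n => x ord0 i ^+ 2).
  move=> x.
  apply: (@continuous_comp _ _ _ (fun y : 'rV[R]_n => y ord0 i) (fun t : R => t ^+ 2)).
    exact: continuous_rV_coord.
  exact: exprn_continuous.
by move=> x; exact: cvgD (cf x) (IH x).
Qed.

Lemma continuous_enorm (R : realType) (n : nat) : continuous (@enorm R n).
Proof.
move=> x; apply: continuous_comp; first exact: continuous_sqnorm.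
exact: sqrt_continuous.
Qed.

Lemma open_unit_ball (R : realType) (n : nat) : open (unit_ball R n).
Proof.
have -> : unit_ball R n = @enorm R n @^-1` [set t | t < 1] by [].
by apply: open_comp => [x _|]; [exact: continuous_enorm|exact: open_lt].
Qed.

Lemma measurable_unit_ball (R : realType) (n : nat) : measurable (unit_ball R n).
Proof. apply: open_measurable_rV; exact: open_unit_ball. Qed.
Arguments measurable_unit_ball R n : clear implicits.

(** * Lebesgue measure under dilations and radial functions *)

Lemma sigma_finite_lebesgue_rV (R : realType) (n : nat) :
  sigma_finite [set: 'rV[R]_n] (lebesgue_rV R n).
Proof.
pose b (k : nat) : 'rV[R]_n := const_mx k%:R.
pose F k := [set x : 'rV[R]_n | forall i, (- b k) ord0 i <= x ord0 i <= b k ord0 i].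
have hb k i : (- b k) ord0 i <= b k ord0 i.
  by rewrite !mxE ge0_cp.
exists F; last first.
  move=> k; have [mF ->] := @lebesgue_rV_box R n (- b k) (b k) (hb k).
  by split => //; exact: ltry.
apply/seteqP; split => // x _.
pose M := \sum_(i < n) `|x ord0 i|.
exists (Num.truncn M).+1 => // i; rewrite !mxE -ler_norml.
apply: le_trans (ltW (truncnS_gt M)).
rewrite /M (bigD1 i)//= lerDl; exact: sumr_ge0.
Qed.

(** A copy of [lebesgue_rV], convertible to it, that carries the sigma-finite structure required by
    Fubini and by the uniqueness of product measures. *)
Definition sf_lebesgue_rV (R : realType) (n : nat) : set 'rV[R]_n -> \bar R :=
  lebesgue_rV R n.

HB.instance Definition _ (R : realType) (n : nat) :=
  Measure.copy (@sf_lebesgue_rV R n) (lebesgue_rV R n).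
HB.instance Definition _ (R : realType) (n : nat) :=
  Measure_isSigmaFinite.Build _ _ _ (@sf_lebesgue_rV R n)
    (@sigma_finite_lebesgue_rV R n).

(** The image of Lebesgue measure under multiplication by [r], rescaled by [r], gives each half-open
    interval its length, so uniqueness applies. *)
Lemma lebesgue_measure_scale (R : realType) (r : R) (A : set (measurableTypeR R)) :
  0 < r -> measurable A ->
  lebesgue_measure [set t | A (r * t)] = ((r^-1)%:E * lebesgue_measure A)%E.
Proof.
move=> r0 mA.
have mr : measurable_fun setT ( *%R r : measurableTypeR R -> measurableTypeR R).
  exact: mulrl_measurable.
pose m' : measure (measurableTypeR R) R := mscale (NngNum (ltW r0))
  (measure_function_pushforward__canonical__measure_function_Measure
     (@lebesgue_measure R) mr).
have -> : lebesgue_measure A = m' A.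
  apply: lebesgue_measure_unique => // _ [[a b] _ <-]; rewrite /m'/= /mscale/= /pushforward/=.
  have -> : *%R r @^-1` `]a, b]%classic = `]a / r, b / r]%classic.
    by apply/seteqP; split => t /=; rewrite !in_itv/= ltr_pdivrMr// ler_pdivlMr// mulrC.
  rewrite !lebesgue_measure_itv/= !lte_fin ltr_pM2r ?invr_gt0//.
  case: ifP => _; last by rewrite mule0.
  by rewrite -!EFinB -EFinM; congr EFin; field; rewrite gt_eqF.
rewrite /m'/= /mscale/= /pushforward muleA -EFinM mulVf ?gt_eqF// mul1e.
by [].
Qed.

Lemma measurable_scale_rV (R : realType) (n : nat) (r : R) :
  measurable_fun setT (fun x : 'rV[R]_n => r *: x).
Proof.
apply: measurable_fun_rV => i; under eq_fun do rewrite mxE.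
apply: (@measurable_funM _ 'rV[R]_n R _ (cst r)) => //; exact: measurable_rV_coord.
Qed.

(** Induction on the dimension: by uniqueness of the product measure it is enough to compare on
    rectangles, where the factors [r^-n] and [r^-1] multiply. *)
Lemma lebesgue_rV_scale (R : realType) (n : nat) (r : R) (A : set 'rV[R]_n) :
  0 < r -> measurable A ->
  lebesgue_rV R n [set x | A (r *: x)] = ((r ^- n)%:E * lebesgue_rV R n A)%E.
Proof.
move=> r0; elim: n A => [|n IH] A mA.
  rewrite expr0 invr1 mul1e; congr (lebesgue_rV R 0 _).
  by apply/seteqP; split => x /=; rewrite [r *: x]thinmx0 [x]thinmx0.
pose mu := @sf_lebesgue_rV R n.
pose g (p : 'rV[R]_n * measurableTypeR R) : 'rV[R]_n * measurableTypeR R :=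
  (r *: p.1, r * p.2).
have mg : measurable_fun setT g.
  apply: measurable_fun_pair.
    exact: (measurableT_comp (@measurable_scale_rV R n r) measurable_fst).
  exact: (@measurable_funM _ _ R _ (cst r) snd).
have rn0 : 0 <= r ^+ n.+1 by rewrite exprn_ge0// ltW.
pose m' : measure _ R := mscale (NngNum rn0)
  (measure_function_pushforward__canonical__measure_function_Measure
     (mu \x @lebesgue_measure R)%E mg).
have mcA : measurable (@cons_rV R n @^-1` A).
  by rewrite -[X in measurable X]setTI; exact: measurable_cons_rV.
have key : (mu \x lebesgue_measure)%E (@cons_rV R n @^-1` A) = m' (@cons_rV R n @^-1` A).
  apply: product_measure_unique => // B C mB mC.
  rewrite /m'/= /mscale/= /pushforward.
  have -> : g @^-1` (B `*` C) = [set x | B (r *: x)] `*` [set t | C (r * t)] by [].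
  have mB' : measurable [set x : 'rV[R]_n | B (r *: x)].
    by rewrite -[X in measurable X]setTI; exact: measurable_scale_rV.
  have mC' : measurable [set t : measurableTypeR R | C (r * t)].
    by rewrite -[X in measurable X]setTI; exact: mulrl_measurable.
  rewrite product_measure1E// [X in (_ * (X * _))%E]IH//
    [X in (_ * (_ * X))%E](@lebesgue_measure_scale R r C r0 mC).
  rewrite muleACA -EFinM !muleA -EFinM.
  have -> : r ^+ n.+1 * (r ^- n * r^-1) = 1.
    by rewrite exprS; field; rewrite gt_eqF// expf_neq0// gt_eqF.
  by rewrite mul1e.
rewrite [X in (_ * X)%E]key /m'/= /mscale/= /pushforward muleA -EFinM mulVf ?mul1e; last first.
  by rewrite expf_neq0 // gt_eqF.
congr (_ _); apply/seteqP; split => -[x t] /=; congr A; apply/rowP => i; rewrite !mxE;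
  by case: unliftP => [j _|_]; rewrite ?mxE.
Qed.

(** Up to the factor [mu B], the volume of the centred ball through [x]. In this variable the image
    of Lebesgue measure has constant density. *)
Definition radial_volume (R : realType) (n : nat) (x : 'rV[R]_n) : R := enorm x ^+ n.

Lemma enorm_ge0 (R : realType) (n : nat) (x : 'rV[R]_n) : 0 <= enorm x.
Proof. exact: sqrtr_ge0. Qed.

Lemma enormZ (R : realType) (n : nat) (r : R) (x : 'rV[R]_n) :
  enorm (r *: x) = `|r| * enorm x.
Proof.
rewrite /enorm; under eq_bigr do rewrite mxE exprMn.
by rewrite -mulr_sumr sqrtrM ?sqr_ge0// sqrtr_sqr.
Qed.

Lemma normr_coord_le_enorm (R : realType) (n : nat) (x : 'rV[R]_n) (i : 'I_n) :
  `|x ord0 i| <= enorm x.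
Proof.
rewrite -sqrtr_sqr /enorm ler_sqrt ?sqr_ge0//.
  by rewrite (bigD1 i)//= lerDl; apply: sumr_ge0 => j _; exact: sqr_ge0.
by apply: sumr_ge0 => j _; exact: sqr_ge0.
Qed.

Lemma lebesgue_rV_unit_ball_lty (R : realType) (n : nat) :
  (lebesgue_rV R n (unit_ball R n) < +oo)%E.
Proof.
have [|mF H] := @lebesgue_rV_box R n (const_mx (-1)) (const_mx 1).
  by move=> i; rewrite !mxE; lra.
have := ltry (\prod_(i < n) ((const_mx 1 : 'rV[R]_n) ord0 i - (const_mx (-1) : 'rV[R]_n) ord0 i)).
rewrite -H; apply: le_lt_trans.
apply: le_measure; rewrite ?inE//; first exact: measurable_unit_ball.
move=> x Bx i; rewrite !mxE -ler_norml.
by apply: le_trans (normr_coord_le_enorm _ _) _; exact: ltW.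
Qed.

Lemma lebesgue_rV_unit_ball_gt0 (R : realType) (n : nat) :
  (0 < lebesgue_rV R n (unit_ball R n))%E.
Proof.
(* The cube [[-r, r]^n] lies in the ball since [n r^2 = n / (n+1)^2 < 1]; the successor keeps this
   valid in dimension 0. *)
set r : R := n.+1%:R^-1.
have r0 : 0 < r by rewrite invr_gt0.
have [|mF H] := @lebesgue_rV_box R n (const_mx (- r)) (const_mx r).
  by move=> i; rewrite !mxE; lra.
apply: (@lt_le_trans _ _ (\prod_(i < n) (r + r))%:E).
  by rewrite lte_fin prodr_gt0// => i _; lra.
have -> : \prod_(i < n) (r + r) =
    \prod_(i < n) ((const_mx r : 'rV[R]_n) ord0 i - (const_mx (- r) : 'rV[R]_n) ord0 i).
  by apply: eq_bigr => i _; rewrite !mxE opprK.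
rewrite -H; apply: le_measure; rewrite ?inE//; first exact: measurable_unit_ball.
move=> x /= h; rewrite /unit_ball/= /enorm.
have -> : 1 = Num.sqrt 1 :> R by rewrite sqrtr1.
rewrite ltr_sqrt//; apply: (@le_lt_trans _ _ (\sum_(i < n) r ^+ 2)).
  apply: ler_sum => i _; rewrite -real_normK ?num_real// lerXn2r ?nnegrE ?normr_ge0 ?(ltW r0)//.
  by have := h i; rewrite !mxE -ler_norml.
rewrite sumr_const card_ord -mulr_natr expr2.
have -> : r * r * n%:R = n%:R / n.+1%:R ^+ 2 by rewrite /r; field.
rewrite ltr_pdivrMr ?exprn_gt0// mul1r -natrX ltr_nat.
by rewrite (leq_trans (ltnSn n))// leq_pmulr.
Qed.

Lemma measurable_radial_volume (R : realType) (n : nat) :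
  measurable_fun setT (@radial_volume R n : 'rV[R]_n -> measurableTypeR R).
Proof.
apply: continuous_measurable_rV => // x.
apply: (@continuous_comp _ _ _ (@enorm R n) (fun t : R => t ^+ n)).
  exact: continuous_enorm.
exact: exprn_continuous.
Qed.

(** Both sides are measures in [A], so it suffices to compare them on the half-lines []-oo, x[],
    which generate the Borel sets and are stable under intersection. For [x > 0] the preimage is the
    unit ball dilated by [x^(1/n)], of measure [x] times that of the ball. *)
Lemma pushforward_radial_volume (R : realType) (n : nat) (A : set (measurableTypeR R)) :
  (0 < n)%N -> measurable A ->
  lebesgue_rV R n (@radial_volume R n @^-1` A) =
  (lebesgue_rV R n (unit_ball R n) * lebesgue_measure (A `&` `]0%R, +oo[))%E.
Proof.
move=> n0 mA; set om := lebesgue_rV R n (unit_ball R n).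
have omfin : om \is a fin_num.
  by rewrite ge0_fin_numE; [exact: lebesgue_rV_unit_ball_lty|exact: measure_ge0].
have om0 : 0 <= fine om by apply: fine_ge0; exact: measure_ge0.
pose m1 : measure (measurableTypeR R) R :=
  measure_function_pushforward__canonical__measure_function_Measure
     (lebesgue_rV R n) (@measurable_radial_volume R n).
pose m2 : measure (measurableTypeR R) R := mscale (NngNum om0)
  (mrestr (@lebesgue_measure R) (@measurable_itv R `]0, +oo[)).
have -> : lebesgue_rV R n (@radial_volume R n @^-1` A) = m1 A by [].
rewrite -(fineK omfin).
have -> : ((fine om)%:E * lebesgue_measure (A `&` `]0%R, +oo[))%E = m2 A by [].
have rays (x : R) : m1 `]-oo, x[%classic = m2 `]-oo, x[%classic.
  rewrite /m1 /m2/= /pushforward /mscale/= /mrestr.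
  have [x0|x0] := leP x 0.
    have -> : @radial_volume R n @^-1` `]-oo, x[%classic = set0.
      apply/seteqP; split => // y /=; rewrite in_itv/= /radial_volume => yx.
      by have := exprn_ge0 n (enorm_ge0 y); lra.
    have -> : `]-oo, x[ `&` `]0, +oo[ = set0 :> set R.
      by apply/seteqP; split => // y /= []; rewrite !in_itv/= andbT => yx y0; lra.
    by rewrite !measure0 mule0.
  have -> : `]-oo, x[ `&` `]0, +oo[ = `]0, x[%classic :> set R.
    apply/seteqP; split => y /=; rewrite !in_itv/= andbT.
      by move=> [-> ->].
    by move/andP => [-> ->].
  rewrite lebesgue_measure_itv/= lte_fin x0 sube0 fineK//.
  pose r := x `^ n%:R^-1.
  have r0 : 0 < r by rewrite powR_gt0.
  have rx : r ^+ n = x.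
    by rewrite -powR_mulrn ?ltW// -powRrM mulVf ?pnatr_eq0 -?lt0n// powRr1// ltW.
  have -> : @radial_volume R n @^-1` `]-oo, x[%classic =
      [set y | unit_ball R n (r^-1 *: y)].
    apply/seteqP; split => y /=;
      rewrite in_itv/= /unit_ball/= enormZ gtr0_norm ?invr_gt0// mulrC ltr_pdivrMr// mul1r.
      by rewrite /radial_volume -rx ltr_pXn2r// ?nnegrE ?enorm_ge0// ltW.
    by rewrite /radial_volume -rx ltr_pXn2r// ?nnegrE ?enorm_ge0// ltW.
  rewrite lebesgue_rV_scale ?invr_gt0//; last exact: measurable_unit_ball.
  by rewrite exprVn invrK rx muleC.
apply: (@measure_unique _ R (measurableTypeR R) (@RGenInftyO.G R)
  (fun k : nat => `]-oo, k%:R[%classic) (RGenInftyO.measurableE R)).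
- move=> _ _ [x ->] [y ->]; exists (Num.min x y).
  by apply/seteqP; split => z /=; rewrite !in_itv/= lt_min => /andP.
- by move=> k; exists k%:R.
- apply/seteqP; split => // x _; exists (Num.truncn x).+1 => //=.
  by rewrite in_itv/= truncnS_gt.
- by move=> _ [x ->].
- move=> k; rewrite rays /m2/= /mscale/= /mrestr fineK//.
  apply: lte_mul_pinfty; [exact: measure_ge0|by []|].
  apply: (@le_lt_trans _ _ (lebesgue_measure `]0%R, k%:R[%classic)).
    apply: le_measure; rewrite ?inE//; first exact: measurableI.
    by move=> y /= []; rewrite !in_itv/= andbT => -> ->.
  by rewrite lebesgue_measure_itv/=; case: ifP => // _; rewrite -EFinB ltry.
- exact: mA.
Qed.
Section radial_integral.
Context (R : realType) (n : nat) (n_gt0 : (0 < n)%N).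
Local Notation mu := (lebesgue_rV R n).
Local Notation B := (unit_ball R n).
Local Notation lam := (@lebesgue_measure R).

Let m1 : measure (measurableTypeR R) R :=
  measure_function_pushforward__canonical__measure_function_Measure
     mu (@measurable_radial_volume R n).

Let omfin : mu B \is a fin_num.
Proof.
by rewrite ge0_fin_numE; [exact: lebesgue_rV_unit_ball_lty|exact: measure_ge0].
Qed.

Let om0 : 0 <= fine (mu B).
Proof. by apply: fine_ge0; exact: measure_ge0. Qed.

Let m2 : measure (measurableTypeR R) R := mscale (NngNum om0) lam.

Let om_gt0 : 0 < fine (mu B).
Proof. by rewrite fine_gt0// lebesgue_rV_unit_ball_gt0 lebesgue_rV_unit_ball_lty. Qed.

(** The origin: the only point of the ball that [radial_volume] does not send into []0, 1[]. *)
Let N := @radial_volume R n @^-1` [set 0].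

Let mN : measurable N.
Proof. by rewrite -[N]setTI; apply: measurable_radial_volume => //; exact: measurable_set1. Qed.

Let N0 : mu N = 0%E.
Proof.
rewrite [LHS]pushforward_radial_volume//.
have -> : [set 0] `&` `]0, +oo[ = set0 :> set R.
  by apply/seteqP; split => // y [/= ->]; rewrite in_itv/= ltxx.
by rewrite measure0 mule0.
Qed.

Let BN : B `\` N = @radial_volume R n @^-1` `]0, 1[%classic.
Proof.
have e0 := @enorm_ge0 R n.
apply/seteqP; split => x; rewrite /N /= in_itv/= /radial_volume.
  move=> [Bx /eqP xN]; rewrite lt0r xN exprn_ge0//=.
  by rewrite exprn_ilt1 -?lt0n.
move/andP => [x0 x1]; split; last by move=> xN; rewrite xN ltxx in x0.
rewrite /unit_ball/= ltNge; apply/negP => h.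
by move: x1; rewrite ltNge exprn_ege1.
Qed.

Lemma ge0_integral_unit_ball_radial (F : R -> \bar R) :
  measurable_fun [set: measurableTypeR R] F -> (forall t, 0 <= F t)%E ->
  (\int[mu]_(x in B) F (radial_volume x) = mu B * \int[lam]_(t in `]0%R, 1%R[) F t)%E.
Proof.
move=> mF F0.
have mFr : measurable_fun [set: 'rV[R]_n] (fun x => F (radial_volume x)).
  exact: (measurableT_comp mF (@measurable_radial_volume R n)).
rewrite (ge0_negligible_integral mN (measurable_unit_ball R n))//; last first.
  exact: measurable_funS mFr.
rewrite BN.
have := @ge0_integral_pushforward _ _ _ _ _ _ (@measurable_radial_volume R n) mu
  `]0, 1[%classic F.
rewrite /= => <- //; last exact: measurable_funS mF.
rewrite (@eq_measure_integral _ _ _ _ m2 m1).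
  rewrite ge0_integral_mscale//=; last exact: measurable_funS mF.
  by rewrite fineK.
move=> A mA A01; rewrite [LHS]pushforward_radial_volume//.
rewrite /m2/= /mscale/= fineK//; congr (_ * lebesgue_measure _)%E.
by apply/setIidPl => x /A01/=; rewrite !in_itv/= andbT => /andP[].
Qed.

Lemma integrable_unit_ball_radial (F : R -> R) :
  measurable_fun [set: measurableTypeR R] F ->
  mu.-integrable B (fun x => (F (radial_volume x))%:E) <->
  lam.-integrable `]0%R, 1%R[ (fun t => (F t)%:E).
Proof.
move=> mF.
have mFr : measurable_fun [set: 'rV[R]_n] (fun x => F (radial_volume x)).
  exact: (measurableT_comp mF (@measurable_radial_volume R n)).
have mF' : measurable_fun [set: measurableTypeR R] (fun t => `|F t|%:E).
  by apply/measurable_EFinP; exact: measurableT_comp.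
have H := @ge0_integral_unit_ball_radial (fun t => `|F t|%:E) mF' (fun=> normr_ge0 _).
split=> /integrableP[_ fi]; apply/integrableP; split.
- by apply/measurable_EFinP; exact: measurable_funS mF.
- rewrite /= in fi *; move: fi; rewrite H.
  case: (\int[_]_(_ in _) _)%E (@integral_ge0 _ _ _ lam `]0%R, 1%R[%classic (fun t => `|F t|%:E) (fun t _ => normr_ge0 _)) => //=.
    by move=> r _ _; exact: ltry.
  by rewrite -(fineK omfin) gt0_muley// lte_fin.
- by apply/measurable_EFinP; exact: measurable_funS mFr.
- rewrite /= in fi *; rewrite H -(fineK omfin) lte_mul_pinfty//.
Qed.

Lemma Rintegral_unit_ball_radial (F : R -> R) :
  measurable_fun [set: measurableTypeR R] F ->
  mu.-integrable B (fun x => (F (radial_volume x))%:E) ->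
  \int[mu]_(x in B) F (radial_volume x) =
  fine (mu B) * \int[lam]_(t in `]0, 1[) F t.
Proof.
move=> mF iF; have iF' := (integrable_unit_ball_radial mF).1 iF.
have mF1 : measurable_fun [set: measurableTypeR R] (fun t => (F t)%:E).
  exact/measurable_EFinP.
rewrite /Rintegral -fineM//; last exact: integrable_fin_num.
congr fine; rewrite integralE [in RHS]integralE muleBr//; last first.
  by apply: fin_num_adde_defl; rewrite fin_numN; apply: integrable_neg_fin_num.
congr (_ - _)%E.
  apply: etrans (@ge0_integral_unit_ball_radial ((fun t => (F t)%:E)^\+)%E _ _).
  - by apply: eq_integral => x _; rewrite !funeposE.
  - exact: (@measurable_funepos _ (measurableTypeR R) R setT _ mF1).
  - exact: funepos_ge0.
apply: etrans (@ge0_integral_unit_ball_radial ((fun t => (F t)%:E)^\-)%E _ _).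
- by apply: eq_integral => x _; rewrite !funenegE.
- exact: (@measurable_funeneg _ (measurableTypeR R) R setT _ mF1).
- exact: funeneg_ge0.
Qed.

Lemma ae_unit_ball_radial (P : R -> Prop) :
  {ae lam, forall t, 0 < t < 1 -> P t} ->
  {ae mu, forall x, B x -> P (radial_volume x)}.
Proof.
case=> A [mA A0 PA].
exists ((B `&` @radial_volume R n @^-1` A) `|` N); split.
- apply: measurableU => //; apply: measurableI; first exact: measurable_unit_ball.
  by rewrite -[X in measurable X]setTI; exact: measurable_radial_volume.
- apply/eqP; rewrite eq_le measure_ge0 andbT.
  have mrA : measurable (@radial_volume R n @^-1` A).
    by rewrite -[X in measurable X]setTI; exact: measurable_radial_volume.
  have mBrA := measurableI _ _ (measurable_unit_ball R n) mrA.
  apply: (le_trans (measureU2 _ mBrA mN)); rewrite [X in (_ + X)%E](_ : _ = 0%E)// adde0.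
  rewrite (@le_trans _ _ (mu (@radial_volume R n @^-1` A)))//.
    by apply: le_measure; rewrite ?inE//; exact: subIsetr.
  rewrite pushforward_radial_volume// -(fineK omfin).
  have -> : lam (A `&` `]0%R, +oo[) = 0%E.
    apply/eqP; rewrite eq_le measure_ge0 andbT -A0.
    by apply: le_measure; rewrite ?inE//; exact: measurableI.
  by rewrite mule0.
- move=> x /not_implyP[Bx nP].
  have [xN|xN] := pselect (N x); first by right.
  left; split => //; apply: PA => /= h; apply: nP; apply: h.
  have : (B `\` N) x by [].
  by rewrite BN/= in_itv.
Qed.

End radial_integral.

Lemma radial_volumeZ (R : realType) (n : nat) (r : R) (x : 'rV[R]_n) :
  0 <= r -> radial_volume (r *: x) = r ^+ n * radial_volume x.
Proof. by move=> r0; rewrite /radial_volume enormZ ger0_norm// exprMn. Qed.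

Lemma powR_invn_expr (R : realType) (n : nat) (x : R) :
  (0 < n)%N -> 0 <= x -> (x `^ n%:R^-1) ^+ n = x.
Proof.
move=> n0 x0.
by rewrite -powR_mulrn ?powR_ge0// -powRrM mulVf ?pnatr_eq0 -?lt0n// powRr1.
Qed.

Lemma expr_powR_invn (R : realType) (n : nat) (x : R) :
  (0 < n)%N -> 0 <= x -> (x ^+ n) `^ n%:R^-1 = x.
Proof.
move=> n0 x0.
by rewrite -powR_mulrn// -powRrM mulfV ?pnatr_eq0 -?lt0n// powRr1.
Qed.

(* Slicing along the rays: for almost every x0, the function phi agrees with g
   at almost every point of the ray through x0. *)
Lemma radial_measurable_profile (R : realType) (n : nat) (phi : 'rV[R]_n -> R) :
  (0 < n)%N ->
  measurable_fun (unit_ball R n) (phi : 'rV[R]_n -> measurableTypeR R) ->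
  radial (unit_ball R n) phi ->
  exists2 ga : R -> R, measurable_fun [set: measurableTypeR R] ga &
    {ae lebesgue_rV R n, forall x, unit_ball R n x -> phi x = ga (radial_volume x)}.
Proof.
move=> n0 mphi [g [N [mN N0 phig]]].
pose mu := @sf_lebesgue_rV R n.
have mpow : measurable_fun [set: measurableTypeR R]
    (fun t : measurableTypeR R => t `^ n%:R^-1 : measurableTypeR R).
  exact: measurable_powR.
pose h (p : 'rV[R]_n * measurableTypeR R) : 'rV[R]_n := (p.2 `^ n%:R^-1) *: p.1.
have mh : measurable_fun setT h.
  apply: measurable_fun_rV => i; rewrite /h; under eq_fun do rewrite mxE.
  apply: (@measurable_funM _ _ R).
    exact: (measurableT_comp mpow measurable_snd).
  exact: (measurableT_comp (measurable_rV_coord i) measurable_fst).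
pose P : set ('rV[R]_n * measurableTypeR R) := [set p | 0 < p.2] `&` h @^-1` N.
have mP : measurable P.
  apply: measurableI.
    have -> : [set p : 'rV[R]_n * measurableTypeR R | 0 < p.2] =
        setT `*` `]0, +oo[%classic.
      by apply/seteqP; split => -[x t] /=; rewrite in_itv/= andbT// => -[].
    exact: measurableX.
  by rewrite -[X in measurable X]setTI; exact: mh.
(* For fixed [t > 0] the slice of [P] is a dilate of the null set [N]; by Tonelli almost every slice
   in the other direction is null as well. *)
have slices : (\int[mu]_x `|(lebesgue_measure \o xsection P) x| = 0)%E.
  under eq_integral do rewrite gee0_abs ?measure_ge0//.
  rewrite -(indic_fubini_tonelli_FE _ mP) indic_fubini_tonelli// indic_fubini_tonelli_GE//.
  apply: integral0_eq => t _ /=.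
  have [t0|t0] := ltP 0 t; last first.
    rewrite (_ : ysection P t = set0) ?measure0//.
    by apply/seteqP; split => // x; rewrite /ysection/= inE => -[/= /lt_geF]; rewrite t0.
  have -> : ysection P t = [set x | N ((t `^ n%:R^-1) *: x)].
    by apply/seteqP; split => x; rewrite /ysection/= inE; [case|split].
  rewrite [LHS]lebesgue_rV_scale ?powR_gt0//.
  by rewrite N0 mule0.
have /(ae_eq_integral_abs mu measurableT) ae1 := slices.
have ae2 : {ae mu, forall x, 0 < radial_volume x}.
  exists (@radial_volume R n @^-1` [set 0]); split.
  - by rewrite -[X in measurable X]setTI; apply: measurable_radial_volume => //;
      exact: measurable_set1.
  - rewrite [LHS]pushforward_radial_volume//.
    have -> : [set 0] `&` `]0, +oo[ = set0 :> set R.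
      by apply/seteqP; split => // y [/= ->]; rewrite in_itv/= ltxx.
    by rewrite measure0 mule0.
  - move=> x /= /negP; rewrite -leNgt => x0; apply/eqP; rewrite eq_le x0/=.
    exact/exprn_ge0/enorm_ge0.
have [x0 [Px0 t0_gt0]] : exists x0, lebesgue_measure (xsection P x0) = 0%E /\
    0 < radial_volume x0.
  apply: contrapT => /forallNP nex.
  have : {ae mu, forall x : 'rV[R]_n, False}.
    apply: filterS2 ae2 (ae1 _) => [x h1 h2|]; last first.
      exact: measurable_fun_xsection.
    by apply: (nex x); split => //; exact: h2.
  case=> A [mA A0 sA]; have := lebesgue_rV_unit_ball_gt0 R n.
  rewrite ltNge => /negP; apply; rewrite -[leRHS]A0.
  apply: le_measure; rewrite ?inE//; first exact: measurable_unit_ball.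
  by move=> x _; apply: sA => /=.
set t0 := radial_volume x0 in t0_gt0.
(* [k t] is the point of the ray through [x0] with radial volume [t]. Composing [phi] with [k] gives
   a measurable profile, although the [g] provided by [radial] is arbitrary. *)
pose k (t : measurableTypeR R) : 'rV[R]_n := ((t0^-1 * t) `^ n%:R^-1) *: x0.
have mk : measurable_fun setT k.
  apply: measurable_fun_rV => i; rewrite /k; under eq_fun do rewrite mxE.
  apply: (@measurable_funM _ _ R); last exact: measurable_cst.
  apply: (measurableT_comp mpow).
  exact: mulrl_measurable.
have kE t : 0 < t -> radial_volume (k t) = t.
  move=> tt; rewrite /k radial_volumeZ ?powR_ge0// powR_invn_expr//.
    by rewrite mulrAC mulVf ?mul1r// gt_eqF.
  by rewrite mulr_ge0// ?invr_ge0 ltW.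
exists ((phi \_ (unit_ball R n)) \o k).
  apply: measurableT_comp => //.
  by apply/(measurable_restrictT _ (measurable_unit_ball R n)).
have : {ae lebesgue_measure, forall t : R, 0 < t < 1 ->
    (phi \_ (unit_ball R n) \o k) t = g (t `^ n%:R^-1)}.
  exists [set t | xsection P x0 (t0^-1 * t)]; split.
  - have mm : measurable_fun [set: measurableTypeR R]
        ( *%R t0^-1 : measurableTypeR R -> measurableTypeR R).
      exact: mulrl_measurable.
    rewrite -[X in measurable X]setTI; apply: mm => //; exact: measurable_xsection.
  - rewrite lebesgue_measure_scale ?invr_gt0//; last exact: measurable_xsection.
    by rewrite Px0 mule0.
  - move=> t /not_implyP[/andP[tt t1] /= neq].
    rewrite /xsection/= inE; split => /=; first by rewrite mulr_gt0// invr_gt0.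
    apply: phig => /= imp; apply: neq.
    have en : enorm (k t) = t `^ n%:R^-1.
      by rewrite -[in RHS](kE t tt) /radial_volume expr_powR_invn// enorm_ge0.
    have Bk : unit_ball R n (k t).
      rewrite /unit_ball/= ltNge; apply/negP => /(exprn_ege1 n).
      by rewrite -/(radial_volume _) kE// leNgt t1.
    by rewrite patchE mem_set// -en; exact: imp.
have aeg : {ae lebesgue_rV R n, forall x, unit_ball R n x -> phi x = g (enorm x)}.
  by exists N.
move/(ae_unit_ball_radial n0); apply: filterS2 aeg => x h1 h2 Bx.
rewrite (h2 Bx) /radial_volume expr_powR_invn ?enorm_ge0//; exact: h1.
Qed.

(** * Smooth functions of one variable *)

(** Derivatives enter as witnesses, so that stability under sums, products and affine substitutions
    is a plain induction on the order. *)
Fixpoint iter_derivable (R : realType) (k : nat) (h : R -> R) : Prop :=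
  if k is k'.+1 then
    exists2 h' : R -> R, (forall t : R, is_derive t (1 : R) h (h' t)) & iter_derivable k' h'
  else continuous h.

Definition smooth1 (R : realType) (h : R -> R) := forall k, iter_derivable k h.

Section iter_derivable_theory.
Context (R : realType).
Implicit Types (g h : R -> R) (k : nat).

Lemma is_derive_continuous h (h' : R -> R) :
  (forall t : R, is_derive t (1 : R) h (h' t)) -> continuous h.
Proof. by move=> dh t; apply/differentiable_continuous/derivable1_diffP; exact: ex_derive. Qed.

Lemma iter_derivable_continuous k h : iter_derivable k h -> continuous h.
Proof. by case: k => [//|k [h' dh _]]; exact: is_derive_continuous dh. Qed.

Lemma iter_derivableW k h : iter_derivable k.+1 h -> iter_derivable k h.
Proof.
elim: k h => [|k IH] h; first by case=> h' dh _; exact: is_derive_continuous dh.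
by case=> h' dh dh'; exists h' => //; exact: IH.
Qed.

Lemma iter_derivable_cst k (c : R) : iter_derivable k (cst c).
Proof.
elim: k c => [|k IH] c /=; first exact: cst_continuous.
by exists (cst 0) => // t; exact: is_derive_cst.
Qed.

Lemma iter_derivableD k g h :
  iter_derivable k g -> iter_derivable k h -> iter_derivable k (fun t => g t + h t).
Proof.
elim: k g h => [|k IH] g h /=; first by move=> cg ch t; exact: cvgD (cg t) (ch t).
case=> g' dg dg' [h' dh dh']; exists (fun t => g' t + h' t); last exact: IH.
by move=> t; exact: is_deriveD.
Qed.

Lemma iter_derivableM k g h :
  iter_derivable k g -> iter_derivable k h -> iter_derivable k (fun t => g t * h t).
Proof.
elim: k g h => [|k IH] g h; first by move=> cg ch t; exact: cvgM (cg t) (ch t).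
move=> sg sh; have [g' dg dg'] := sg; have [h' dh dh'] := sh.
exists (fun t => g t * h' t + h t * g' t).
  by move=> t; exact: (is_deriveM (dg t) (dh t)).
by apply: iter_derivableD; apply: IH => //; exact: iter_derivableW.
Qed.

Lemma iter_derivable_affine k h (c d : R) :
  iter_derivable k h -> iter_derivable k (fun t => h (c * t + d)).
Proof.
elim: k h => [|k IH] h /=.
  move=> ch t; apply: (@continuous_comp _ _ _ (fun t => c * t + d) h); last exact: ch.
  by apply: cvgD; [exact: mulrl_continuous|exact: cvg_cst].
case=> h' dh dh'; exists (fun t => c * h' (c * t + d)).
  move=> t; rewrite mulrC.
  apply: (@is_derive1_comp _ h (fun t => c * t + d)).
  apply: is_derive_eq (is_deriveD (is_deriveZ c (is_derive_id t 1)) (is_derive_cst d t 1)) _.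
  by rewrite addr0 /GRing.scale/= mulr1.
apply: iter_derivableM; [exact: iter_derivable_cst|exact: IH].
Qed.

End iter_derivable_theory.

Section flat_exponential.
Context (R : realType).

(** The classical flat function [exp(-1/t)] with an extra factor [t^-j]: the enlarged family is
    stable under differentiation, and its smoothness is an induction over all [j] at once. *)
Definition flat_exp (j : nat) (t : R) : R := if 0 < t then t ^- j * expR (- t^-1) else 0.

(** From [exp x >= (x / (j+1))^(j+1)] at [x = 1/t]. One power more than [t^-j] is spent, so that a
    factor [t] remains and forces the limit 0 at the origin. *)
Lemma flat_exp_le j (t : R) : 0 < t -> flat_exp j t <= j.+1%:R ^+ j.+1 * t.
Proof.
move=> t0; rewrite /flat_exp t0.
have tm : 0 < t * j.+1%:R by rewrite mulr_gt0.
have h1 : ((t * j.+1%:R)^-1) ^+ j.+1 <= expR (t^-1).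
  have -> : t^-1 = j.+1%:R * (t * j.+1%:R)^-1 by rewrite invfM mulrCA mulfV ?mulr1// pnatr_eq0.
  rewrite expRM_natl; apply: lerXn2r; rewrite ?nnegrE ?expR_ge0 ?invr_ge0 ?(ltW tm)//.
  by apply: le_trans (expR_ge1Dx _); rewrite lerDr.
rewrite expRN -ler_pdivlMl; last by rewrite invr_gt0 exprn_gt0.
rewrite invrK.
have -> : t ^+ j * (j.+1%:R ^+ j.+1 * t) = ((t * j.+1%:R)^-1 ^+ j.+1)^-1.
  by rewrite exprVn invrK exprMn (exprS t); set c := _ ^+ j.+1; ring.
by rewrite lef_pV2 ?posrE ?expR_gt0// exprn_gt0// invr_gt0.
Qed.

Lemma flat_exp_ge0 j (t : R) : 0 <= flat_exp j t.
Proof.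
rewrite /flat_exp; case: ifP => // t0.
by rewrite mulr_ge0 ?expR_ge0// invr_ge0 exprn_ge0 ?ltW.
Qed.

Lemma is_derive_flat_exp j (t : R) :
  is_derive t (1 : R) (flat_exp j) (- j%:R * flat_exp j.+1 t + flat_exp j.+2 t).
Proof.
have [t0|t0|->] := ltrgtP t 0.
- rewrite /flat_exp ltNge (ltW t0)/= mulr0 addr0.
  apply: near_eq_is_derive (is_derive_cst (0 : R) t (1 : R)).
  by near=> s; rewrite ltNge ifF//; apply/negbTE; rewrite negbK ltW//; near: s; exact: lt_nbhsl.
- have tN : t != 0 by rewrite gt_eqF.
  have tjN i : t ^+ i != 0 by rewrite expf_neq0.
  rewrite /flat_exp t0.
  apply: (@near_eq_is_derive _ _ _ (fun s : R => s^-1 ^+ j * expR (- s^-1))).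
    by near=> s; rewrite ifT ?exprVn//; near: s; exact: lt_nbhsr.
  have dV : is_derive t (1 : R) (fun s : R => s^-1) (- t ^- 2).
    apply: DeriveDef; first exact: derivableV.
    by rewrite deriveV// derive_id /GRing.scale/= mulr1.
  have dE : is_derive t (1 : R) (fun s : R => expR (- s^-1)) (expR (- t^-1) * (t ^- 2)).
    apply: (@is_derive1_comp _ expR (fun s : R => - s^-1)).
    by rewrite -[X in is_derive _ _ _ X]opprK; exact: is_deriveN.
  have dX : is_derive t (1 : R) (fun s : R => s^-1 ^+ j) (- j%:R * t ^- j.+1).
    elim: j => [|j IH].
      by rewrite oppr0 mul0r; under eq_fun do rewrite expr0; exact: is_derive_cst.
    under eq_fun do rewrite exprS.
    apply: is_derive_eq (is_deriveM dV IH) _.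
    rewrite /GRing.scale/= exprVn expr2 (exprS t j.+1) (exprS t j) -natr1.
    by field; rewrite ?tN ?(tjN j).
  apply: is_derive_eq (is_deriveM dX dE) _.
  rewrite /GRing.scale/= exprVn (exprS t j.+1) (exprS t j) expr2.
  by field; rewrite ?tN ?(tjN j).
(* At 0 the right difference quotient of [flat_exp j] is [flat_exp j.+1], which is at most [C h];
   the left one is zero. *)
- rewrite {2 3}/flat_exp ltxx mulr0 addr0.
  set C : R := j.+2%:R ^+ j.+2.
  have C0 : 0 < C by rewrite exprn_gt0.
  suff h : h^-1 *: ((flat_exp j \o shift 0) (h *: (1 : R)) - flat_exp j 0) @[h --> 0^'] --> (0 : R).
    by apply: DeriveDef; [apply/cvg_ex; exists 0|exact: cvg_lim h].
  apply/cvgr0Pnorm_le => e e0.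
  near=> h.
  have -> : (flat_exp j \o shift 0) (h *: (1 : R)) = flat_exp j h.
    by rewrite /= addr0 /GRing.scale/= mulr1.
  rewrite {2}/flat_exp ltxx subr0 /GRing.scale/=.
  have [h0|h0] := ltP 0 h; last first.
    by rewrite /flat_exp ltNge h0 mulr0 normr0 ltW.
  have -> : h^-1 * flat_exp j h = flat_exp j.+1 h.
    by rewrite /flat_exp h0 mulrA exprS invfM.
  rewrite ger0_norm ?flat_exp_ge0//; apply: (le_trans (flat_exp_le _ h0)).
  rewrite -ler_pdivlMl// mulrC ltW// (le_lt_trans (ler_norm _))//.
  near: h; apply: dnbhs0_lt; exact: divr_gt0.
Unshelve. all: by end_near. Qed.

Lemma smooth1_flat_exp j : smooth1 (flat_exp j).
Proof.
move=> k; elim: k j => [|k IH] j.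
  exact: is_derive_continuous (is_derive_flat_exp j).
exists (fun t => - j%:R * flat_exp j.+1 t + flat_exp j.+2 t).
  exact: is_derive_flat_exp.
apply: iter_derivableD => //; apply: iter_derivableM => //.
exact: iter_derivable_cst.
Qed.

End flat_exponential.

Lemma smooth1_antiderivative (R : realType) (h h' : R -> R) :
  (forall t : R, is_derive t (1 : R) h (h' t)) -> smooth1 h' -> smooth1 h.
Proof.
move=> dh sh' [|k]; first exact: is_derive_continuous dh.
by exists h'.
Qed.

(** Bounded support makes [K] integrable on every half-line, so the primitive starting at [-oo] is
    defined everywhere and the fundamental theorem of calculus applies at each point. *)
Lemma antiderivative_ex (R : realType) (K : R -> R) (c d : R) :
  continuous K -> (forall t, ~ (c <= t <= d) -> K t = 0) ->
  exists h : R -> R, forall t : R, is_derive t (1 : R) h (K t).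
Proof.
move=> cK K0.
have mK : measurable_fun [set: measurableTypeR R] K by exact: continuous_measurable_fun.
have iK (A : set (measurableTypeR R)) : measurable A ->
    lebesgue_measure.-integrable A (EFin \o K).
  move=> mA; apply: (@integrableS _ _ _ _ setT) => //.
  have -> : EFin \o K = (EFin \o K) \_ `[c, d]%classic.
    apply/funext => t; rewrite patchE; case: ifPn => // /negP tcd.
    by rewrite /= K0// => tcd'; apply: tcd; rewrite inE/= in_itv.
  apply: (@integrable_mkcond _ (measurableTypeR R) R lebesgue_measure `[c, d]%classic
    (EFin \o K) (measurable_itv `[c, d])).1.
  apply: continuous_compact_integrable; first exact: segment_compact.
  exact: continuous_subspaceT.
exists (fun x => \int[lebesgue_measure]_(t in `]-oo, x]) K t) => t.
have [||||dF F'] := @continuous_FTC1 R K -oo%O t (t + 1).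
- by rewrite ltrDl.
- exact: iK.
- by rewrite ltNyr.
- exact: cK.
by apply: DeriveDef; [exact: dF|exact: etrans (esym (derive1E _ _)) F'].
Qed.

Lemma flat_exp_gt0 (R : realType) (j : nat) (t : R) : 0 < t -> 0 < flat_exp j t.
Proof. by move=> t0; rewrite /flat_exp t0 mulr_gt0 ?expR_gt0// invr_gt0 exprn_gt0. Qed.

Lemma flat_exp0_le1 (R : realType) (t : R) : flat_exp 0 t <= 1.
Proof.
rewrite /flat_exp; case: ifP => // t0.
by rewrite expr0 invr1 mul1r -expR0 ler_expR oppr_le0 invr_ge0 ltW.
Qed.

Lemma is_derive_ge0_le (R : realType) (h h' : R -> R) (a b : R) :
  (forall t : R, is_derive t (1 : R) h (h' t)) -> (forall t, 0 <= h' t) ->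
  a <= b -> h a <= h b.
Proof.
move=> dh h'0 ab; have [|c _ E] := MVT_segment ab (fun t _ => dh t).
  exact/continuous_subspaceT/(is_derive_continuous dh).
by rewrite -subr_ge0 E mulr_ge0// subr_ge0.
Qed.

(** [Th] is the normalised primitive of [exp(-1/t) exp(-1/(1-t))] on []0, 1[]. Its derivative [th]
    is exported with its bounds because it is the mollifier used at Lebesgue points. *)
Lemma smooth_step_ex (R : realType) : exists (Th th : R -> R) (C : R),
  [/\ smooth1 Th, (forall t : R, is_derive t (1 : R) Th (th t)),
      (forall t, t <= 0 -> Th t = 0), (forall t, 1 <= t -> Th t = 1) &
      [/\ forall t, 0 <= Th t <= 1, forall t, 0 <= th t <= C,
          (forall t, t <= 0 -> th t = 0), (forall t, 1 <= t -> th t = 0) & continuous th]].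
Proof.
pose rho (t : R) := flat_exp 0 t * flat_exp 0 (-1 * t + 1).
have srho : smooth1 rho.
  move=> k; apply: iter_derivableM; first exact: smooth1_flat_exp.
  by apply: iter_derivable_affine; exact: smooth1_flat_exp.
have rho0 t : 0 <= rho t by rewrite mulr_ge0 ?flat_exp_ge0.
have rho1 t : rho t <= 1.
  by rewrite mulr_ile1 ?flat_exp_ge0 ?flat_exp0_le1.
have rhoL t : t <= 0 -> rho t = 0.
  by move=> t0; rewrite /rho /flat_exp ltNge t0 mul0r.
have rhoR t : 1 <= t -> rho t = 0.
  by move=> t1; rewrite /rho /flat_exp (_ : 0 < -1 * t + 1 = false) ?mulr0//; apply/negbTE; lra.
have crho : continuous rho := iter_derivable_continuous (srho 0%N).
have [|h dh] := antiderivative_ex (c := 0) (d := 1) crho.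
  move=> t /negP; rewrite negb_and -!ltNge => /orP[t0|t1]; first by rewrite rhoL// ltW.
  by rewrite rhoR// ltW.
have hle a b : a <= b -> h a <= h b by exact: is_derive_ge0_le dh rho0.
have hL t : t <= 0 -> h t = h 0.
  move=> t0; have [|c] := MVT_segment t0 (fun t _ => dh t).
    exact/continuous_subspaceT/(is_derive_continuous dh).
  rewrite in_itv/= => /andP[_ c0]; rewrite rhoL// mul0r => /eqP.
  by rewrite subr_eq0 => /eqP.
have hR t : 1 <= t -> h t = h 1.
  move=> t1; have [|c] := MVT_segment t1 (fun t _ => dh t).
    exact/continuous_subspaceT/(is_derive_continuous dh).
  rewrite in_itv/= => /andP[c0 _]; rewrite rhoR// mul0r => /eqP.
  by rewrite subr_eq0 => /eqP.
have h01 : h 0 < h 1.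
  apply: (@gtr0_derive1_incr R h 0 1) => //; rewrite ?ltr01//.
  - by move=> x; rewrite in_itv/= => /andP[x0 x1]; rewrite derive1E derive_val;
      rewrite mulr_gt0// flat_exp_gt0//; lra.
  - exact/continuous_subspaceT/(is_derive_continuous dh).
pose c := (h 1 - h 0)^-1.
have c0 : 0 < c by rewrite invr_gt0 subr_gt0.
exists (fun t => c * (h t - h 0)), (fun t => c * rho t), c.
have dTh t : is_derive t (1 : R) (fun t => c * (h t - h 0)) (c * rho t).
  apply: is_derive_eq (is_deriveZ c (is_deriveB (dh t) (is_derive_cst (h 0) t 1))) _.
  by rewrite subr0.
split.
- apply: smooth1_antiderivative dTh _ => k.
  by apply: iter_derivableM; [exact: iter_derivable_cst|exact: srho].
- exact: dTh.
- by move=> t /hL ->; rewrite subrr mulr0.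
- by move=> t /hR ->; rewrite mulVf// gt_eqF// subr_gt0.
split.
- move=> t; have ht : h 0 <= h t <= h 1.
    have [t0|t0] := leP t 0; first by rewrite hL// lexx ltW.
    have [t1|t1] := leP t 1; first by rewrite !hle// ltW.
    by rewrite (hR t) ?lexx ?andbT ltW.
  case/andP: ht => ht1 ht2; rewrite mulr_ge0 ?subr_ge0 ?(ltW c0)//=.
  by rewrite /c ler_pdivrMl ?subr_gt0// mulr1 lerB.
- by move=> t; rewrite mulr_ge0 ?(ltW c0)//= ler_piMr// ltW.
- by move=> t /rhoL ->; rewrite mulr0.
- by move=> t /rhoR ->; rewrite mulr0.
- move=> t; apply: cvgM; [exact: cvg_cst|exact: crho].
Qed.

(* For [p] vanishing near the nonpositive half-line this is the smooth function
   t |-> p (t^a) t^b, extended by zero to t <= 0. *)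
Definition powcomp (R : realType) (p : R -> R) (a b t : R) : R :=
  if 0 < t then p (t `^ a) * t `^ b else 0.

Section powcomp_theory.
Context (R : realType) (a : R) (a_gt0 : 0 < a).

Lemma powcomp_small (p : R -> R) (b d t : R) :
  0 < d -> (forall s, s < d -> p s = 0) -> t < d `^ a^-1 -> powcomp p a b t = 0.
Proof.
move=> d0 p0 td; rewrite /powcomp; case: ifP => // t0.
rewrite p0 ?mul0r//.
have -> : d = (d `^ a^-1) `^ a by rewrite -powRrM mulVf ?gt_eqF// powRr1// ltW.
by rewrite gt0_ltr_powR// nnegrE ?powR_ge0// ltW.
Qed.

Lemma is_derive_powcomp (p p' : R -> R) (b d t : R) :
  0 < d -> (forall s, s < d -> p s = 0) ->
  (forall s : R, is_derive s (1 : R) p (p' s)) ->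
  is_derive t (1 : R) (powcomp p a b)
    (a * powcomp p' a (a - 1 + b) t + b * powcomp p a (b - 1) t).
Proof.
move=> d0 p0 dp.
have [t0|t0] := ltP 0 t.
  have dpow (e : R) := is_derive1_powR e t0.
  have dc : is_derive t (1 : R) (fun s => p (s `^ a)) (p' (t `^ a) * (a * t `^ (a - 1))).
    exact: (@is_derive1_comp _ p (fun s => s `^ a)).
  rewrite /powcomp t0.
  apply: (@near_eq_is_derive _ _ _ (fun s : R => p (s `^ a) * s `^ b)).
    by near=> s; rewrite ifT//; near: s; exact: lt_nbhsr.
  apply: is_derive_eq (is_deriveM dc (dpow b)) _.
  rewrite /GRing.scale/= [t `^ (a - 1 + b)]powRD; last by rewrite (gt_eqF t0) implybT.
  ring.
rewrite /powcomp ltNge t0/= !mulr0 addr0.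
apply: near_eq_is_derive (is_derive_cst (0 : R) t (1 : R)).
near=> s; apply/esym/(powcomp_small _ d0 p0).
near: s; apply: lt_nbhsl; rewrite (le_lt_trans t0)// powR_gt0//.
Unshelve. all: by end_near. Qed.

(** A derivative of [powcomp] is a combination of functions of the same kind, with [p'] for [p] or
    another exponent [b]; the induction therefore runs over all [p] and [b]. *)
Lemma smooth1_powcomp (p : R -> R) (b d : R) :
  0 < d -> (forall s, s < d -> p s = 0) -> smooth1 p -> smooth1 (powcomp p a b).
Proof.
move=> d0 p0 sp k; elim: k p b p0 sp => [|k IH] p b p0 sp.
  have [p' dp _] := sp 1%N.
  exact: is_derive_continuous (fun t => is_derive_powcomp b t d0 p0 dp).
have [p' dp sp'] : exists2 p', (forall s : R, is_derive s (1 : R) p (p' s)) & smooth1 p'.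
  have [p' dp _] := sp 1%N; exists p' => // j.
  have [p1 dp1 sp1] := sp j.+1.
  suff -> : p' = p1 by [].
  by apply/funext => s; rewrite -(derive_val (is_derive := dp s)) -(derive_val (is_derive := dp1 s)).
exists (fun t => a * powcomp p' a (a - 1 + b) t + b * powcomp p a (b - 1) t).
  by move=> t; exact: is_derive_powcomp d0 p0 dp.
apply: iter_derivableD; apply: iter_derivableM; try exact: iter_derivable_cst.
  apply: IH => // s sd.
  (* The derivative [p'] inherits the vanishing below [d], since [p] is locally constant there. *)
  have h : is_derive s (1 : R) p 0.
    apply: near_eq_is_derive (is_derive_cst (0 : R) s (1 : R)).
    by near=> r; rewrite p0//; near: r; exact: lt_nbhsl.
  by rewrite -(derive_val (is_derive := dp s)) (derive_val (is_derive := h)).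
exact: IH.
Unshelve. all: by end_near. Qed.

End powcomp_theory.

(** * Radial test functions *)

Lemma normr_le_enorm (R : realType) (n : nat) (x : 'rV[R]_n) : `|x| <= enorm x.
Proof.
rewrite [leLHS]mx_normrE; apply/bigmax_leP; split=> [|[i j] _/=]; first exact: enorm_ge0.
by rewrite (ord1 i) normr_coord_le_enorm.
Qed.

(** The counterpart of [iter_derivable] in several variables. Continuity is demanded at every order
    because the existence of partial derivatives does not imply it. *)
Fixpoint iter_partial (R : realType) (n k : nat) (u : 'rV[R]_n -> R) : Prop :=
  continuous u /\
  if k is k'.+1 then forall i, exists2 u' : 'rV[R]_n -> R,
    (forall x, is_derive x (ebasis R i) u (u' x)) & iter_partial k' u'
  else True.

Section iter_partial_theory.
Context (R : realType) (n : nat).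
Implicit Types (u v : 'rV[R]_n -> R) (k : nat).

Lemma iter_partial_continuous k u : iter_partial k u -> continuous u.
Proof. by case: k => [[]|k []]. Qed.

Lemma partial_eq u (u' : 'rV[R]_n -> R) i :
  (forall x, is_derive x (ebasis R i) u (u' x)) -> 'D_(ebasis R i) u = u'.
Proof. by move=> du; apply/funext => x; exact: derive_val. Qed.

Lemma partials_rcons s i u :
  partials (rcons s i) u = partials s ('D_(ebasis R i) u).
Proof. by rewrite /partials foldr_rcons. Qed.

Lemma smooth_partial u i : smooth u -> smooth ('D_(ebasis R i) u).
Proof. by move=> su s; rewrite -partials_rcons; exact: su. Qed.

Lemma smooth_iter_partial k u : smooth u -> iter_partial k u.
Proof.
elim: k u => [|k IH] u su; first by split; [exact: (su [::]).1|].
split=> [|i]; first exact: (su [::]).1.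
exists ('D_(ebasis R i) u); last by apply: IH; exact: smooth_partial.
by move=> x; apply: DeriveDef => //; exact: (su [::]).2.
Qed.

Lemma iter_partial_smooth u : (forall k, iter_partial k u) -> smooth u.
Proof.
move=> su s; suff ss : forall k, iter_partial k (partials s u).
  split; first exact: iter_partial_continuous (ss 0%N).
  by move=> x i; have [_ /(_ i)[u' du _]] := ss 1%N; exact: ex_derive.
elim: s => // i s IH k.
by have [_ /(_ i)[u' du' su']] := IH k.+1; rewrite /= (partial_eq du').
Qed.

Lemma iter_partialW k u : iter_partial k.+1 u -> iter_partial k u.
Proof.
elim: k u => [|k IH] u [cu su] //; split=> // i.
by have [u' du /IH su'] := su i; exists u'.
Qed.

Lemma iter_partial_cst k (c : R) : iter_partial k (fun _ : 'rV[R]_n => c).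
Proof.
elim: k c => [|k IH] c; first by split=> //; exact: cst_continuous.
split=> [|i]; first exact: cst_continuous.
by exists (fun=> 0) => // x; exact: is_derive_cst.
Qed.

Lemma iter_partialD k u v :
  iter_partial k u -> iter_partial k v -> iter_partial k (fun x => u x + v x).
Proof.
elim: k u v => [|k IH] u v [cu su] [cv sv];
  have cuv : continuous (fun x => u x + v x) by move=> x; exact: cvgD (cu x) (cv x).
- by [].
- split=> // i; have [u' du su'] := su i; have [v' dv sv'] := sv i.
  by exists (fun x => u' x + v' x); [move=> x; exact: is_deriveD|exact: IH].
Qed.

Lemma iter_partialM k u v :
  iter_partial k u -> iter_partial k v -> iter_partial k (fun x => u x * v x).
Proof.
elim: k u v => [|k IH] u v su sv;
  have cu := iter_partial_continuous su; have cv := iter_partial_continuous sv;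
  have cuv : continuous (fun x => u x * v x) by move=> x; exact: cvgM (cu x) (cv x).
- by [].
- split=> // i; have [_ /(_ i)[u' du su']] := su; have [_ /(_ i)[v' dv sv']] := sv.
  exists (fun x => u x * v' x + v x * u' x).
    by move=> x; exact: (is_deriveM (du x) (dv x)).
  by apply: iter_partialD; apply: IH => //; exact: iter_partialW.
Qed.

Lemma is_derive_line u (x v : 'rV[R]_n) (d : R) :
  is_derive (0 : R) (1 : R) (fun s : R => u (s *: v + x)) d -> is_derive x v u d.
Proof.
set g := (fun s : R => _) => dg.
have E : (fun h : R => h^-1 *: ((u \o shift x) (h *: v) - u x)) =
    (fun h : R => h^-1 *: ((g \o shift 0) (h *: (1 : R)) - g 0)).
  apply/funext => h; rewrite /g /= addr0 scale0r add0r.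
  by rewrite [h *: 1]/GRing.scale/= mulr1.
apply: DeriveDef; rewrite /derivable /derive E; first exact: (ex_derive (is_derive := dg)).
exact: (derive_val (is_derive := dg)).
Qed.

Lemma is_derive_coord (i j : 'I_n) (x : 'rV[R]_n) :
  is_derive x (ebasis R i) (fun y : 'rV[R]_n => y ord0 j) (j == i)%:R.
Proof.
apply: is_derive_line.
have -> : (fun s : R => (s *: ebasis R i + x) ord0 j) =
    (fun s : R => (j == i)%:R * s + x ord0 j).
  by apply/funext => s; rewrite !mxE eqxx/= mulrC.
apply: is_derive_eq
  (is_deriveD (is_deriveZ _ (is_derive_id (0 : R) (1 : R))) (is_derive_cst (x ord0 j) (0 : R) (1 : R))) _.
by rewrite addr0 /GRing.scale/= mulr1.
Qed.

Lemma iter_partial_coord k (j : 'I_n) : iter_partial k (fun x : 'rV[R]_n => x ord0 j).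
Proof.
case: k => [|k]; split=> //; try exact: continuous_rV_coord.
by move=> i; exists (fun=> (j == i)%:R); [exact: is_derive_coord|exact: iter_partial_cst].
Qed.

(** Radial test functions are written in this polynomial variable, so that the singularity of
    [enorm] at the origin never enters. *)
Definition sqnorm (x : 'rV[R]_n) : R := \sum_(i < n) x ord0 i ^+ 2.

Lemma sqnorm_ge0 x : 0 <= sqnorm x.
Proof. by apply: sumr_ge0 => i _; exact: sqr_ge0. Qed.

Lemma enorm_sqr (x : 'rV[R]_n) : enorm x ^+ 2 = sqnorm x.
Proof. by rewrite sqr_sqrtr// sqnorm_ge0. Qed.

Lemma is_derive_sqnorm_comp (h h' : R -> R) (i : 'I_n) (x : 'rV[R]_n) :
  (forall t : R, is_derive t (1 : R) h (h' t)) ->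
  is_derive x (ebasis R i) (fun y => h (sqnorm y)) (2 * x ord0 i * h' (sqnorm x)).
Proof.
move=> dh; apply: is_derive_line.
have E (s : R) : sqnorm (s *: ebasis R i + x) = s * s + ((2 * x ord0 i) * s + sqnorm x).
  rewrite /sqnorm (bigD1 i)//= [in RHS](bigD1 i)//=.
  rewrite !mxE !eqxx/= mulr1 (eq_bigr (fun j => x ord0 j ^+ 2)); last first.
    by move=> j /negbTE ji; rewrite !mxE eqxx/= ji mulr0 add0r.
  ring.
under eq_fun do rewrite E.
have dl : is_derive (0 : R) (1 : R) (fun s : R => s * s + ((2 * x ord0 i) * s + sqnorm x))
    (2 * x ord0 i).
  apply: is_derive_eq (is_deriveD (is_deriveM (is_derive_id (0 : R) (1 : R)) (is_derive_id (0 : R) (1 : R)))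
    (is_deriveD (is_deriveZ (2 * x ord0 i) (is_derive_id (0 : R) (1 : R)))
      (is_derive_cst (sqnorm x) (0 : R) (1 : R)))) _.
  by rewrite /GRing.scale/= mul0r !add0r addr0 mulr1.
have := is_derive1_comp (dh _) dl.
rewrite [X in h' X](_ : _ = sqnorm x); last by rewrite mul0r mulr0 !add0r.
by rewrite [h' _ * _]mulrC.
Qed.

Lemma iter_partial_sqnorm_comp k (h : R -> R) :
  iter_derivable k h -> iter_partial k (fun x => h (sqnorm x)).
Proof.
elim: k h => [|k IH] h sh;
  have ch : continuous (fun x : 'rV[R]_n => h (sqnorm x)).
- move=> x; apply: (@continuous_comp _ _ _ sqnorm h); first exact: continuous_sqnorm.
  exact: iter_derivable_continuous sh _.
- by [].
- move=> x; apply: (@continuous_comp _ _ _ sqnorm h); first exact: continuous_sqnorm.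
  exact: iter_derivable_continuous sh _.
- split=> // i; have [h' dh sh'] := sh.
  exists (fun x : 'rV[R]_n => 2 * x ord0 i * h' (sqnorm x)).
    by move=> x; exact: is_derive_sqnorm_comp.
  apply: iter_partialM; last exact: IH.
  by apply: iter_partialM; [exact: iter_partial_cst|exact: iter_partial_coord].
Qed.

End iter_partial_theory.

Section radial_test_function.
Context (R : realType) (n : nat) (n_gt0 : (0 < n)%N).

Lemma sqnorm_powR (x : 'rV[R]_n) : sqnorm x `^ (n%:R / 2) = radial_volume x.
Proof.
rewrite -enorm_sqr -powR_mulrn ?enorm_ge0// -powRrM mulrCA mulfV ?mulr1//.
by rewrite powR_mulrn ?enorm_ge0.
Qed.

(* Multiplying [p] by [t^(- n/2)] turns the Laplacian of the primitive into a
   pure derivative: Delta (h(|x|^2)) = 2 n p'(|x|^n). *)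
Lemma radial_test_function_ex (p p' : R -> R) (a b : R) :
  0 < a -> a < b -> b < 1 -> smooth1 p ->
  (forall t : R, is_derive t (1 : R) p (p' t)) ->
  (forall t, 0 <= p t <= 1) -> (forall t, t <= a -> p t = 0) ->
  (forall t, b <= t -> p t = 0) ->
  exists v : 'rV[R]_n -> R, [/\ test_function (unit_ball R n) v,
    forall x, laplacian v x = 2 * n%:R * p' (radial_volume x),
    forall x, `|v x| <= b `^ (2 / n%:R) / Num.max a (radial_volume x) &
    forall x, b <= radial_volume x -> v x = 0].
Proof.
move=> a0 ab b1 sp dp p01 pa pb.
have b0 : 0 < b := lt_trans a0 ab.
have nR : 0 < n%:R :> R by rewrite ltr0n.
pose al : R := n%:R / 2.
have al0 : 0 < al by rewrite divr_gt0.
have ale : al^-1 = 2 / n%:R by rewrite /al invf_div.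
(* The value of [|x|^2] on the sphere where [radial_volume] equals [b]. *)
pose beta : R := b `^ (2 / n%:R).
have beta0 : 0 < beta by rewrite powR_gt0.
have betaE : beta `^ al = b.
  by rewrite /beta -ale -powRrM mulVf ?gt_eqF// powRr1// ltW.
have beta1 : beta < 1.
  rewrite ltNge; apply/negP => beta1.
  have : 1 `^ al <= beta `^ al by apply: ge0_ler_powR; rewrite ?nnegrE ?(ltW al0) ?(ltW beta0).
  by rewrite powR1 betaE leNgt b1.
have powb t : beta <= t -> b <= t `^ al.
  by move=> h; rewrite -betaE; apply: ge0_ler_powR; rewrite ?nnegrE ?(ltW al0) ?(ltW beta0)//
    (le_trans (ltW beta0)).
have powt (t s : R) : 0 <= t -> t <= s -> t `^ al <= s `^ al.
  by move=> t0 ts; apply: ge0_ler_powR; rewrite ?nnegrE ?(ltW al0)// (le_trans t0).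
have pa' s : s < a -> p s = 0 by move=> sa; apply: pa; exact: ltW.
(* With [h' = K] the gradient of [h(|x|^2)] is [2 p(t) x / |x|^n] for [t = |x|^n]. The field
   [x / |x|^n] is divergence free off the origin, so only the derivative of [p(t)] survives in the
   Laplacian. *)
pose K := powcomp p al (- al).
have sK : smooth1 K by exact: (smooth1_powcomp al0 (- al) a0 pa' sp).
pose K' t := al * powcomp p' al (al - 1 - al) t + - al * powcomp p al (- al - 1) t.
have dK t : is_derive t (1 : R) K (K' t) by exact: (is_derive_powcomp al0 (- al) t a0 pa' dp).
have K_beta t : beta <= t -> K t = 0.
  by move=> tb; rewrite /K /powcomp; case: ifP => // t0; rewrite pb ?mul0r//; exact: powb.
have K0 t : t < 0 -> K t = 0 by move=> t0; rewrite /K /powcomp ltNge ltW.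
have cK : continuous K := iter_derivable_continuous (sK 0%N).
have [|h dh] := antiderivative_ex (c := 0) (d := beta) cK.
  by move=> t /negP; rewrite negb_and -!ltNge => /orP[/K0//|/ltW/K_beta].
have ch : continuous h := is_derive_continuous dh.
have hb t : beta <= t -> h t = h beta.
  move=> tb; have [|c] := MVT_segment tb (fun t _ => dh t); first exact: continuous_subspaceT.
  by rewrite in_itv/= => /andP[c0 _]; rewrite K_beta// mul0r => /eqP; rewrite subr_eq0 => /eqP.
(* [h] is constant from [beta] on; subtracting this constant puts the support in the closed ball
   [|x|^2 <= beta], inside the open unit ball. *)
pose v (x : 'rV[R]_n) := h (sqnorm x) + - h beta.
have sv : smooth v.
  apply: iter_partial_smooth => k; apply: iter_partialD; last exact: iter_partial_cst.
  apply: iter_partial_sqnorm_comp; exact: smooth1_antiderivative dh sK k.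
have v0 x : beta <= sqnorm x -> v x = 0 by move=> xb; rewrite /v hb// subrr.
have dv i x : is_derive x (ebasis R i) v (2 * x ord0 i * K (sqnorm x)).
  apply: is_derive_eq (is_deriveD (is_derive_sqnorm_comp i x dh)
    (is_derive_cst (- h beta) x (ebasis R i))) _.
  by rewrite addr0.
have ddv (i : 'I_n) (x : 'rV[R]_n) :
    is_derive x (ebasis R i) (fun x : 'rV[R]_n => 2 * x ord0 i * K (sqnorm x))
    (2 * K (sqnorm x) + 4 * x ord0 i ^+ 2 * K' (sqnorm x)).
  apply: is_derive_eq (is_deriveM (is_deriveM (is_derive_cst (2 : R) x (ebasis R i))
    (is_derive_coord i i x)) (is_derive_sqnorm_comp i x dK)) _.
  rewrite eqxx; transitivity (2 * x ord0 i * (2 * x ord0 i * K' (sqnorm x)) +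
    K (sqnorm x) * (2 * 1 + x ord0 i * 0)) => //.
  ring.
exists v; split.
- split=> //; exists [set x | sqnorm x <= beta]; split.
  + apply: bounded_closed_compact.
      exists 1; split; first exact: num_real.
      move=> M M1 x /= xb; rewrite (le_trans (normr_le_enorm _))//.
      rewrite (le_trans _ (ltW M1))// -(@ler_pXn2r _ 2)// ?nnegrE ?enorm_ge0//.
      by rewrite enorm_sqr expr1n (le_trans xb)// ltW.
    have -> : [set x : 'rV[R]_n | sqnorm x <= beta] = @sqnorm R n @^-1` [set t | t <= beta] by [].
    by apply: preimage_closed => [x _|]; [exact: continuous_sqnorm|exact: closed_le].
  + move=> x /= xb; rewrite /unit_ball/= -(@ltr_pXn2r _ 2)// ?nnegrE ?enorm_ge0//.
    by rewrite enorm_sqr expr1n (le_lt_trans xb).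
  + by move=> x /negP; rewrite -ltNge => /ltW /v0.
- move=> x; rewrite /laplacian.
  rewrite (eq_bigr (fun i => 2 * K (sqnorm x) + 4 * x ord0 i ^+ 2 * K' (sqnorm x))); last first.
    move=> i _; rewrite /partials/= (partial_eq (dv i)).
    by apply: derive_val; exact: ddv.
  rewrite big_split/= sumr_const card_ord -mulr_suml -mulr_sumr -/(sqnorm x).
  rewrite /K' /K /powcomp -sqnorm_powR -/al.
  (* At the origin both sides are 0: [powcomp] is 0 there by definition, and [p' 0 = 0] because [p]
     vanishes near 0. *)
  have [s0|] := ltP 0 (sqnorm x); last first.
    move=> s0; have -> : sqnorm x = 0 by apply/eqP; rewrite eq_le s0 sqnorm_ge0.
    rewrite !mulr0 !mul0rn addr0 powR0 ?gt_eqF//.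
    have hp : is_derive (0 : R) (1 : R) p 0.
      apply: near_eq_is_derive (is_derive_cst (0 : R) 0 (1 : R)).
      by near=> r; rewrite pa'//; near: r; exact: lt_nbhsl.
    by rewrite -(derive_val (is_derive := dp 0)) (derive_val (is_derive := hp)) !mulr0 addr0.
  have -> : al - 1 - al = -1 by ring.
  have sN : sqnorm x != 0 by rewrite gt_eqF.
  rewrite (powRD _ (r := - al) (s := -1)) ?sN ?implybT// powRN powR_inv1 ?ltW//.
  have AN : sqnorm x `^ al != 0 by rewrite gt_eqF// powR_gt0.
  rewrite -mulr_natr; set A := sqnorm x `^ al in AN *; rewrite /al.
  by field; rewrite AN sN.
- move=> x; have m0 : 0 < Num.max a (radial_volume x) by rewrite lt_max a0.
  have [xb|xb] := leP beta (sqnorm x).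
    by rewrite v0// normr0 divr_ge0 ?ltW.
  have [|c] := MVT_segment (ltW xb) (fun t _ => dh t); first exact: continuous_subspaceT.
  rewrite in_itv/= => /andP[xc cb] E.
  have -> : v x = - (K c * (beta - sqnorm x)) by rewrite -E /v; ring.
  (* [K c] is zero when [c^al <= a] and at most [c^-al] otherwise; since [c] exceeds [|x|^2], the
     power [c^al] is then above both [a] and [radial_volume x]. *)
  have Kc : 0 <= K c <= (Num.max a (radial_volume x))^-1.
    rewrite /K /powcomp; case: ifPn => [c0|_]; last by rewrite lexx invr_ge0 ltW.
    have [ca|ca] := leP (c `^ al) a.
      by rewrite pa// mul0r lexx invr_ge0 ltW.
    have /andP[p0 p1] := p01 (c `^ al).
    rewrite mulr_ge0 ?powR_ge0//= powRN.
    apply: (@le_trans _ _ (c `^ al)^-1); first by rewrite ler_piMl// invr_ge0 powR_ge0.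
    rewrite lef_pV2 ?posrE ?powR_gt0// ge_max (ltW ca)/= -sqnorm_powR.
    by apply: powt => //; exact: sqnorm_ge0.
  case/andP: Kc => K1 K2.
  rewrite normrN normrM (ger0_norm K1) ger0_norm ?subr_ge0 ?(ltW xb)// mulrC.
  apply: ler_pM => //; first by rewrite subr_ge0 (ltW xb).
  by rewrite gerBl sqnorm_ge0.
- by move=> x bx; apply: v0; rewrite leNgt; apply/negP => xb;
    move: bx; rewrite -sqnorm_powR leNgt -betaE => /negP; apply;
    apply: gt0_ltr_powR; rewrite ?nnegrE ?sqnorm_ge0 ?ltW.
Unshelve. all: by end_near. Qed.

End radial_test_function.

(** * Square integrable functions and test functions *)

Section square_integrable.
Context (R : realType) (n : nat).
Local Notation mu := (lebesgue_rV R n).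
Local Notation B := (unit_ball R n).
Implicit Types f g : 'rV[R]_n -> R.

Lemma integrable_sqr f : sq_integrable B f -> mu.-integrable B (fun x => (f x ^+ 2)%:E).
Proof.
move=> [mf f2]; apply/integrableP; split.
  by apply/measurable_EFinP; exact: measurable_funX.
by under eq_integral do rewrite gee0_abs ?lee_fin ?sqr_ge0//.
Qed.

Lemma sq_integrableM f g : sq_integrable B f -> sq_integrable B g ->
  mu.-integrable B (fun x => (f x * g x)%:E).
Proof.
move=> sf sg; have mB := measurable_unit_ball R n.
have := integrableD mB (integrable_sqr sf) (integrable_sqr sg).
apply: le_integrable => //.
  by apply/measurable_EFinP; apply: measurable_funM; [exact: sf.1|exact: sg.1].
move=> x _ /=; rewrite lee_fin (ger0_norm (addr_ge0 (sqr_ge0 _) (sqr_ge0 _))) normrM.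
have := sqr_ge0 (`|f x| - `|g x|); rewrite -(real_normK (num_real (f x))).
rewrite -(real_normK (num_real (g x))).
have := normr_ge0 (f x); have := normr_ge0 (g x).
move: `|f x| `|g x| => p q q0 p0 h; nra.
Qed.

Lemma integrable_bounded f (C : R) :
  measurable_fun B (f : 'rV[R]_n -> measurableTypeR R) ->
  (forall x, B x -> `|f x| <= C) -> mu.-integrable B (fun x => (f x)%:E).
Proof.
move=> mf fC; apply: measurable_bounded_integrable => //.
- exact: measurable_unit_ball.
- exact: lebesgue_rV_unit_ball_lty.
exists C; split; first exact: num_real.
by move=> M CM x Bx /=; rewrite (le_trans (fC _ Bx))// ltW.
Qed.

Lemma sq_integrable_bounded f (C : R) :
  measurable_fun B (f : 'rV[R]_n -> measurableTypeR R) ->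
  (forall x, B x -> `|f x| <= C) -> sq_integrable B f.
Proof.
move=> mf fC; split=> //.
have : mu.-integrable B (fun x => (f x ^+ 2)%:E).
  apply: (@integrable_bounded _ (C ^+ 2)); first exact: measurable_funX.
  by move=> x Bx; rewrite normrX lerXn2r ?nnegrE ?fC// (le_trans _ (fC _ Bx)).
move/integrableP => -[_]; under eq_integral do rewrite gee0_abs ?lee_fin ?sqr_ge0//.
by [].
Qed.

Lemma sq_integrable_integrable f : sq_integrable B f -> mu.-integrable B (fun x => (f x)%:E).
Proof.
move=> sf; have s1 : sq_integrable B (fun=> 1 : R).
  by apply: (@sq_integrable_bounded _ 1) => // x _; rewrite normr1.
by have := sq_integrableM sf s1; under eq_fun do rewrite mulr1.
Qed.

Lemma sq_integrableD f g : sq_integrable B f -> sq_integrable B g ->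
  sq_integrable B (fun x => f x + g x).
Proof.
move=> sf sg; have mB := measurable_unit_ball R n.
have mfg : measurable_fun B (fun x => f x + g x : measurableTypeR R).
  by apply: measurable_funD; [exact: sf.1|exact: sg.1].
split=> //; have : mu.-integrable B (fun x => ((f x + g x) ^+ 2)%:E).
  have := integrableD mB (integrableD mB (integrable_sqr sf) (integrable_sqr sg))
    (integrableD mB (sq_integrableM sf sg) (sq_integrableM sf sg)).
  apply: eq_integrable => // x _ /=; rewrite -!EFinD; congr EFin.
  by rewrite sqrrD; ring.
move/integrableP => -[_]; under eq_integral do rewrite gee0_abs ?lee_fin ?sqr_ge0//.
by [].
Qed.

Lemma sq_integrableM_bounded f g (C : R) : sq_integrable B f ->
  measurable_fun B (g : 'rV[R]_n -> measurableTypeR R) ->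
  (forall x, B x -> `|g x| <= C) -> sq_integrable B (fun x => g x * f x).
Proof.
move=> sf mg gC; have mB := measurable_unit_ball R n.
have mfg : measurable_fun B (fun x => g x * f x : measurableTypeR R).
  by apply: measurable_funM => //; exact: sf.1.
split=> //; have : mu.-integrable B (fun x => ((g x * f x) ^+ 2)%:E).
  have := integrableZl mB (C ^+ 2) (integrable_sqr sf).
  apply: le_integrable => //; first by apply/measurable_EFinP; exact: measurable_funX.
  move=> x Bx; rewrite /= lee_fin exprMn !normrM ler_wpM2r//.
  have gC' : `|g x| <= `|C| by rewrite (le_trans (gC _ Bx))// ler_norm.
  exact: ler_pM.
move/integrableP => -[_]; under eq_integral do rewrite gee0_abs ?lee_fin ?sqr_ge0//.
by [].
Qed.

Lemma sq_integrableZ f (c : R) : sq_integrable B f -> sq_integrable B (fun x => c * f x).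
Proof.
by move=> sf; apply: (@sq_integrableM_bounded _ (cst c) `|c|) => //; exact: measurable_cst.
Qed.

End square_integrable.

Section test_functions.
Context (R : realType) (n : nat).
Local Notation mu := (lebesgue_rV R n).
Local Notation B := (unit_ball R n).
Implicit Types v : 'rV[R]_n -> R.

Lemma test_function_continuous v : test_function B v -> continuous v.
Proof. by case=> sv _; exact: (sv [::]).1. Qed.

Lemma test_function_is_derive v i x : test_function B v ->
  is_derive x (ebasis R i) v ('D_(ebasis R i) v x).
Proof. by case=> sv _; apply: DeriveDef => //; exact: (sv [::]).2. Qed.

Lemma test_function_out v x : test_function B v -> ~ B x -> v x = 0.
Proof. by case=> _ [K [_ KB vK]] nBx; apply: vK => /KB. Qed.

Lemma test_function_partial v i : test_function B v -> test_function B ('D_(ebasis R i) v).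
Proof.
move=> tv; have [sv [K [cK KB vK]]] := tv; split; first exact: smooth_partial.
exists K; split=> // x nKx; apply: derive_val.
apply: near_eq_is_derive (is_derive_cst (0 : R) x (ebasis R i)).
have oK : open (~` K) by apply: closed_openC; exact: compact_closed cK.
by apply: filterS (open_nbhs_nbhs (conj oK nKx)) => y nKy; rewrite vK.
Qed.

Lemma test_functionM_coord v i : test_function B v ->
  test_function B (fun x => x ord0 i * v x).
Proof.
move=> [sv [K [cK KB vK]]]; split.
  apply: iter_partial_smooth => k; apply: iter_partialM; first exact: iter_partial_coord.
  exact: smooth_iter_partial.
by exists K; split=> // x /vK ->; rewrite mulr0.
Qed.

Lemma test_function_bounded v : test_function B v -> exists C : R, forall x, `|v x| <= C.
Proof.
move=> tv; have [_ [K [cK KB vK]]] := tv.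
have : compact (v @` K).
  by apply: continuous_compact => //; exact/continuous_subspaceT/test_function_continuous.
move=> /compact_bounded[M [Mr vM]].
exists (`|M| + 1) => x; have [Kx|nKx] := pselect (K x).
  by apply: vM; [rewrite (le_lt_trans (ler_norm _))// ltrDl|exists x].
by rewrite vK// normr0 addr_ge0.
Qed.

Lemma test_function_measurable v (D : set 'rV[R]_n) : test_function B v -> measurable D ->
  measurable_fun D (v : 'rV[R]_n -> measurableTypeR R).
Proof. by move=> tv mD; apply: continuous_measurable_rV => //; exact: test_function_continuous. Qed.

Lemma test_function_sq_integrable v : test_function B v -> sq_integrable B v.
Proof.
move=> tv; have [C vC] := test_function_bounded tv.
apply: (@sq_integrable_bounded _ _ _ C) => //.
by apply: test_function_measurable => //; exact: measurable_unit_ball.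
Qed.

End test_functions.

Lemma is_derive_cons_rV (R : realType) (n : nat) (u : 'rV[R]_n.+1 -> R) (x : 'rV[R]_n) (t d : R) :
  is_derive (cons_rV (x, t)) (ebasis R ord0) u d ->
  is_derive t (1 : R) (fun t : R => u (cons_rV (x, t))) d.
Proof.
set g := (fun t : R => _) => du.
have E : (fun h : R => h^-1 *: ((g \o shift t) (h *: (1 : R)) - g t)) =
    (fun h : R => h^-1 *: ((u \o shift (cons_rV (x, t))) (h *: ebasis R ord0) - u (cons_rV (x, t)))).
  apply/funext => h; rewrite /g /=; congr (_ *: (u _ - _)).
  apply/rowP => i; rewrite !mxE eqxx/=.
  case: unliftP => [j ->|->]; last by rewrite eqxx [h *: 1]/GRing.scale/= mulr1.
  by rewrite eq_sym (negbTE (neq_lift _ _)) mulr0 add0r.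
apply: DeriveDef; rewrite /derivable /derive E; first exact: (ex_derive (is_derive := du)).
exact: (derive_val (is_derive := du)).
Qed.

(** The coordinate [ord0] is the last factor of the product measure behind [lebesgue_rV]. By Fubini
    the integral reduces to lines in that direction, where the fundamental theorem of calculus gives
    a difference of two values of [v] outside the ball. *)
Lemma Rintegral_partial_test_function (R : realType) (n : nat) (v : 'rV[R]_n.+1 -> R) :
  test_function (unit_ball R n.+1) v ->
  \int[lebesgue_rV R n.+1]_(x in unit_ball R n.+1) 'D_(ebasis R ord0) v x = 0.
Proof.
move=> tv; set w := 'D_(ebasis R ord0) v.
have tw : test_function (unit_ball R n.+1) w by exact: test_function_partial.
have wB : w \_ (unit_ball R n.+1) = w.
  apply/funext => x; rewrite patchE; case: ifPn => // /negP nBx.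
  by rewrite (test_function_out tw)// => Bx; apply: nBx; rewrite inE.
have iw : (lebesgue_rV R n.+1).-integrable setT (EFin \o w).
  rewrite -wB; have -> : EFin \o w \_ (unit_ball R n.+1) = (EFin \o w) \_ (unit_ball R n.+1).
    by apply/funext => x; rewrite /= !patchE; case: ifP.
  apply: (@integrable_mkcond _ _ _ (lebesgue_rV R n.+1) _ (EFin \o w) (measurable_unit_ball R n.+1)).1.
  exact: sq_integrable_integrable (test_function_sq_integrable tw).
have mw : measurable_fun setT (w : 'rV[R]_n.+1 -> measurableTypeR R).
  exact: test_function_measurable.
rewrite Rintegral_mkcond wB /Rintegral.
have Dw (x : 'rV[R]_n) (t : R) : is_derive t (1 : R) (fun t : R => v (cons_rV (x, t))) (w (cons_rV (x, t))).
  by apply: is_derive_cons_rV; exact: test_function_is_derive.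
have out (x : 'rV[R]_n) (t : R) : 1 <= `|t| -> ~ unit_ball R n.+1 (cons_rV (x, t)).
  move=> t1; rewrite /unit_ball/= => h; have := normr_coord_le_enorm (cons_rV (x, t)) ord0.
  by rewrite mxE unlift_none/= leNgt (lt_le_trans h).
pose mu := @sf_lebesgue_rV R n.
have iwc : (mu \x @lebesgue_measure R)%E.-integrable setT
    ((EFin \o w) \o @cons_rV R n).
  have mwc : measurable_fun setT ((EFin \o w) \o @cons_rV R n).
    by apply: (measurableT_comp _ (@measurable_cons_rV R n)); exact/measurable_EFinP.
  apply/integrableP; split=> //.
  have /integrableP[_] := iw; apply: le_lt_trans.
  have maw : measurable_fun setT (fun x => `|(EFin \o w) x|%E).
    by apply: measurableT_comp => //; exact/measurable_EFinP.
  have := ge0_integral_pushforward (@measurable_cons_rV R n)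
    (mu \x @lebesgue_measure R)%E measurableT maw (fun y _ => abse_ge0 _).
  by rewrite preimage_setT /= => <-.
have mw' : measurable_fun setT (EFin \o w) by exact/measurable_EFinP.
have -> : (\int[lebesgue_rV R n.+1]_x (w x)%:E =
    \int[(mu \x @lebesgue_measure R)]_p ((EFin \o w) \o @cons_rV R n) p)%E.
  exact: (integral_pushforward (@measurable_cons_rV R n) (mu := (mu \x @lebesgue_measure R)%E)
    mw' iwc measurableT).
rewrite -integral12_prod_meas1//.
rewrite integral0_eq// => x _; rewrite /fubini_F/=.
rewrite (_ : (fun t => _) = (fun t => (w (cons_rV (x, t)))%:E) \_ `[(-1)%R, 1%R]%classic); last first.
  apply/funext => t; rewrite patchE; case: ifPn => // /negP; rewrite inE/= in_itv/= -ler_norml => h.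
  by rewrite (test_function_out tw)//; apply: out; rewrite leNgt; apply/negP => /ltW.
rewrite -integral_mkcond.
have cvx : continuous (fun t : R => v (cons_rV (x, t))) := is_derive_continuous (Dw x).
rewrite (@continuous_FTC2 _ _ (fun t : R => v (cons_rV (x, t)))).
- by rewrite !(test_function_out tv) ?subee//; apply: out; rewrite ?normrN normr1.
- by rewrite gtrN.
- apply: continuous_subspaceT; apply: is_derive_continuous => t.
  exact: is_derive_cons_rV (test_function_is_derive _ _ tw).
- split=> [t _||]; first exact: (ex_derive (is_derive := Dw x t)).
  + exact: cvg_at_right_filter (cvx _).
  + exact: cvg_at_left_filter (cvx _).
- by move=> t _; rewrite derive1E; exact: derive_val.
Qed.

(** * Constants in H^1_0 *)

Section pairing.
Context (R : realType) (n : nat).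
Local Notation mu := (lebesgue_rV R n).
Local Notation B := (unit_ball R n).
Implicit Types f g h : 'rV[R]_n -> R.

Definition pairing f g : R := \int[mu]_(x in B) (f x * g x).

Lemma pairingC f g : pairing f g = pairing g f.
Proof. by apply: eq_Rintegral => x _; rewrite mulrC. Qed.

Lemma pairing_lin (a b : R) f1 f2 g :
  sq_integrable B f1 -> sq_integrable B f2 -> sq_integrable B g ->
  pairing (fun x => a * f1 x + b * f2 x) g = a * pairing f1 g + b * pairing f2 g.
Proof.
move=> s1 s2 sg; have mB := measurable_unit_ball R n.
rewrite /pairing -!RintegralZl//; try exact: sq_integrableM.
rewrite -RintegralD//.
- by apply: eq_Rintegral => x _; rewrite mulrDl !mulrA.
- have := sq_integrableM (sq_integrableZ a s1) sg.
  by apply: eq_integrable => // x _ /=; rewrite mulrA.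
- have := sq_integrableM (sq_integrableZ b s2) sg.
  by apply: eq_integrable => // x _ /=; rewrite mulrA.
Qed.

Lemma pairing_ae f1 f2 g :
  measurable_fun B (f1 : 'rV[R]_n -> measurableTypeR R) ->
  measurable_fun B (f2 : 'rV[R]_n -> measurableTypeR R) ->
  measurable_fun B (g : 'rV[R]_n -> measurableTypeR R) ->
  {ae mu, forall x, B x -> f1 x = f2 x} -> pairing f1 g = pairing f2 g.
Proof.
move=> m1 m2 mg f12; congr fine; apply: ae_eq_integral.
- exact: measurable_unit_ball.
- by apply/measurable_EFinP; exact: measurable_funM.
- by apply/measurable_EFinP; exact: measurable_funM.
- by apply: filterS f12 => x f12x Bx; rewrite f12x.
Qed.

(** Young's inequality [p q <= p^2 / d + d q^2] replaces Cauchy-Schwarz. The number [d] is fixed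
    from [e] and the norm of [g] so that the second term contributes at most [e / 2]; convergence
    then makes the first one as small. *)
Lemma L2_cvg_pairing (u_ : nat -> 'rV[R]_n -> R) f g :
  (forall k, sq_integrable B (u_ k)) -> sq_integrable B f -> sq_integrable B g ->
  L2_cvg B u_ f -> pairing (u_ k) g @[k --> \oo] --> pairing f g.
Proof.
move=> su sf sg uf; have mB := measurable_unit_ball R n.
apply/cvgrPdist_le => e e0.
pose A := \int[mu]_(x in B) (g x ^+ 2).
have A0 : 0 <= A by apply: Rintegral_ge0 => x _; exact: sqr_ge0.
pose d := e / (2 * (A + 1)).
have d0 : 0 < d by rewrite divr_gt0// mulr_gt0// ltr_wpDl.
have dA : d * A <= e / 2.
  rewrite /d mulrAC ler_pdivrMr ?mulr_gt0 ?ltr_wpDl//.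
  by have := mulr_ge0 (ltW e0) A0; nra.
have sub k : sq_integrable B (fun x => u_ k x - f x).
  have := sq_integrableD (su k) (sq_integrableZ (-1) sf).
  by under eq_fun do rewrite mulN1r.
have small : \forall k \near \oo, \int[mu]_(x in B) ((u_ k x - f x) ^+ 2) <= d * (e / 2).
  have /fine_cvgP[_ /cvgrPdist_le] := uf.
  move=> /(_ (d * (e / 2)))[|N _ H]; first by rewrite mulr_gt0// divr_gt0.
  exists N => // k /H; rewrite /= sub0r normrN; apply: le_trans.
  exact: ler_norm.
near=> k.
have -> : pairing f g - pairing (u_ k) g = - pairing (fun x => u_ k x - f x) g.
  have := @pairing_lin 1 (-1) (u_ k) f g (su k) sf sg.
  rewrite mul1r mulN1r => H; rewrite -[LHS]opprB -H; congr (- _).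
  by apply: eq_Rintegral => x _; rewrite mul1r mulN1r.
rewrite normrN (le_trans (le_normr_Rintegral _ _))//; first exact: sq_integrableM.
have i1 := integrable_sqr (sub k); have i2 := integrable_sqr sg.
have i1' : mu.-integrable B (EFin \o (fun x => d^-1 * (u_ k x - f x) ^+ 2)).
  exact: (integrableZl mB d^-1 i1).
have i2' : mu.-integrable B (EFin \o (fun x => d * g x ^+ 2)).
  exact: (integrableZl mB d i2).
apply: (@le_trans _ _ (\int[mu]_(x in B) (d^-1 * (u_ k x - f x) ^+ 2 + d * g x ^+ 2))).
  apply: le_Rintegral => //.
  - have := integrable_abse (sq_integrableM (sub k) sg).
    by [].
  - exact: (integrableD mB i1' i2').
  move=> x _; rewrite normrM -(real_normK (num_real (g x))) -(real_normK (num_real (u_ k x - f x))).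
  move: `|u_ k x - f x| `|g x| (normr_ge0 (u_ k x - f x)) (normr_ge0 (g x)) => p q p0 q0.
  have := sqr_ge0 (p - d * q).
  have -> : d^-1 * p ^+ 2 + d * q ^+ 2 = d^-1 * (p ^+ 2 + (d * q) ^+ 2) by field; rewrite gt_eqF.
  have -> : p * q = d^-1 * (p * (d * q)) by field; rewrite gt_eqF.
  move=> h; rewrite ler_pM2l ?invr_gt0//; have := mulr_ge0 p0 (mulr_ge0 (ltW d0) q0).
  by move: (d * q) h => dq h; nra.
rewrite RintegralD// !RintegralZl// -/A.
have h : \int[mu]_(x in B) ((u_ k x - f x) ^+ 2) <= d * (e / 2) by near: k.
have : d^-1 * \int[mu]_(x in B) ((u_ k x - f x) ^+ 2) <= e / 2.
  by rewrite ler_pdivrMl.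
lra.
Unshelve. all: by end_near. Qed.

End pairing.

Section H10_constants.
Context (R : realType) (m : nat).
Let n := m.+1.
Local Notation mu := (lebesgue_rV R n).
Local Notation B := (unit_ball R n).
Local Notation X := (fun x : 'rV[R]_n => x ord0 ord0).
Local Notation D0 v := ('D_(ebasis R ord0) v).

Let coord_bounded x : B x -> `|X x| <= 1.
Proof. by move=> Bx; rewrite (le_trans (normr_coord_le_enorm _ _))// ltW. Qed.

Let mX : measurable_fun B (X : 'rV[R]_n -> measurableTypeR R).
Proof. by apply: (measurable_funS measurableT) => //; exact: measurable_rV_coord. Qed.

Let sX (f : 'rV[R]_n -> R) : sq_integrable B f -> sq_integrable B (fun x => X x * f x).
Proof. by move=> sf; exact: sq_integrableM_bounded sf mX coord_bounded. Qed.

Let s1 : sq_integrable B (fun=> 1 : R).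
Proof. by apply: (@sq_integrable_bounded _ _ _ 1) => // x _; rewrite normr1. Qed.

Let sX1 : sq_integrable B X.
Proof. exact: sq_integrable_bounded mX coord_bounded. Qed.

(* Integrating D_0 (x_0 u) over the ball gives zero for test functions u, hence
   in the limit the first identity; the second one passes to the limit in v := x_0 u. *)
Lemma H10_pairing (phi : 'rV[R]_n -> R) : H10 B phi ->
  exists2 G : 'rV[R]_n -> R, [/\ sq_integrable B G,
      (forall v, test_function B v -> pairing phi (D0 v) = - pairing G v) &
      pairing phi (fun=> 1) = - pairing G X] &
    forall g : 'rV[R]_n -> R, sq_integrable B g ->
      (forall v, test_function B v -> pairing v g = 0) ->
      pairing phi (fun x => X x * g x) = 0.
Proof.
case=> sphi [G wG [u_ [tu uphi uG]]].
have [sG0 wG0] := wG ord0.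
have su k := test_function_sq_integrable (tu k).
have sDu k := test_function_sq_integrable (test_function_partial ord0 (tu k)).
exists (G ord0).
  split=> //.
  have c1 := L2_cvg_pairing su sphi s1 uphi.
  have c2 := L2_cvg_pairing sDu sG0 sX1 (uG ord0).
  have E k : pairing (u_ k) (fun=> 1) = - pairing (D0 (u_ k)) X.
    have tXu := test_functionM_coord ord0 (tu k).
    have DX : D0 (fun x => X x * u_ k x) = (fun x => 1 * (u_ k x * 1) + 1 * (D0 (u_ k) x * X x)).
      apply/funext => x; apply: derive_val.
      apply: is_derive_eq (is_deriveM (is_derive_coord ord0 ord0 x)
        (test_function_is_derive ord0 x (tu k))) _.
      rewrite eqxx; transitivity (X x * D0 (u_ k) x + u_ k x * 1) => //; ring.
    have := Rintegral_partial_test_function tXu; rewrite DX.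
    rewrite RintegralD; last 3 first.
    - exact: measurable_unit_ball.
    - under eq_fun do rewrite mul1r; exact: sq_integrableM.
    - under eq_fun do rewrite mul1r; exact: sq_integrableM.
    rewrite !(eq_Rintegral _ (fun _ _ => mul1r _)).
    by move/eqP; rewrite addr_eq0 => /eqP.
  have c3 : pairing (u_ k) (fun=> 1) @[k --> \oo] --> - pairing (G ord0) X.
    by rewrite (funext E); exact: cvgN c2.
  exact: cvg_unique c1 c3.
move=> g sg g0.
have c := L2_cvg_pairing su sphi (sX sg) uphi.
apply: cvg_unique c _ => //.
have -> : (fun k => pairing (u_ k) (fun x => X x * g x)) = (fun=> 0).
  apply/funext => k; rewrite -(g0 _ (test_functionM_coord ord0 (tu k))).
  by apply: eq_Rintegral => x _; rewrite mulrCA mulrA.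
exact: cvg_cst.
Qed.

(** The weak derivative [G] of the constant [k] is orthogonal to every test function, because [D0 v]
    has integral zero. Rather than deducing [G = 0] by density, the two identities of [H10_pairing]
    are combined linearly: [k |B| = - <G, x_0>] and [k <G, x_0> = 0], whence [k^2 |B| = 0]. *)
Lemma H10_combination_constant (phi1 phi2 : 'rV[R]_n -> R) (a b k : R) :
  H10 B phi1 -> H10 B phi2 ->
  {ae mu, forall x, B x -> a * phi1 x + b * phi2 x = k} -> k = 0.
Proof.
move=> H1 H2 aek; have sphi1 := H1.1; have sphi2 := H2.1.
have [G1 [sG1 wG1 e1] l1] := H10_pairing H1.
have [G2 [sG2 wG2 e2] l2] := H10_pairing H2.
pose phi x := a * phi1 x + b * phi2 x.
pose G x := a * G1 x + b * G2 x.
have sG : sq_integrable B G by apply: sq_integrableD; exact: sq_integrableZ.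
have sphi : sq_integrable B phi by apply: sq_integrableD; exact: sq_integrableZ.
have mk : measurable_fun B (fun=> k : measurableTypeR R) by exact: measurable_cst.
have phik g : sq_integrable B g -> pairing phi g = k * pairing (fun=> 1) g.
  move=> sg; rewrite (pairing_ae _ mk sg.1 aek); last exact: sphi.1.
  rewrite /pairing -RintegralZl//.
  - by apply: eq_Rintegral => x _; rewrite mul1r.
  - exact: measurable_unit_ball.
  - exact: sq_integrableM.
have G0 v : test_function B v -> pairing v G = 0.
  move=> tv; have sv := test_function_sq_integrable tv.
  have tDv := test_function_partial ord0 tv; have sDv := test_function_sq_integrable tDv.
  rewrite pairingC pairing_lin//.
  have := wG1 _ tv; have := wG2 _ tv => w2 w1.
  have : pairing phi (D0 v) = - (a * pairing G1 v + b * pairing G2 v).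
    by rewrite pairing_lin// w1 w2; ring.
  rewrite phik// [X in _ * X](_ : _ = 0) ?mulr0.
    by move/eqP; rewrite eq_sym oppr_eq0 => /eqP.
  rewrite -[RHS](Rintegral_partial_test_function tv).
  by apply: eq_Rintegral => x _; rewrite mul1r.
have E1 : pairing phi (fun=> 1) = - pairing G X.
  by rewrite !pairing_lin// e1 e2; ring.
have E2 : pairing phi (fun x => X x * G x) = 0.
  by rewrite pairing_lin// ?l1 ?l2 ?mulr0 ?addr0//; exact: sX.
have GX : pairing (fun=> 1) (fun x => X x * G x) = pairing G X.
  by apply: eq_Rintegral => x _; rewrite mul1r mulrC.
move: E1 E2; rewrite !phik//; last exact: sX.
rewrite GX => E1 E2.
have om : pairing (fun _ : 'rV[R]_n => 1) (fun=> 1) = fine (mu B).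
  rewrite /pairing; under eq_Rintegral do rewrite mulr1.
  by rewrite Rintegral_cst ?mul1r//; exact: measurable_unit_ball.
have om0 : 0 < fine (mu B).
  by rewrite fine_gt0// lebesgue_rV_unit_ball_gt0 lebesgue_rV_unit_ball_lty.
apply/eqP; have : k * k * fine (mu B) = 0.
  by rewrite -om -mulrA E1 mulrN E2 oppr0.
by move/eqP; rewrite !mulf_eq0 (gt_eqF om0) orbF orbb.
Qed.

End H10_constants.

(** * The Volterra inequality *)

Section powR_integrals.
Context (R : realType).
Local Notation lam := (@lebesgue_measure R).

Lemma measurable_powRE (p : R) (D : set (measurableTypeR R)) : measurable D ->
  measurable_fun D (fun t : measurableTypeR R => (t `^ p)%:E).
Proof.
move=> mD; apply/measurable_EFinP; exact: (@measurable_funS _ _ _ _ setT).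
Qed.

Lemma integral_powR_itvcc (p c d : R) : p != 0 -> 0 < c -> c < d ->
  (\int[lam]_(t in `[c, d]) (t `^ (p - 1))%:E = ((d `^ p - c `^ p) / p)%:E)%E.
Proof.
move=> p0 c0 cd.
have dp (e t : R) : 0 < t -> is_derive t (1 : R) (fun t : R => t `^ e) (e * t `^ (e - 1)).
  exact: is_derive1_powR.
have cp (e t : R) : 0 < t -> {for t, continuous (fun t : R => t `^ e)}.
  by move=> t0; apply/differentiable_continuous/derivable1_diffP; exact: (ex_derive (is_derive := dp e t t0)).
have dF (t : R) : 0 < t -> is_derive t (1 : R) (fun t : R => p^-1 * t `^ p) (t `^ (p - 1)).
  move=> t0; apply: is_derive_eq (is_deriveZ p^-1 (dp p t t0)) _.
  by rewrite /GRing.scale/= mulKf.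
have cF (t : R) : 0 < t -> {for t, continuous (fun t : R => p^-1 * t `^ p)}.
  by move=> t0; apply/differentiable_continuous/derivable1_diffP; exact: (ex_derive (is_derive := dF t t0)).
rewrite (@continuous_FTC2 R _ (fun t : R => p^-1 * t `^ p))//.
- by rewrite -EFinB -mulrBr mulrC.
- apply: continuous_in_subspaceT => t; rewrite inE/= in_itv/= => /andP[ct _].
  by apply: cp; exact: lt_le_trans ct.
- split=> [t||].
  + rewrite in_itv/= => /andP[ct _].
    exact: (ex_derive (is_derive := dF t (lt_trans c0 ct))).
  + by apply: cvg_at_right_filter; exact: cF.
  + by apply: cvg_at_left_filter; apply: cF; exact: lt_trans cd.
- move=> t; rewrite in_itv/= => /andP[ct _].
  by rewrite derive1E; apply: derive_val; apply: dF; exact: lt_trans ct.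
Qed.

Lemma integral_powR_itvoc_le (p d : R) : 0 < p -> 0 < d ->
  (\int[lam]_(t in `]0%R, d]) (t `^ (p - 1))%:E <= (d `^ p / p)%:E)%E.
Proof.
move=> p0 d0.
(* The intervals exhaust []0, d]]; dividing by [k.+2] keeps the left end strictly below [d], as
   [integral_powR_itvcc] requires. *)
pose F (k : nat) : set R := `[d / k.+2%:R, d]%classic.
have mF k : measurable (F k : set (measurableTypeR R)) by exact: measurable_itv.
have F0 k : 0 < d / k.+2%:R by rewrite divr_gt0.
have -> : `]0, d]%classic = \bigcup_k F k :> set R.
  apply/seteqP; split=> t; rewrite /F/= in_itv/=.
    move=> /andP[t0 td]; exists (Num.truncn (d / t)) => //=.
    rewrite in_itv/= td andbT ler_pdivrMr// mulrC -ler_pdivrMr//.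
    by rewrite (le_trans (ltW (truncnS_gt _)))// ler_nat.
  move=> [k _]; rewrite /F/= in_itv/= => /andP[kt ->].
  by rewrite andbT (lt_le_trans _ kt).
have cv : (\int[lam]_(t in F k) (t `^ (p - 1))%:E @[k --> \oo] -->
    \int[lam]_(t in \bigcup_k F k) (t `^ (p - 1))%:E)%E.
  apply: ge0_nondecreasing_set_cvg_integral => //.
  - move=> i j ij; rewrite subsetEset => t; rewrite /F/= !in_itv/= => /andP[it ->].
    rewrite andbT (le_trans _ it)// ler_pM2l// lef_pV2 ?posrE// ler_nat.
    exact: ij.
  - by move=> k; exact: measurable_powRE (mF k).
  - by move=> k t _; rewrite lee_fin powR_ge0.
rewrite -(cvg_lim _ cv)//; apply: lime_le; first by apply/cvg_ex; eexists; exact: cv.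
near=> k.
rewrite integral_powR_itvcc ?gt_eqF//; last first.
  by rewrite ltr_pdivrMr// ltr_pMr// ltr1n.
by rewrite lee_fin ler_pM2r ?invr_gt0// gerBl powR_ge0.
Unshelve. all: by end_near. Qed.

(** The weight [t^(-1/2)] reproduces itself under the kernel: []0, a]] contributes [2 a^(-1/2)], and
    the tail of [t^(-3/2)] beyond [a] at most as much. *)
Lemma integral_sqrtV_max_le (a b : R) : 0 < a ->
  (\int[lam]_(t in `]0%R, b[) (t `^ (- 2^-1) / Num.max a t)%:E <= (4 * a `^ (- 2^-1))%:E)%E.
Proof.
(* An upper end above both [a] and [b]: the integral can be split at [a] wherever [b] lies. *)
move=> a0; pose c := Num.max a b + 1.
have ac : a < c by rewrite /c -ltrBlDr lt_max; apply/orP; left; lra.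
have bc : b <= c by rewrite /c -lerBlDr le_max; apply/orP; right; lra.
have mk (D : set (measurableTypeR R)) : measurable D ->
    measurable_fun D (fun t : measurableTypeR R => (t `^ (- 2^-1) / Num.max a t)%:E).
  move=> mD; apply/measurable_EFinP; apply: (@measurable_funS _ _ _ _ setT) => //.
  apply: measurable_funM; first exact: measurable_powR.
  have -> : (fun t : measurableTypeR R => (Num.max a t)^-1) =
      (fun t : R => (Num.max a t) `^ (-1)).
    by apply/funext => t; rewrite powR_inv1// le_max ltW.
  have mpow : measurable_fun [set: measurableTypeR R]
      (fun t : measurableTypeR R => t `^ (-1) : measurableTypeR R).
    exact: measurable_powR.
  apply: (measurableT_comp mpow); exact: measurable_maxr.
have k0 (t : R) : (0 <= (t `^ (- 2^-1) / Num.max a t)%:E)%E.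
  by rewrite lee_fin divr_ge0 ?powR_ge0// le_max ltW.
apply: (@le_trans _ _ (\int[lam]_(t in `]0%R, a] `|` `]a, c]) (t `^ (- 2^-1) / Num.max a t)%:E)%E).
  apply: ge0_subset_integral => //; first exact: measurableU.
  - by apply: mk; exact: measurableU.
  - move=> t/=; rewrite !in_itv/= => /andP[t0 tb].
    by have [ta|ta] := leP t a; [left|right]; rewrite ?t0 ?ta//= (le_trans (ltW tb)).
rewrite ge0_integral_setU//; last 2 first.
- by apply: mk; exact: measurableU.
- apply/eqP/seteqP; split=> // t /= []; rewrite !in_itv/= => /andP[_ ta] /andP[at' _].
  by move: at'; rewrite ltNge ta.
have -> : 4 * a `^ (- 2^-1) = a^-1 * (a `^ 2^-1 / 2^-1) + 2 * a `^ (- 2^-1).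
  have -> : a^-1 * (a `^ 2^-1 / 2^-1) = 2 * a `^ (- 2^-1).
    have -> : - 2^-1 = 2^-1 + -1 :> R by field.
    rewrite powRD ?(gt_eqF a0) ?implybT// powR_inv1 ?(ltW a0)//.
    by field; rewrite gt_eqF.
  ring.
rewrite EFinD; apply: leeD.
  apply: (@le_trans _ _ (\int[lam]_(t in `]0%R, a]) (a^-1%:E * (t `^ (2^-1 - 1))%:E))%E).
    apply: ge0_le_integral => //; first exact: mk.
    - by apply: measurable_funeM; exact: measurable_powRE.
    - move=> t; rewrite /= in_itv/= => /andP[t0 ta].
      rewrite -EFinM lee_fin (max_l ta) mulrC.
      by rewrite (_ : 2^-1 - 1 = - 2^-1)//; field.
  rewrite ge0_integralZl//.
  - by rewrite EFinM lee_pmul2l ?lte_fin ?invr_gt0//; apply: integral_powR_itvoc_le.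
  - exact: measurable_powRE.
  - by move=> t _; rewrite lee_fin powR_ge0.
  - by rewrite lee_fin invr_ge0 ltW.
apply: (@le_trans _ _ (\int[lam]_(t in `[a, c]) (t `^ (- 2^-1 - 1))%:E)%E).
  apply: (@le_trans _ _ (\int[lam]_(t in `]a, c]) (t `^ (- 2^-1 - 1))%:E)%E).
    apply: ge0_le_integral => //; first exact: mk.
    - exact: measurable_powRE.
    - move=> t; rewrite /= in_itv/= => /andP[at' tc].
      have t0 : 0 < t := lt_trans a0 at'.
      rewrite lee_fin max_r ?(ltW at')// powRD ?(gt_eqF t0) ?implybT//.
      by rewrite powR_inv1 ?(ltW t0).
  apply: ge0_subset_integral => //.
  - exact: measurable_powRE.
  - by move=> t _; rewrite lee_fin powR_ge0.
  - by move=> t /=; rewrite !in_itv/= => /andP[/ltW -> ->].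
rewrite integral_powR_itvcc// lee_fin.
have := powR_ge0 c (- 2^-1).
by rewrite invrN invrK; move: (c `^ _) (a `^ _) => C A C0; lra.
Qed.

End powR_integrals.

Lemma ae_mono (d : measure_display) (T : measurableType d) (R : realType)
    (m : {measure set T -> \bar R}) (P Q : T -> Prop) :
  {ae m, forall x, P x} -> (forall x, P x -> Q x) -> {ae m, forall x, Q x}.
Proof.
move=> [N [mN N0 sN]] PQ; exists N; split=> //.
by apply: subset_trans sN; apply: subsetC => x; exact: PQ.
Qed.

Lemma le_halves_le0 (R : realType) (x N : R) : (forall k, x <= N / 2 ^+ k) -> x <= 0.
Proof.
move=> xN; rewrite leNgt; apply/negP => x0.
have N0 : 0 < N by apply: lt_le_trans x0 _; have := xN 0%N; rewrite expr0 divr1.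
pose k := (Num.truncn (N / x)).+1.
have : N / 2 ^+ k < x.
  rewrite ltr_pdivrMr ?exprn_gt0// mulrC -ltr_pdivrMr//.
  apply: lt_le_trans (truncnS_gt _) _.
  by rewrite -natrX ler_nat ltnW// ltn_expl.
by rewrite ltNge xN.
Qed.

Lemma ae_itv_ex (R : realType) (P : R -> Prop) (c d : R) : c < d ->
  {ae @lebesgue_measure R, forall t, c < t < d -> P t} -> exists2 t, c < t < d & P t.
Proof.
move=> cd [N [mN N0 sN]]; apply: contrapT => nex.
have : (lebesgue_measure `]c, d[%classic <= lebesgue_measure N)%E.
  apply: le_measure; rewrite ?inE// => t /=; rewrite in_itv/= => tcd.
  by apply: sN => /= h; apply: nex; exists t => //; exact: h.
by rewrite N0 lebesgue_measure_itv/= lte_fin cd -EFinB lee_fin subr_le0 leNgt cd.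
Qed.

Section volterra_uniqueness.
Context (R : realType) (u : R -> R) (E : set R) (C e : R).
Local Notation lam := (@lebesgue_measure R).
Hypothesis mu : measurable_fun [set: measurableTypeR R] (u : measurableTypeR R -> measurableTypeR R).
Hypothesis u2 : (\int[lam]_(t in `]0%R, 1%R[) (u t ^+ 2)%:E < +oo)%E.
Hypothesis aeE : {ae lam, forall t, 0 < t < 1 -> E t}.
Hypothesis C0 : 0 <= C.
Hypothesis e0 : 0 < e.
Let J (a b : R) := (\int[lam]_(t in `]0%R, b[) (`|u t| / Num.max a t)%:E)%E.
Hypothesis volterra : forall a b, E a -> E b -> 0 < a -> a < b -> b < 1 ->
  ((`|u a - u b|)%:E <= (C * b `^ e)%:E * J a b)%E.

Let A := fine (\int[lam]_(t in `]0%R, 1%R[) (u t ^+ 2)%:E).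

Let u2_ge0 : (0 <= \int[lam]_(t in `]0%R, 1%R[) (u t ^+ 2)%:E)%E.
Proof. by apply: integral_ge0 => t _; rewrite lee_fin sqr_ge0. Qed.

Let AE : (\int[lam]_(t in `]0%R, 1%R[) (u t ^+ 2)%:E)%E = A%:E.
Proof. by rewrite fineK// ge0_fin_numE. Qed.

Let A0 : 0 <= A. Proof. exact: fine_ge0. Qed.

Let mu2 (D : set (measurableTypeR R)) : measurable D ->
  measurable_fun D (fun t : measurableTypeR R => (u t ^+ 2)%:E).
Proof.
move=> mD; apply/measurable_EFinP; apply: (@measurable_funS _ _ _ _ setT) => //.
exact: measurable_funX.
Qed.

Let mabsu (D : set (measurableTypeR R)) : measurable D ->
  measurable_fun D (fun t : measurableTypeR R => `|u t|%:E).
Proof.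
move=> mD; apply/measurable_EFinP; apply: (@measurable_funS _ _ _ _ setT) => //.
exact: measurableT_comp.
Qed.

Let mmax (a : R) : 0 < a -> measurable_fun [set: measurableTypeR R]
  (fun t : measurableTypeR R => (Num.max a t)^-1 : measurableTypeR R).
Proof.
move=> a0.
have -> : (fun t : measurableTypeR R => (Num.max a t)^-1) = (fun t : R => (Num.max a t) `^ (-1)).
  by apply/funext => t; rewrite powR_inv1// le_max ltW.
have mpow : measurable_fun [set: measurableTypeR R]
    (fun t : measurableTypeR R => t `^ (-1) : measurableTypeR R).
  exact: measurable_powR.
by apply: (measurableT_comp mpow); exact: measurable_maxr.
Qed.

Let mker (f : R -> R) (a : R) (D : set (measurableTypeR R)) : 0 < a -> measurable D ->
  measurable_fun [set: measurableTypeR R] (f : measurableTypeR R -> measurableTypeR R) ->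
  measurable_fun D (fun t : measurableTypeR R => (f t / Num.max a t)%:E).
Proof.
move=> a0 mD mf; apply/measurable_EFinP; apply: (@measurable_funS _ _ _ _ setT) => //.
by apply: measurable_funM => //; exact: mmax.
Qed.

Let mabs : measurable_fun [set: measurableTypeR R]
  (fun t : measurableTypeR R => `|u t| : measurableTypeR R).
Proof. exact: measurableT_comp. Qed.

Let maxa_gt0 (a t : R) : 0 < a -> 0 < Num.max a t.
Proof. by move=> a0; rewrite lt_max a0. Qed.

Let J_ge0 a b : 0 < a -> (0 <= J a b)%E.
Proof.
by move=> a0; apply: integral_ge0 => t _; rewrite lee_fin divr_ge0// ltW// maxa_gt0.
Qed.

Let mw : measurable_fun [set: measurableTypeR R]
  (fun t : measurableTypeR R => t `^ (- 2^-1) : measurableTypeR R).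
Proof. exact: measurable_powR. Qed.

Let sub01 (b : R) : b < 1 -> `]0, b[ `<=` (`]0, 1[ : set R).
Proof. by move=> b1 t /=; rewrite !in_itv/= => /andP[-> /lt_trans->]. Qed.

(** The a priori bound that starts the iteration. Young's inequality gives [|u| / max <= a^(-1/2)
    u^2 + a^(1/2) / max^2]; as [a^(1/2) t^(1/2) <= max], the last term is at most [t^(-1/2) / max],
    which [integral_sqrtV_max_le] controls. *)
Let J_le a b : 0 < a -> b < 1 -> (J a b <= ((A + 4) * a `^ (- 2^-1))%:E)%E.
Proof.
move=> a0 b1.
apply: (@le_trans _ _ (\int[lam]_(t in `]0%R, b[) ((a `^ (- 2^-1))%:E * (u t ^+ 2)%:E +
    (t `^ (- 2^-1) / Num.max a t)%:E))%E).
  apply: ge0_le_integral => //.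
  - by move=> t _; rewrite lee_fin divr_ge0// ltW// maxa_gt0.
  - exact: mker.
  - by apply: emeasurable_funD; [apply: measurable_funeM; exact: mu2|exact: mker].
  - move=> t; rewrite /= in_itv/= => /andP[t0 tb]; rewrite -EFinM -EFinD lee_fin.
    have m0 := maxa_gt0 t a0; set m := Num.max a t in m0 *.
    have p0 (x : R) : 0 < x -> 0 < x `^ 2^-1 by exact: powR_gt0.
    have pp (x : R) : 0 < x -> x = x `^ 2^-1 * x `^ 2^-1.
      move=> x0; rewrite -powRD; last by rewrite (gt_eqF x0) implybT.
      by rewrite (_ : 2^-1 + 2^-1 = 1) ?powRr1 ?(ltW x0)//; field.
    have ple (x : R) : 0 < x -> x <= m -> x `^ 2^-1 <= m `^ 2^-1.
      by move=> x0 xm; apply: ge0_ler_powR; rewrite ?nnegrE ?invr_ge0 ?(ltW x0) ?(ltW m0).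
    have am : a `^ 2^-1 <= m `^ 2^-1 by apply: ple => //; rewrite le_max lexx.
    have tm : t `^ 2^-1 <= m `^ 2^-1 by apply: ple => //; rewrite le_max lexx orbT.
    rewrite !powRN -(real_normK (num_real (u t))).
    move: (p0 _ a0) (p0 _ t0) (p0 _ m0) am tm (pp _ m0) (normr_ge0 (u t)).
    move: (a `^ _) (t `^ _) (m `^ _) `|u t| => al ta me x al0 ta0 me0 am tm mE x0.
    apply: (@le_trans _ _ (al^-1 * x ^+ 2 + al / m ^+ 2)).
      have -> : al^-1 * x ^+ 2 + al / m ^+ 2 = al^-1 * (x ^+ 2 + (al / m) ^+ 2).
        by field; rewrite !gt_eqF.
      have -> : x / m = al^-1 * (x * (al / m)) by field; rewrite !gt_eqF.
      rewrite ler_pM2l ?invr_gt0//.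
      have := sqr_ge0 (x - al / m); have := mulr_ge0 x0 (ltW (divr_gt0 al0 m0)).
      move: (al / m) => q; nra.
    rewrite lerD2l expr2 invfM mulrA ler_pM2r ?invr_gt0//.
    rewrite ler_pdivrMr// mulrC ler_pdivlMr// [leRHS]mE.
    by apply: ler_pM => //; exact: ltW.
rewrite ge0_integralD//.
- rewrite mulrDl EFinD; apply: leeD; last exact: integral_sqrtV_max_le.
  rewrite ge0_integralZl//; last 3 first.
  + exact: mu2.
  + by move=> t _; rewrite lee_fin sqr_ge0.
  + by rewrite lee_fin powR_ge0.
  rewrite mulrC EFinM; apply: lee_wpmul2l; first by rewrite lee_fin powR_ge0.
  rewrite -AE; apply: ge0_subset_integral => //.
  + exact: mu2.
  + by move=> t _; rewrite lee_fin sqr_ge0.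
  + exact: sub01.
- by move=> t _; rewrite -EFinM lee_fin mulr_ge0 ?powR_ge0 ?sqr_ge0.
- by apply: measurable_funeM; exact: mu2.
- by move=> t _; rewrite lee_fin divr_ge0 ?powR_ge0// ltW// maxa_gt0.
- exact: mker.
Qed.

(** The number 8 is twice the factor 4 of [integral_sqrtV_max_le]: inserting the bound
    [N 2^-k a^(-1/2)] into the inequality returns it with half the constant. *)
Let near_zero b : E b -> 0 < b -> b < 1 -> u b = 0 -> C * b `^ e <= 8^-1 ->
  forall a, E a -> 0 < a -> a < b -> u a = 0.
Proof.
move=> Eb b0 b1 ub Cb.
have est a : E a -> 0 < a -> a < b -> (`|u a|%:E <= 8^-1%:E * J a b)%E.
  move=> Ea a0 ab; have := volterra Ea Eb a0 ab b1; rewrite ub subr0.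
  move/le_trans; apply; apply: lee_wpmul2r; first exact: J_ge0.
  by rewrite lee_fin.
pose N := (A + 4) / 8.
have N0 : 0 <= N by rewrite divr_ge0// addr_ge0.
have bound k a : E a -> 0 < a -> a < b -> `|u a| <= N / 2 ^+ k * a `^ (- 2^-1).
  elim: k a => [|k IH] a Ea a0 ab; rewrite -lee_fin; apply: (le_trans (est a Ea a0 ab)).
    apply: (@le_trans _ _ (8^-1%:E * ((A + 4) * a `^ (- 2^-1))%:E)%E).
      by apply: lee_wpmul2l; [rewrite lee_fin|exact: J_le].
    by rewrite -EFinM lee_fin /N expr0 divr1 mulrA [8^-1 * _]mulrC.
  set M := N / 2 ^+ k in IH.
  have M0 : 0 <= M by rewrite /M divr_ge0// exprn_ge0.
  apply: (@le_trans _ _ (8^-1%:E * (M%:E * (4 * a `^ (- 2^-1))%:E))%E).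
    apply: lee_wpmul2l; first by rewrite lee_fin.
    apply: (@le_trans _ _ (\int[lam]_(t in `]0%R, b[) (M%:E * (t `^ (- 2^-1) / Num.max a t)%:E))%E).
      apply: ae_ge0_le_integral => //.
      - by move=> t _; rewrite lee_fin divr_ge0// ltW// maxa_gt0.
      - exact: mker.
      - by move=> t _; rewrite -EFinM lee_fin mulr_ge0// divr_ge0 ?powR_ge0// ltW// maxa_gt0.
      - by apply: measurable_funeM; exact: mker.
      - apply: (ae_mono aeE) => t Et; rewrite /= in_itv/= => /andP[t0 tb].
        rewrite -EFinM lee_fin mulrA ler_pM2r ?invr_gt0 ?maxa_gt0//.
        by apply: IH => //; apply: Et; rewrite t0 (lt_trans tb).
    rewrite ge0_integralZl//.
    - by apply: lee_wpmul2l; [rewrite lee_fin|exact: integral_sqrtV_max_le].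
    - exact: mker.
    - by move=> t _; rewrite lee_fin divr_ge0 ?powR_ge0// ltW// maxa_gt0.
  rewrite -!EFinM lee_fin exprS invfM mulrCA -/M [N * _](_ : _ = M / 2); last first.
    by rewrite /M mulrCA mulrC.
  have := mulr_ge0 M0 (powR_ge0 a (- 2^-1)); move: (a `^ _) => q; lra.
move=> a Ea a0 ab; apply/eqP; rewrite -normr_le0.
apply: (@le_halves_le0 _ _ (N * a `^ (- 2^-1))) => k.
by rewrite mulrAC; exact: bound.
Qed.

(** Seen from a fixed [a0 > 0] the kernel is at most [1 / a0], and the inequality becomes an
    ordinary Volterra inequality with constant [C / a0]. Since [u] vanishes almost everywhere below
    [s], only an interval shorter than [d] contributes, and each iteration halves the bound. The
    admissible [d] does not depend on [s]. *)
Let continuation a0 s d : E a0 -> 0 < a0 -> a0 < s -> 0 < d -> C / a0 * d <= 2^-1 ->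
  (forall t, E t -> 0 < t -> t < 1 -> t < s -> u t = 0) ->
  forall t, E t -> 0 < t -> t < 1 -> t < s + d -> u t = 0.
Proof.
move=> Ea0 a00 a0s d0 Kd us b Eb b0 b1 bsd.
have [bs|sb] := ltP b s; first exact: us.
have s0 : 0 < s := lt_trans a00 a0s.
have ua0 : u a0 = 0 by apply: us => //; rewrite (lt_trans a0s)// (le_lt_trans sb).
pose K := C / a0.
have K0 : 0 <= K by rewrite divr_ge0// ltW.
pose I (b : R) := (\int[lam]_(t in `]0%R, b[) `|u t|%:E)%E.
have I0 x : (0 <= I x)%E by apply: integral_ge0 => t _; rewrite lee_fin.
have est c : E c -> s <= c -> c < 1 -> (`|u c|%:E <= K%:E * I c)%E.
  move=> Ec sc c1; have a0c := lt_le_trans a0s sc; have c0 := lt_trans a00 a0c.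
  have := volterra Ea0 Ec a00 a0c c1; rewrite ua0 sub0r normrN.
  move/le_trans; apply.
  apply: (@le_trans _ _ (C%:E * J a0 c)%E).
    apply: lee_wpmul2r; first exact: J_ge0.
    have : c `^ e <= 1 `^ e by apply: ge0_ler_powR; rewrite ?nnegrE ?ler01 ?(ltW e0) ?(ltW c0) ?(ltW c1).
    by rewrite powR1 lee_fin => ce; rewrite ler_piMr.
  rewrite /K EFinM -muleA; apply: lee_wpmul2l; first by rewrite lee_fin.
  rewrite -ge0_integralZl//; last 2 first.
  - exact: mabsu.
  - by rewrite lee_fin invr_ge0 ltW.
  apply: ge0_le_integral => //.
  - by move=> t _; rewrite lee_fin divr_ge0// ltW// maxa_gt0.
  - exact: mker.
  - by apply: measurable_funeM; exact: mabsu.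
  - move=> t _; rewrite -EFinM lee_fin mulrC ler_wpM2r//.
    by rewrite lef_pV2 ?posrE ?maxa_gt0// le_max lexx.
(* The first bound comes from [|u| <= u^2 + 1] integrated over []0, 1[]. *)
pose N := K * (A + 1).
have bound k c : E c -> s <= c -> c < 1 -> c < s + d -> `|u c| <= N / 2 ^+ k.
  elim: k c => [|k IH] c Ec sc c1 csd; rewrite -lee_fin; apply: (le_trans (est c Ec sc c1)).
    rewrite expr0 divr1 /N [leRHS]EFinM; apply: lee_wpmul2l; first by rewrite lee_fin.
    apply: (@le_trans _ _ (\int[lam]_(t in `]0%R, 1%R[) ((u t ^+ 2)%:E + 1%:E))%E).
      apply: (@le_trans _ _ (\int[lam]_(t in `]0%R, 1%R[) `|u t|%:E)%E).
        apply: ge0_subset_integral => //; first exact: mabsu.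
        exact: sub01.
      apply: ge0_le_integral => //; first exact: mabsu.
        by apply: emeasurable_funD => //; exact: mu2.
      move=> t _; rewrite -EFinD lee_fin -(real_normK (num_real (u t))).
      by move: `|u t| => q; have := sqr_ge0 (q - 2^-1); nra.
    rewrite ge0_integralD//; last 2 first.
    - by move=> t _; rewrite lee_fin sqr_ge0.
    - exact: mu2.
    rewrite AE integral_cst// mul1e [X in (_ + X)%E](lebesgue_measure_itv `]0, 1[)/= lte_fin ltr01.
    by rewrite -EFinB -EFinD subr0.
  set M := N / 2 ^+ k in IH.
  have M0 : 0 <= M by rewrite /M divr_ge0 ?exprn_ge0// /N mulr_ge0// addr_ge0.
  have -> : N / 2 ^+ k.+1 = M / 2 by rewrite /M exprS invfM mulrA mulrAC.
  apply: (@le_trans _ _ (K%:E * (M * (c - s))%:E)%E); last first.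
    rewrite -EFinM lee_fin mulrCA ler_wpM2l//.
    apply: le_trans Kd; rewrite ler_wpM2l//; lra.
  apply: lee_wpmul2l; first by rewrite lee_fin.
  have cup : `]0, c[%classic = `]0, s[ `|` `[s, c[ :> set R.
    apply/seteqP; split=> t /=; rewrite !in_itv/=.
      by move=> /andP[t0 tc]; have [ts|st] := ltP t s; [left|right]; rewrite ?t0 ?tc.
    by move=> [/andP[-> ts]|/andP[st ->]]; rewrite ?(lt_le_trans ts) ?(lt_le_trans s0).
  rewrite /I cup ge0_integral_setU//; last 2 first.
  - by apply: mabsu; exact: measurableU.
  - apply/eqP/seteqP; split=> // t /= []; rewrite !in_itv/= => /andP[_ ts] /andP[st _].
    by move: ts; rewrite ltNge st.
  rewrite -[leRHS]add0e; apply: leeD.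
    apply: (@le_trans _ _ (\int[lam]_(t in `]0%R, s[) (cst 0 t))%E); last by rewrite integral0.
    apply: ae_ge0_le_integral => //; first exact: mabsu.
    apply: (ae_mono aeE) => t Et; rewrite /= in_itv/= => /andP[t0 ts].
    have t1 : t < 1 by rewrite (lt_trans ts)// (le_lt_trans sc).
    by rewrite (us t)// ?normr0//; apply: Et; rewrite t0.
  apply: (@le_trans _ _ (\int[lam]_(t in `[s, c[) (cst M%:E t))%E); last first.
    rewrite integral_cst// [X in (_ * X)%E](lebesgue_measure_itv `[s, c[)/= lte_fin.
    case: ifPn => [_|]; first by rewrite -EFinB -EFinM.
    by rewrite mule0 lee_fin mulr_ge0// subr_ge0.
  apply: ae_ge0_le_integral => //; first exact: mabsu.
  apply: (ae_mono aeE) => t Et; rewrite /= in_itv/= => /andP[st tc].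
  have t1 : t < 1 by rewrite (lt_trans tc).
  rewrite lee_fin IH ?(lt_trans tc)//.
  by apply: Et; rewrite t1 (lt_le_trans s0).
apply/eqP; rewrite -normr_le0.
by apply: (@le_halves_le0 _ _ N) => k; exact: bound.
Qed.

Lemma volterra_uniqueness b : E b -> 0 < b -> b < 1 -> u b = 0 -> C * b `^ e <= 8^-1 ->
  forall t, E t -> 0 < t < 1 -> u t = 0.
Proof.
move=> Eb b0 b1 ub Cb.
(* A good point below [b], where [u] is already zero; it serves as base point of all continuation
   steps, which gives them a common length. *)
have [|a0 /andP[a00 a0b] Ea0] := @ae_itv_ex R E 0 b b0.
  by apply: (ae_mono aeE) => t Et /andP[t0 tb]; apply: Et; rewrite t0 (lt_trans tb).
(* Then [C / a0 * d = C / (2 (C + 1)) <= 1/2], also when [C = 0]. *)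
pose d := a0 / (2 * (C + 1)).
have C1 : 0 < C + 1 by rewrite ltr_wpDl.
have d0 : 0 < d by rewrite divr_gt0// mulr_gt0.
have Kd : C / a0 * d <= 2^-1.
  have -> : C / a0 * d = (C / (C + 1)) / 2 by rewrite /d; field; rewrite !gt_eqF.
  by rewrite ler_piMl// ler_pdivrMr// mul1r; lra.
have claim k : forall t, E t -> 0 < t -> t < 1 -> t < b + k%:R * d -> u t = 0.
  elim: k => [|k IH].
    by move=> t Et t0 t1; rewrite mul0r addr0; exact: near_zero Eb b0 b1 ub Cb t Et t0.
  move=> t Et t0 t1; rewrite -natr1 mulrDl mul1r addrA.
  apply: (continuation Ea0 a00 _ d0 Kd IH) => //.
  by rewrite (lt_le_trans a0b)// lerDl mulr_ge0// ltW.
move=> t Et /andP[t0 t1].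
(* More than [1 / d] steps of length [d] pass the end point 1. *)
apply: (claim (Num.truncn (d^-1)).+1) => //.
have : 1 < (Num.truncn d^-1).+1%:R * d by rewrite -ltr_pdivrMr// div1r truncnS_gt.
lra.
Qed.

End volterra_uniqueness.

(** * Mollification at Lebesgue points *)

Section mollifier.
Context (R : realType) (Th th : R -> R) (C : R).
Hypothesis dTh : forall t : R, is_derive t (1 : R) Th (th t).
Hypothesis Th0 : forall t, t <= 0 -> Th t = 0.
Hypothesis Th1 : forall t, 1 <= t -> Th t = 1.
Hypothesis th_bnd : forall t, 0 <= th t <= C.
Hypothesis thL : forall t, t <= 0 -> th t = 0.
Hypothesis thR : forall t, 1 <= t -> th t = 0.
Hypothesis cth : continuous th.
Local Notation lam := (@lebesgue_measure R).

(** The mollifier of unit mass carried by [[y, y + e]], namely the derivative of the step [Th]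
    rescaled from [[0, 1]] to that interval. *)
Definition bump (y e t : R) : R := e^-1 * th (e^-1 * t + - (e^-1 * y)).

Lemma is_derive_step (y e t : R) :
  is_derive t (1 : R) (fun t => Th (e^-1 * t + - (e^-1 * y))) (bump y e t).
Proof.
rewrite /bump [e^-1 * th _]mulrC.
apply: (@is_derive1_comp _ Th (fun t => e^-1 * t + - (e^-1 * y))).
apply: is_derive_eq (is_deriveD (is_deriveZ e^-1 (is_derive_id t 1))
  (is_derive_cst (- (e^-1 * y)) t 1)) _.
by rewrite addr0 /GRing.scale/= mulr1.
Qed.

Lemma continuous_bump (y e : R) : continuous (bump y e).
Proof.
move=> t; apply: cvgM; first exact: cvg_cst.
apply: (@continuous_comp _ _ _ (fun t => e^-1 * t + - (e^-1 * y)) th); last exact: cth.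
by apply: cvgD; [exact: mulrl_continuous|exact: cvg_cst].
Qed.

Lemma bump_ge0 (y e t : R) : 0 < e -> 0 <= bump y e t.
Proof. by move=> e0; rewrite mulr_ge0 ?invr_ge0 ?(ltW e0)//; have /andP[] := th_bnd (e^-1 * t + - (e^-1 * y)). Qed.

Lemma bump_le (y e t : R) : 0 < e -> bump y e t <= C / e.
Proof.
move=> e0; rewrite /bump mulrC ler_pM2r ?invr_gt0//.
by have /andP[] := th_bnd (e^-1 * t + - (e^-1 * y)).
Qed.

Lemma bump_out (y e t : R) : 0 < e -> t <= y \/ y + e <= t -> bump y e t = 0.
Proof.
move=> e0 h; rewrite /bump -mulrBr mulrC; case: h => h.
  by rewrite thL ?mul0r// pmulr_rle0 ?invr_gt0// subr_le0.
by rewrite thR ?mul0r// mulrC ler_pdivlMr// mul1r; lra.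
Qed.

Lemma measurable_bump (y e : R) (D : set (measurableTypeR R)) : measurable D ->
  measurable_fun D (bump y e : measurableTypeR R -> measurableTypeR R).
Proof.
move=> mD; apply: (@measurable_funS _ _ _ _ setT) => //.
have cb := @continuous_bump y e; exact: continuous_measurable_fun.
Qed.

Lemma integral_bump (y e : R) : 0 < e -> 0 <= y -> y + e <= 1 ->
  (\int[lam]_(t in `]0%R, 1%R[) (bump y e t)%:E = 1)%E.
Proof.
move=> e0 y0 ye.
have -> : (\int[lam]_(t in `]0%R, 1%R[) (bump y e t)%:E =
    \int[lam]_(t in `[y, (y + e)%R]) (bump y e t)%:E)%E.
  rewrite integral_mkcond [RHS]integral_mkcond; apply: eq_integral => t _.
  rewrite !patchE !mem_setE !in_itv/=.
  have [/andP[t0 t1]|t01] := boolP (0 < t < 1); have [/andP[yt tye]|ytye] := boolP (y <= t <= y + e) => //.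
  - by rewrite bump_out//; move: ytye; rewrite negb_and -!ltNge => /orP[/ltW|/ltW]; tauto.
  - rewrite bump_out//; move: t01; rewrite negb_and -!leNgt => /orP[h|h].
      by left; exact: le_trans y0.
    by right; exact: le_trans h.
rewrite (@continuous_FTC2 R _ (fun t => Th (e^-1 * t + - (e^-1 * y)))).
- have -> : e^-1 * (y + e) + - (e^-1 * y) = 1 by field; rewrite gt_eqF.
  by rewrite subrr (Th0 (lexx _)) (Th1 (lexx _)) -EFinB subr0.
- by rewrite ltrDl.
- exact/continuous_subspaceT/continuous_bump.
- have cT := is_derive_continuous (is_derive_step y e).
  split=> [t _||]; first exact: (ex_derive (is_derive := is_derive_step y e t)).
  + by apply: cvg_at_right_filter; exact: cT.
  + by apply: cvg_at_left_filter; exact: cT.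
- move=> t _; rewrite derive1E.
  exact: (derive_val (is_derive := is_derive_step y e t)).
Qed.

Lemma integrable_mul_bump (f : R -> R) (y e : R) : 0 < e ->
  lam.-integrable `]0%R, 1%R[ (EFin \o f) ->
  lam.-integrable `]0%R, 1%R[ (EFin \o (fun t => f t * bump y e t)).
Proof.
move=> e0 intf.
have C0 : 0 <= C by have /andP[h1 h2] := th_bnd 0; exact: le_trans h2.
have m01 : measurable (`]0, 1[%classic : set (measurableTypeR R)) by exact: measurable_itv.
have := integrableZl m01 (C / e) intf; apply: le_integrable => //.
  apply/measurable_EFinP; apply: measurable_funM; last exact: measurable_bump.
  by case/integrableP: intf => /measurable_EFinP.
move=> t _ /=; rewrite lee_fin normrM [`|C / e * _|]normrM mulrC ler_wpM2r//.
rewrite (ger0_norm (bump_ge0 _ _ e0)).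
by rewrite (le_trans (bump_le _ _ e0))// ler_norm.
Qed.

Lemma integrable_bump (y e : R) : 0 < e -> lam.-integrable `]0%R, 1%R[ (EFin \o bump y e).
Proof.
move=> e0; have i1 : lam.-integrable `]0%R, 1%R[ (EFin \o cst 1).
  apply: measurable_bounded_integrable => //.
  - by rewrite /= lebesgue_measure_itv/= lte_fin ltr01 -EFinB ltry.
  - by exists 1; split; [exact: num_real|move=> M M1 t _ /=; rewrite normr1 ltW].
have := integrable_mul_bump y e0 i1.
by apply: eq_integrable => // t _ /=; rewrite mul1r.
Qed.

(** The window [[y, y + e]] only has to contain [x]. This allows averaging to the right of [a] and
    to the left of [b], so that the test function stays between the two points. *)
Definition approx_pt (f : R -> R) (x : R) : Prop :=
  forall h : R, 0 < h -> exists2 e0 : R, 0 < e0 & forall e y, 0 < e < e0 ->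
    x - e <= y <= x -> `|\int[lam]_(t in `]0, 1[) (f t * bump y e t) - f x| <= h.

(** The coefficients of the combination are chosen after the point [b], so the good points must
    depend on the two profiles alone and serve every combination of them. *)
Lemma approx_pt_lin (f g : R -> R) (a b x : R) :
  lam.-integrable `]0%R, 1%R[ (EFin \o f) -> lam.-integrable `]0%R, 1%R[ (EFin \o g) ->
  approx_pt f x -> approx_pt g x -> approx_pt (fun t => a * f t + b * g t) x.
Proof.
move=> intf intg af ag h h0.
pose K := `|a| + `|b| + 1.
have K0 : 0 < K by rewrite ltr_wpDl// addr_ge0.
have [e1 e10 H1] := af (h / K) (divr_gt0 h0 K0).
have [e2 e20 H2] := ag (h / K) (divr_gt0 h0 K0).
exists (Num.min e1 e2); first by rewrite lt_min e10.
move=> e y /andP[e0]; rewrite lt_min => /andP[ee1 ee2] xy.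
have ifb := integrable_mul_bump y e0 intf; have igb := integrable_mul_bump y e0 intg.
have -> : \int[lam]_(t in `]0, 1[) ((a * f t + b * g t) * bump y e t) =
    a * \int[lam]_(t in `]0, 1[) (f t * bump y e t) +
    b * \int[lam]_(t in `]0, 1[) (g t * bump y e t).
  rewrite -!RintegralZl// -RintegralD//.
  - by apply: eq_Rintegral => t _; rewrite mulrDl !mulrA.
  - exact: (integrableZl _ a ifb).
  - exact: (integrableZl _ b igb).
have := H1 e y; rewrite e0 ee1 => /(_ isT xy) h1.
have := H2 e y; rewrite e0 ee2 => /(_ isT xy) h2.
set I1 := \int[_]_(_ in _) _ in h1 *; set I2 := \int[_]_(_ in _) (g _ * _) in h2 *.
have -> : a * I1 + b * I2 - (a * f x + b * g x) = a * (I1 - f x) + b * (I2 - g x) by ring.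
rewrite (le_trans (ler_normD _ _))// !normrM.
apply: (@le_trans _ _ (`|a| * (h / K) + `|b| * (h / K))).
  by apply: lerD; exact: ler_wpM2l.
rewrite -mulrDl mulrCA ler_piMr ?(ltW h0)// ler_pdivrMr// mul1r /K; lra.
Qed.

(** The bump is at most [C / e] and vanishes outside the ball of radius [e] around [x], a ball of
    measure [2 e]; the error is thus at most [2 C] times the mean deviation of [f] on that ball. *)
Lemma lebesgue_approx_pt (f : R -> R) (x : R) : 0 < x < 1 ->
  measurable_fun [set: measurableTypeR R] (f : measurableTypeR R -> measurableTypeR R) ->
  lam.-integrable `]0%R, 1%R[ (EFin \o f) ->
  lebesgue_pt (f \_ `]0, 1[%classic) x -> approx_pt f x.
Proof.
move=> /andP[x0 x1] mf intf lx h h0.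
have C0 : 0 <= C by have /andP[h1 h2] := th_bnd 0; exact: le_trans h2.
pose d := h / (2 * C + 1).
have C1 : 0 < 2 * C + 1 by rewrite ltr_wpDl// mulr_ge0.
have d0 : 0 < d by rewrite divr_gt0.
move: lx => /fine_cvgP[[r1 /= r10 fin1] /cvgrPdist_le/(_ d d0)[r2 /= r20 small]].
(* The bounds [x] and [1 - x] keep every window inside the unit interval, where the bump has
   integral 1. *)
pose e0 := Num.min (Num.min r1 r2) (Num.min x (1 - x)).
have e00 : 0 < e0 by rewrite !lt_min r10 r20 x0 subr_gt0.
exists e0 => // e y /andP[e_gt0]; rewrite !lt_min => /andP[/andP[er1 er2] /andP[ex ex1]].
move=> /andP[xy yx].
have nd r : 0 < e -> e < r -> `|0 - e| < r by move=> e1 er; rewrite sub0r normrN gtr0_norm.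
have fdavg := fin1 e (nd _ e_gt0 er1) e_gt0.
have davg_le := small e (nd _ e_gt0 er2) e_gt0.
set g := f \_ `]0, 1[%classic in fdavg davg_le.
have gf t : 0 < t < 1 -> g t = f t.
  by move=> t01; rewrite /g patchE ifT// inE/= in_itv.
have ib := integrable_bump y e_gt0.
have intb : lam.-integrable `]0%R, 1%R[ (EFin \o (fun t => f x * bump y e t)).
  exact: (integrableZl _ (f x) ib).
have Ib : \int[lam]_(t in `]0, 1[) (f x * bump y e t) = f x.
  by rewrite RintegralZl// /Rintegral integral_bump ?mulr1//; lra.
have ifb := integrable_mul_bump y e_gt0 intf.
rewrite -[X in _ - X]Ib -RintegralB//.
rewrite -lee_fin.
have intd : lam.-integrable `]0%R, 1%R[ (EFin \o (fun t => f t * bump y e t - f x * bump y e t)).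
  have m01 : measurable (`]0, 1[%classic : set (measurableTypeR R)) by exact: measurable_itv.
  have := integrableB m01 ifb intb; exact: eq_integrable.
rewrite EFin_normr_Rintegral//.
apply: (le_trans (le_abse_integral _ _ _)) => //; first by case/integrableP: intd.
pose k (t : R) := `|(center (g x) \o g) t|%:E.
have mg : measurable_fun [set: measurableTypeR R] (g : measurableTypeR R -> measurableTypeR R).
  apply: (measurable_restrictT f _).1; first exact: measurable_itv.
  exact: measurable_funS mf.
have mk (D : set (measurableTypeR R)) : measurable D -> measurable_fun D k.
  move=> mD; apply/measurable_EFinP; apply: (@measurable_funS _ _ _ _ setT) => //.
  by apply: measurableT_comp => //; apply: measurable_funB.
have mball : measurable (ball x e : set (measurableTypeR R)) by exact: measurable_ball.
have k0 t : (0 <= k t)%E by rewrite lee_fin.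
have Ce0 : (0 <= (C / e)%:E)%E by rewrite lee_fin divr_ge0// ltW.
apply: (@le_trans _ _ (\int[lam]_(t in ball x e) ((C / e)%:E * k t))%E).
  rewrite integral_mkcond [leRHS]integral_mkcond; apply: ge0_le_integral => //.
  - by move=> t _; rewrite patchE; case: ifP.
  - apply: (measurable_restrictT _ _).1 => //.
    by apply: measurableT_comp => //; case/integrableP: intd.
  - apply: (measurable_restrictT _ _).1 => //.
    by apply: measurable_funeM; exact: mk.
  - move=> t _; rewrite !patchE mem_setE in_itv/=.
    case: ifPn => [t01|_]; last by case: ifP => // _; exact: mule_ge0.
    have -> : f t * bump y e t - f x * bump y e t = (f t - f x) * bump y e t by ring.
    rewrite normrM (ger0_norm (bump_ge0 _ _ e_gt0)).
    case: ifPn => [_|].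
      rewrite (_ : k t = `|g t - g x|%:E)// -EFinM lee_fin (gf t t01) (gf x) ?x0// mulrC ler_wpM2r//.
      exact: bump_le.
    rewrite notin_setE /ball/= => /negP; rewrite -leNgt => xt.
    rewrite bump_out ?mulr0//.
    by move: xt; rewrite ler_normr => /orP[xt|xt]; [left|right]; lra.
rewrite ge0_integralZl//; last exact: mk.
have -> : (\int[lam]_(t in ball x e) k t = (2 * e * fine (davg g x e))%:E)%E.
  rewrite EFinM fineK// /davg /iavg lebesgue_measure_ball ?(ltW e_gt0)//.
  have -> : ((e *+ 2)%:E^-1 = ((2 * e)^-1)%:E)%E.
    by rewrite inver mulrn_eq0/= (gt_eqF e_gt0) mulr_natl.
  rewrite muleA -EFinM mulfV; first by rewrite mul1e.
  by rewrite mulf_neq0// gt_eqF.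
rewrite -EFinM lee_fin.
move: davg_le; rewrite sub0r normrN => /(le_trans (ler_norm _)) dd.
have -> : C / e * (2 * e * fine (davg g x e)) = 2 * C * fine (davg g x e).
  by field; rewrite gt_eqF.
apply: (@le_trans _ _ (2 * C * d)); first by rewrite ler_wpM2l// mulr_ge0.
by rewrite /d mulrCA ler_piMr ?(ltW h0)// ler_pdivrMr// mul1r; lra.
Qed.

End mollifier.

(** * Very weak solutions *)

(** The distributional form of [-Delta phi = c V (phi - m)]. No gradient of [phi] appears, and [m]
    is a parameter instead of the weighted mean, so that a combination of solutions is a solution
    with the same combination of the [m]. *)
Definition very_weak_solution (R : realType) (n : nat) (V : 'rV[R]_n -> R) (c : R)
    (phi : 'rV[R]_n -> R) (m : R) : Prop :=
  forall v, test_function (unit_ball R n) v ->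
    pairing phi (laplacian v) = - c * pairing (fun x => V x * (phi x - m)) v.

Section very_weak.
Context (R : realType) (n : nat).
Local Notation mu := (lebesgue_rV R n).
Local Notation B := (unit_ball R n).
Variables (V : 'rV[R]_n -> R) (M : R).
Hypothesis mV : measurable_fun B (V : 'rV[R]_n -> measurableTypeR R).
Hypothesis VM : forall x, B x -> `|V x| <= M.

Lemma Rintegral_sum (I : Type) (s : seq I) (F : I -> 'rV[R]_n -> R) :
  (forall i, mu.-integrable B (EFin \o F i)) ->
  mu.-integrable B (EFin \o (fun x => \sum_(i <- s) F i x)) /\
  \int[mu]_(x in B) (\sum_(i <- s) F i x) = \sum_(i <- s) \int[mu]_(x in B) F i x.
Proof.
move=> iF; have mB := measurable_unit_ball R n.
elim: s => [|i s [IH1 IH2]].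
  rewrite big_nil; under eq_Rintegral do rewrite big_nil.
  split; last by rewrite Rintegral_cst// mul0r.
  apply: eq_integrable (integrable0 mu B) => // x _.
  by rewrite /= big_nil.
have iS := integrableD mB (iF i) IH1.
rewrite big_cons -IH2 -RintegralD//; split.
  by apply: eq_integrable iS => // x _; rewrite /= big_cons.
by apply: eq_Rintegral => x _; rewrite big_cons.
Qed.

Lemma sq_integrable_center (phi : 'rV[R]_n -> R) (m : R) :
  sq_integrable B phi -> sq_integrable B (fun x => phi x - m).
Proof.
move=> sphi; apply: sq_integrableD => //.
by apply: (@sq_integrable_bounded _ _ _ `|m|) => // x _; rewrite normrN.
Qed.

(** Each [D_i v] is again a test function, so the definition of the weak gradient may be applied to
    it and moves the remaining derivative onto [v]. *)
Lemma weak_eigen_very_weak (lambda sigma : R) (phi : 'rV[R]_n -> R) :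
  sq_integrable B phi -> weak_eigen_solution B lambda V sigma phi ->
  very_weak_solution V (lambda + sigma) phi (wmean B V phi).
Proof.
move=> sphi [G wG eqG] v tv.
set m := wmean B V phi.
have tDv i := test_function_partial i tv.
have tDDv i := test_function_partial i (tDv i).
have E := eqG v tv.
have [_ S1] := @Rintegral_sum _ (index_enum 'I_n)
  (fun i x => G i x * 'D_(ebasis R i) v x)
  (fun i => sq_integrableM (wG i).1 (test_function_sq_integrable (tDv i))).
have [_ S2] := @Rintegral_sum _ (index_enum 'I_n)
  (fun i x => phi x * 'D_(ebasis R i) ('D_(ebasis R i) v) x)
  (fun i => sq_integrableM sphi (test_function_sq_integrable (tDDv i))).
have -> : pairing phi (laplacian v) =
    \sum_(i < n) \int[mu]_(x in B) (phi x * 'D_(ebasis R i) ('D_(ebasis R i) v) x).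
  by rewrite -S2; apply: eq_Rintegral => x _; rewrite /laplacian mulr_sumr.
rewrite (eq_bigr (fun i => - \int[mu]_(x in B) (G i x * 'D_(ebasis R i) v x))); last first.
  by move=> i _; exact: ((wG i).2 _ (tDv i)).
rewrite sumrN -S1; move: E; rewrite /wcenter -/m -/(pairing _ v).
move: (\int[mu]_(x in B) (\sum_(i < n) _)) (pairing _ _) => X Y /eqP.
by rewrite subr_eq => /eqP ->; ring.
Qed.

Lemma very_weak_lin (c a b m1 m2 : R) (phi1 phi2 : 'rV[R]_n -> R) :
  sq_integrable B phi1 -> sq_integrable B phi2 ->
  very_weak_solution V c phi1 m1 -> very_weak_solution V c phi2 m2 ->
  very_weak_solution V c (fun x => a * phi1 x + b * phi2 x) (a * m1 + b * m2).
Proof.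
move=> s1 s2 w1 w2 v tv.
have sV (phi : 'rV[R]_n -> R) m : sq_integrable B phi ->
    sq_integrable B (fun x => V x * (phi x - m)).
  by move=> sphi; exact: sq_integrableM_bounded (sq_integrable_center m sphi) mV VM.
have sv := test_function_sq_integrable tv.
have sL : sq_integrable B (laplacian v).
  rewrite /laplacian; elim: (index_enum _) => [|i s IH].
    under eq_fun do rewrite big_nil.
    by apply: (@sq_integrable_bounded _ _ _ 0) => // x _; rewrite normr0.
  under eq_fun do rewrite big_cons; apply: sq_integrableD => //.
  exact: test_function_sq_integrable (test_function_partial i (test_function_partial i tv)).
rewrite pairing_lin// w1// w2//.
have -> : pairing (fun x => V x * (a * phi1 x + b * phi2 x - (a * m1 + b * m2))) v =
    a * pairing (fun x => V x * (phi1 x - m1)) v + b * pairing (fun x => V x * (phi2 x - m2)) v.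
  rewrite -pairing_lin//; [|exact: sV|exact: sV].
  by apply: eq_Rintegral => x _; ring.
ring.
Qed.

End very_weak.

(** * The Volterra inequality for a radial solution *)

Section estimate.
Context (R : realType) (n : nat) (n_gt0 : (0 < n)%N).
Local Notation mu := (lebesgue_rV R n).
Local Notation B := (unit_ball R n).
Local Notation lam := (@lebesgue_measure R).

Lemma profile_sq_integrable (phi : 'rV[R]_n -> R) (ga : R -> R) :
  sq_integrable B phi ->
  measurable_fun [set: measurableTypeR R] (ga : measurableTypeR R -> measurableTypeR R) ->
  {ae mu, forall x, B x -> phi x = ga (radial_volume x)} ->
  (\int[lam]_(t in `]0%R, 1%R[) (ga t ^+ 2)%:E < +oo)%E /\
  lam.-integrable `]0%R, 1%R[ (EFin \o ga).
Proof.
move=> [mphi phi2] mga aega.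
have mgar (D : set 'rV[R]_n) : measurable D ->
    measurable_fun D (fun x : 'rV[R]_n => ga (radial_volume x) : measurableTypeR R).
  move=> mD; apply: (@measurable_funS _ _ _ _ setT) => //.
  exact: (measurableT_comp mga (@measurable_radial_volume R n)).
have mB := measurable_unit_ball R n.
have sga : sq_integrable B (fun x => ga (radial_volume x)).
  split; first exact: mgar.
  rewrite (_ : (\int[mu]_(x in B) _ = \int[mu]_(x in B) (phi x ^+ 2)%:E)%E)//.
  apply: ae_eq_integral => //.
  - by apply/measurable_EFinP; apply: measurable_funX; exact: mgar.
  - by apply/measurable_EFinP; exact: measurable_funX.
  - by apply: filterS aega => x h Bx; rewrite h.
have m2 : measurable_fun [set: measurableTypeR R] (fun t => ga t ^+ 2 : measurableTypeR R).
  exact: measurable_funX.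
split.
  have /(integrable_unit_ball_radial n_gt0 m2) := integrable_sqr sga.
  move=> /integrableP[_]; under eq_integral do rewrite gee0_abs ?lee_fin ?sqr_ge0//.
  by [].
exact/(integrable_unit_ball_radial n_gt0 mga)/sq_integrable_integrable.
Qed.

Variables (Th th : R -> R) (C : R).
Hypothesis sTh : smooth1 Th.
Hypothesis dTh : forall t : R, is_derive t (1 : R) Th (th t).
Hypothesis Th0 : forall t, t <= 0 -> Th t = 0.
Hypothesis Th1 : forall t, 1 <= t -> Th t = 1.
Hypothesis Th_bnd : forall t, 0 <= Th t <= 1.
Hypothesis th_bnd : forall t, 0 <= th t <= C.
Hypothesis thL : forall t, t <= 0 -> th t = 0.
Hypothesis thR : forall t, 1 <= t -> th t = 0.
Hypothesis cth : continuous th.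

(** For [p] close to the indicator of [[a, b]], the integral of [ga] against [p'] is close to
    [ga a - ga b], while the test function built from [p] is bounded by [b^(2/n) / max(a, t)] and
    vanishes beyond [b]. The volume of the ball occurs on both sides and cancels; [2 n] comes from
    the Laplacian. *)
Lemma volterra_estimate (V phi : 'rV[R]_n -> R) (M c m : R) (ga : R -> R) (a b : R) :
  measurable_fun B (V : 'rV[R]_n -> measurableTypeR R) ->
  (forall x, B x -> `|V x| <= M) -> 0 <= M ->
  sq_integrable B phi -> very_weak_solution V c phi m ->
  measurable_fun [set: measurableTypeR R] (ga : measurableTypeR R -> measurableTypeR R) ->
  {ae mu, forall x, B x -> phi x = ga (radial_volume x)} ->
  0 < a -> a < b -> b < 1 -> approx_pt th ga a -> approx_pt th ga b ->
  (`|(ga a - m) - (ga b - m)|%:E <= (`|c| * M / (2 * n%:R) * b `^ (2 / n%:R))%:E *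
    \int[lam]_(t in `]0%R, b[) (`|ga t - m| / Num.max a t)%:E)%E.
Proof.
move=> mV VM M0 sphi vw mga aega a0 ab b1 pta ptb.
have b0 : 0 < b := lt_trans a0 ab.
have nR : 0 < n%:R :> R by rewrite ltr0n.
have [_ intga] := profile_sq_integrable sphi mga aega.
have mB := measurable_unit_ball R n.
set J := (\int[lam]_(t in `]0%R, b[) _)%E.
set beta := b `^ (2 / n%:R).
have beta0 : 0 <= beta by exact: powR_ge0.
pose om := fine (mu B).
have omfin : mu B = om%:E.
  by rewrite fineK// ge0_fin_numE; [exact: lebesgue_rV_unit_ball_lty|exact: measure_ge0].
have om0 : 0 < om by rewrite fine_gt0// lebesgue_rV_unit_ball_gt0 lebesgue_rV_unit_ball_lty.
have -> : ga a - m - (ga b - m) = ga a - ga b by ring.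
apply/lee_addgt0Pr => h h0.
have h20 : 0 < h / 2 by rewrite divr_gt0.
have [ea ea0 Ha] := pta _ h20; have [eb eb0 Hb] := ptb _ h20.
(* Small enough for both averages, and at most half of [b - a] so that the two ramps of [p] do not
   overlap. *)
pose e := Num.min (Num.min ea eb) (b - a) / 2.
have mm0 : 0 < Num.min (Num.min ea eb) (b - a) by rewrite !lt_min ea0 eb0 subr_gt0.
have e0 : 0 < e by rewrite divr_gt0.
have em : e < Num.min (Num.min ea eb) (b - a) by rewrite /e ltr_pdivrMr// ltr_pMr// ltr1n.
have [eea eeb] : e < ea /\ e < eb by move: em; rewrite !lt_min => /andP[/andP[]].
have eab : a + e <= b - e.
  have : 2 * e <= b - a by rewrite /e mulrC divfK// ge_min lexx orbT.
  lra.
(* A plateau rising on [[a, a + e]] and falling on [[b - e, b]]; its derivative is the bump at [a]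
   minus the bump at [b - e]. *)
pose p t := Th (e^-1 * t + - (e^-1 * a)) + -1 * Th (e^-1 * t + - (e^-1 * (b - e))).
pose p' t := bump th a e t - bump th (b - e) e t.
have dp t : is_derive t (1 : R) p (p' t).
  apply: is_derive_eq (is_deriveD (is_derive_step dTh a e t)
    (is_deriveZ (-1) (is_derive_step dTh (b - e) e t))) _.
  by rewrite /GRing.scale/= mulN1r.
have sp : smooth1 p.
  move=> k; apply: iter_derivableD; first exact: iter_derivable_affine.
  by apply: iter_derivableM; [exact: iter_derivable_cst|exact: iter_derivable_affine].
have arg y t : e^-1 * t + - (e^-1 * y) = (t - y) / e by field; rewrite gt_eqF.
have ThL y t : t <= y -> Th (e^-1 * t + - (e^-1 * y)) = 0.
  by move=> ty; rewrite arg Th0// pmulr_lle0 ?invr_gt0// subr_le0.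
have ThR y t : y + e <= t -> Th (e^-1 * t + - (e^-1 * y)) = 1.
  by move=> ty; rewrite arg Th1// ler_pdivlMr// mul1r; lra.
have pa t : t <= a -> p t = 0.
  by move=> ta; rewrite /p !ThL ?mulr0 ?addr0//; lra.
have pb t : b <= t -> p t = 0.
  by move=> bt; rewrite /p !ThR ?mulN1r ?subrr//; lra.
have p01 t : 0 <= p t <= 1.
  rewrite /p; have [tb|bt] := leP t (b - e).
    by rewrite (ThL _ _ tb) mulr0 addr0.
  rewrite (ThR a) ?mulN1r; last by lra.
  by have /andP[h1 h2] := Th_bnd (e^-1 * t + - (e^-1 * (b - e))); apply/andP; split; lra.
have [v [tv Lv vle v0]] := radial_test_function_ex n_gt0 a0 ab b1 sp dp p01 pa pb.
have sv := test_function_sq_integrable tv.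
have ia := integrable_mul_bump th_bnd cth a e0 intga.
have ib := integrable_mul_bump th_bnd cth (b - e) e0 intga.
have m01 : measurable (`]0, 1[%classic : set (measurableTypeR R)) by exact: measurable_itv.
pose Ia := \int[lam]_(t in `]0, 1[) (ga t * bump th a e t).
pose Ib := \int[lam]_(t in `]0, 1[) (ga t * bump th (b - e) e t).
have Iab : \int[lam]_(t in `]0, 1[) (ga t * p' t) = Ia - Ib.
  rewrite /Ia /Ib -RintegralB//.
  by apply: eq_Rintegral => t _; rewrite /p' mulrBr.
have mp' : measurable_fun [set: measurableTypeR R] (p' : measurableTypeR R -> measurableTypeR R).
  by apply: measurable_funB; exact: measurable_bump.
have igp : lam.-integrable `]0%R, 1%R[ (EFin \o (fun t => ga t * p' t)).
  have := integrableB m01 ia ib; apply: eq_integrable => // t _ /=.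
  by rewrite /p' mulrBr.
pose F t := 2 * n%:R * (ga t * p' t).
have mF : measurable_fun [set: measurableTypeR R] (F : measurableTypeR R -> measurableTypeR R).
  by apply: measurable_funM => //; exact: measurable_funM.
have iF : lam.-integrable `]0%R, 1%R[ (EFin \o F) by exact: (integrableZl m01 (2 * n%:R) igp).
have step1 : pairing phi (laplacian v) = om * (2 * n%:R * (Ia - Ib)).
  have mLv : measurable_fun B (laplacian v : 'rV[R]_n -> measurableTypeR R).
    rewrite (funext Lv); apply: measurable_funM => //.
    apply: (@measurable_funS _ _ _ _ setT) => //.
    exact: (measurableT_comp mp' (@measurable_radial_volume R n)).
  have mgar : measurable_fun B (fun x : 'rV[R]_n => ga (radial_volume x) : measurableTypeR R).
    apply: (@measurable_funS _ _ _ _ setT) => //.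
    exact: (measurableT_comp mga (@measurable_radial_volume R n)).
  rewrite (pairing_ae sphi.1 mgar mLv aega) -Iab -RintegralZl//.
  have iFr : mu.-integrable B (fun x => (F (radial_volume x))%:E).
    exact/(integrable_unit_ball_radial n_gt0 mF).
  rewrite -(Rintegral_unit_ball_radial n_gt0 mF iFr).
  by apply: eq_Rintegral => x _; rewrite Lv /F; ring.
pose f x := V x * (phi x - m).
have sf : sq_integrable B f.
  exact: sq_integrableM_bounded (sq_integrable_center m sphi) mV VM.
pose k t := (`|ga t - m| / Num.max a t)%:E.
(* A majorant of [|f v|] in the radial variable; the cut at [b] reflects the support of [v] and
   reduces the integral over []0, 1[] to one over []0, b[]. *)
pose H t := if t < b then ((M * beta)%:E * k t)%E else 0%E.
have maxa_gt0 t : 0 < Num.max a t by rewrite lt_max a0.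
have k0 t : (0 <= k t)%E by rewrite lee_fin divr_ge0// ltW.
have H0 t : (0 <= H t)%E.
  by rewrite /H; case: ifP => // _; rewrite mule_ge0// lee_fin mulr_ge0.
have mgam : measurable_fun [set: measurableTypeR R]
    (fun t => `|ga t - m| : measurableTypeR R).
  by apply: measurableT_comp => //; exact: measurable_funB.
have mk (D : set (measurableTypeR R)) : measurable D -> measurable_fun D k.
  move=> mD; apply/measurable_EFinP; apply: (@measurable_funS _ _ _ _ setT) => //.
  apply: measurable_funM => //.
  have -> : (fun t : measurableTypeR R => (Num.max a t)^-1) = (fun t : R => (Num.max a t) `^ (-1)).
    by apply/funext => t; rewrite powR_inv1// ltW.
  have mpow : measurable_fun [set: measurableTypeR R]
      (fun t : measurableTypeR R => t `^ (-1) : measurableTypeR R).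
    exact: measurable_powR.
  by apply: (measurableT_comp mpow); exact: measurable_maxr.
have HE : H = (fun t => (M * beta)%:E * k t)%E \_ `]-oo, b[%classic.
  by apply/funext => t; rewrite patchE mem_setE in_itv.
have mH : measurable_fun [set: measurableTypeR R] H.
  rewrite HE; apply: (measurable_restrictT _ _).1; first exact: measurable_itv.
  by apply: measurable_funeM; apply: mk; exact: measurable_itv.
have step2 : (`|pairing f v|%:E <= om%:E * ((M * beta)%:E * J))%E.
  rewrite /pairing EFin_normr_Rintegral//; last exact: sq_integrableM.
  have mfv : measurable_fun B (fun x => (f x * v x)%:E).
    by apply/measurable_EFinP; apply: measurable_funM; [exact: sf.1|exact: sv.1].
  apply: (le_trans (le_abse_integral mu mB mfv)).
  apply: (@le_trans _ _ (\int[mu]_(x in B) H (radial_volume x))%E).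
    apply: ae_ge0_le_integral => //.
    - exact: measurableT_comp.
    - apply: (@measurable_funS _ _ _ _ setT) => //.
      exact: (measurableT_comp mH (@measurable_radial_volume R n)).
    - apply: filterS aega => x hx Bx; rewrite /H abse_EFin.
      have [xb|xb] := ltP (radial_volume x) b; last by rewrite v0// mulr0 normr0.
      rewrite -EFinM lee_fin /f hx// !normrM -mulrA -[leRHS]mulrA.
      apply: ler_pM => //; [exact: VM|].
      by rewrite mulrCA ler_wpM2l// (le_trans (vle x)).
  rewrite (ge0_integral_unit_ball_radial n_gt0 mH H0) omfin.
  apply: lee_wpmul2l; first by rewrite lee_fin ltW.
  have m0b : measurable (`]0, b[%classic : set (measurableTypeR R)) by exact: measurable_itv.
  have -> : (\int[lam]_(t in `]0%R, 1%R[) H t = \int[lam]_(t in `]0%R, b[) ((M * beta)%:E * k t))%E.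
    rewrite integral_mkcond [RHS]integral_mkcond; apply: eq_integral => t _.
    rewrite !patchE !mem_setE !in_itv/= /H.
    have [tb|tb] := ltP t b; last by rewrite andbF; case: ifP.
    by rewrite andbT (lt_trans tb b1) andbT.
  rewrite (ge0_integralZl lam m0b (mk _ m0b) (fun t _ => k0 t))//.
  by rewrite lee_fin mulr_ge0.
have J0 : (0 <= J)%E by apply: integral_ge0 => t _; exact: k0.
have step3 : (`|Ia - Ib|%:E <= (`|c| * M / (2 * n%:R) * beta)%:E * J)%E.
  have E : om * (2 * n%:R * (Ia - Ib)) = - c * pairing f v by rewrite -step1; exact: vw.
  have E' : `|Ia - Ib| = `|c| / (2 * n%:R * om) * `|pairing f v|.
    have -> : Ia - Ib = (- c / (2 * n%:R * om)) * pairing f v.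
      apply: (@mulfI _ (om * (2 * n%:R))); first by rewrite mulf_neq0 ?mulf_neq0 ?gt_eqF.
      by rewrite -[LHS]mulrA E; field; rewrite !gt_eqF.
    rewrite normrM normrM normrN normfV (ger0_norm (_ : 0 <= 2 * n%:R * om))//.
    by rewrite !mulr_ge0// ltW.
  rewrite E' EFinM.
  apply: (@le_trans _ _ ((`|c| / (2 * n%:R * om))%:E * (om%:E * ((M * beta)%:E * J)))%E).
    by apply: lee_wpmul2l => //; rewrite lee_fin divr_ge0// !mulr_ge0// ltW.
  rewrite !muleA -!EFinM le_eqVlt; apply/orP; left; apply/eqP; congr (_%:E * _)%E.
  by field; rewrite !gt_eqF.
apply: (@le_trans _ _ (`|Ia - Ib|%:E + h%:E)%E); last by rewrite leeD2r.
rewrite -EFinD lee_fin.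
have := Ha e a; rewrite e0 eea => /(_ isT); rewrite lexx andbT gerBl (ltW e0) => /(_ isT).
have := Hb e (b - e); rewrite e0 eeb => /(_ isT); rewrite lexx gerBl (ltW e0) => /(_ isT).
rewrite -/Ia -/Ib => hb ha.
have -> : ga a - ga b = (Ia - Ib) - (Ia - ga a) + (Ib - ga b) by ring.
rewrite (le_trans (ler_normD _ _))// (le_trans (lerD (ler_normB _ _) (lexx _)))//.
lra.
Qed.

End estimate.

Lemma ae_conj (d : measure_display) (T : measurableType d) (R : realType)
    (m : {measure set T -> \bar R}) (P Q : T -> Prop) :
  {ae m, forall x, P x} -> {ae m, forall x, Q x} -> {ae m, forall x, P x /\ Q x}.
Proof. by move=> h1 h2; apply: filterS2 h1 h2. Qed.

(** * Measurability and boundedness of the weight *)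

Section weight.
Context (R : realType) (n : nat).
Local Notation B := (unit_ball R n).

Lemma compact_closure_unit_ball : compact (closure B).
Proof.
apply: bounded_closed_compact; last exact: closed_closure.
have cl1 : closed [set x : 'rV[R]_n | `|x| <= 1].
  rewrite (_ : [set _ | _] = (fun x => `|x|) @^-1` [set y | y <= 1]) //.
  by apply: preimage_closed => [x _|]; [exact: norm_continuous|exact: closed_le].
exists 1; split; first exact: num_real.
move=> r r1 x clx; apply: le_trans (ltW r1).
have : closure [set y : 'rV[R]_n | `|y| <= 1] x.
  apply: closure_subset clx => y /= By.
  by rewrite (le_trans (normr_le_enorm y))// ltW.
by move: cl1 => /closure_id <-.
Qed.

(** As [alpha > 0] and [lambda * psi >= 0] on the closed ball, the argument of [f'] stays positive
    there. So [f'] may be replaced by the continuous [g] of [C2_nonneg], and [V] is continuous on a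
    compact set. *)
Lemma solution_weight (f : R -> R) (lambda alpha : R) (psi : 'rV[R]_n -> R) :
  C2_nonneg f -> 0 <= lambda -> constrained_solution B f lambda alpha psi ->
  let V := fun x : 'rV[R]_n => derive1 f (alpha + lambda * psi x) in
  measurable_fun B (V : 'rV[R]_n -> measurableTypeR R) /\
  exists2 M, 0 <= M & forall x, B x -> `|V x| <= M.
Proof.
move=> f_C2 lambda0 sol V.
have [[g [cg gE]] _] := f_C2.2 1%N isT.
have alpha0 := solution_alpha_gt0 sol.
have cpsi := (solution_C2 sol).1.
have psi0 x : closure B x -> 0 <= psi x.
  move=> clx; have [Bx|nBx] := pselect (B x); first exact: ltW (solution_gt0 sol Bx).
  by rewrite (solution_boundary sol).
have arg0 x : closure B x -> 0 < alpha + lambda * psi x.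
  by move=> clx; rewrite ltr_wpDr// mulr_ge0// psi0.
pose W x := g (alpha + lambda * psi x).
have VW x : closure B x -> V x = W x.
  by move=> clx; rewrite /V -derive1n1 gE// arg0.
have cW : {within closure B, continuous W}.
  rewrite continuous_subspace_in => x /set_mem clx.
  apply: (@continuous_comp _ _ _ (fun y : subspace (closure B) => alpha + lambda * psi y) g).
    apply: cvgD; first exact: cvg_cst.
    by apply: cvgM; [exact: cvg_cst|exact: cpsi].
  move/continuous_within_itvcyP : cg => [cg _]; apply: cg.
  by rewrite in_itv/= andbT arg0.
have BW : B `<=` closure B := @subset_closure _ B.
split.
  apply: (eq_measurable_fun (W : 'rV[R]_n -> measurableTypeR R)).
    by move=> x /set_mem Bx; rewrite VW//; exact: BW.
  apply: within_continuous_measurable_rV; first exact: open_unit_ball.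
  exact: continuous_subspaceW cW.
have [M [_ MW]] := compact_bounded (continuous_compact cW compact_closure_unit_ball).
exists (`|M| + 1); first by rewrite addr_ge0.
move=> x Bx; rewrite VW; last exact: BW.
apply: MW; first by rewrite (le_lt_trans (ler_norm M))// ltrDl.
by exists x => //; exact: BW.
Qed.

End weight.

(** * Linear dependence of two radial solutions modulo constants *)

Section uniqueness.
Context (R : realType) (n : nat) (n_gt0 : (0 < n)%N).
Local Notation mu := (lebesgue_rV R n).
Local Notation B := (unit_ball R n).
Local Notation lam := (@lebesgue_measure R).

Lemma ae_approx_pt (Th th : R -> R) (C : R) (ga : R -> R) :
  (forall t : R, is_derive t (1 : R) Th (th t)) ->
  (forall t, t <= 0 -> Th t = 0) -> (forall t, 1 <= t -> Th t = 1) ->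
  (forall t, 0 <= th t <= C) -> (forall t, t <= 0 -> th t = 0) ->
  (forall t, 1 <= t -> th t = 0) -> continuous th ->
  measurable_fun [set: measurableTypeR R] (ga : measurableTypeR R -> measurableTypeR R) ->
  lam.-integrable `]0%R, 1%R[ (EFin \o ga) ->
  {ae lam, forall t, 0 < t < 1 -> approx_pt th ga t}.
Proof.
move=> dTh Th0 Th1 th_bnd thL thR cth mga iga.
have m01 : measurable (`]0, 1[%classic : set (measurableTypeR R)) by exact: measurable_itv.
have := lebesgue_differentiation (integrable_locally m01 iga).
move=> /ae_mono; apply => t lt t01.
exact: (lebesgue_approx_pt dTh Th0 Th1 th_bnd thL thR cth t01 mga iga lt).
Qed.

Lemma very_weak_unique (V phi1 phi2 : 'rV[R]_n -> R) (M c m1 m2 : R) :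
  measurable_fun B (V : 'rV[R]_n -> measurableTypeR R) ->
  0 <= M -> (forall x, B x -> `|V x| <= M) ->
  sq_integrable B phi1 -> radial B phi1 -> very_weak_solution V c phi1 m1 ->
  sq_integrable B phi2 -> radial B phi2 -> very_weak_solution V c phi2 m2 ->
  exists a b : R, (a, b) != (0, 0) /\
    {ae mu, forall x, B x -> a * phi1 x + b * phi2 x = a * m1 + b * m2}.
Proof.
move=> mV M0 VM s1 r1 w1 s2 r2 w2.
have [Th [th [K [sTh dTh Th0 Th1 [Th_bnd th_bnd thL thR cth]]]]] := smooth_step_ex R.
have [ga1 mga1 ae1] := radial_measurable_profile n_gt0 s1.1 r1.
have [ga2 mga2 ae2] := radial_measurable_profile n_gt0 s2.1 r2.
have [_ iga1] := profile_sq_integrable n_gt0 s1 mga1 ae1.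
have [_ iga2] := profile_sq_integrable n_gt0 s2 mga2 ae2.
pose E := [set t | approx_pt th ga1 t /\ approx_pt th ga2 t].
have aeE : {ae lam, forall t, 0 < t < 1 -> E t}.
  have E1 := ae_approx_pt dTh Th0 Th1 th_bnd thL thR cth mga1 iga1.
  have E2 := ae_approx_pt dTh Th0 Th1 th_bnd thL thR cth mga2 iga2.
  have E12 := ae_conj E1 E2.
  by apply: (ae_mono E12) => t [h1 h2] t01; split; [exact: h1|exact: h2].
have nR : 0 < n%:R :> R by rewrite ltr0n.
pose C := `|c| * M / (2 * n%:R); pose e : R := 2 / n%:R.
have C0 : 0 <= C by rewrite divr_ge0 ?mulr_ge0// ltW.
have e0 : 0 < e by rewrite divr_gt0.
(* Chosen so that [b < d] gives [C b^e <= C / (8 (C + 1)) <= 1/8], the smallness that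
   [volterra_uniqueness] asks for. *)
pose d := Num.min 1 ((8 * (C + 1))^-1 `^ e^-1).
have C1 : 0 < C + 1 by rewrite ltr_wpDl.
have d0 : 0 < d by rewrite lt_min ltr01 powR_gt0// invr_gt0 mulr_gt0.
have [|b /andP[b0 bd] [pt1 pt2]] := @ae_itv_ex R E 0 d d0.
  apply: (ae_mono aeE) => t Et /andP[t0 td]; apply: Et; rewrite t0 (lt_le_trans td)//.
  by rewrite ge_min lexx.
have b1 : b < 1 by rewrite (lt_le_trans bd)// ge_min lexx.
have Cb : C * b `^ e <= 8^-1.
  have : b `^ e <= (8 * (C + 1))^-1.
    pose r := (8 * (C + 1))^-1; have r0 : 0 < r by rewrite invr_gt0 mulr_gt0.
    have -> : (8 * (C + 1))^-1 = (r `^ e^-1) `^ e.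
      by rewrite -powRrM mulVf ?gt_eqF// powRr1// ltW.
    apply: ge0_ler_powR; rewrite ?nnegrE ?powR_ge0 ?(ltW b0) ?(ltW e0)//.
    by rewrite (le_trans (ltW bd))// ge_min lexx orbT.
  move=> /(ler_wpM2l C0)/le_trans; apply.
  rewrite invfM mulrCA ger_pMr ?invr_gt0// ler_pdivrMr// mul1r lerDl//.
pose u1 := ga1 b - m1; pose u2 := ga2 b - m2.
(* A single linear form in two unknowns has a nonzero kernel: [(u2, - u1)] lies in it, or [(0, 1)]
   when [u2 = 0]. *)
have [a [a' [aa' au]]] : exists a a' : R, (a, a') != (0, 0) /\ a * u1 + a' * u2 = 0.
  have [u20|u20] := eqVneq u2 0.
    by exists 0, 1; rewrite u20 xpair_eqE oner_eq0 andbF mul0r mulr0 addr0.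
  by exists u2, (- u1); rewrite xpair_eqE negb_and u20; split => //; ring.
exists a, a'; split => //.
set m := a * m1 + a' * m2.
pose phi x := a * phi1 x + a' * phi2 x; pose ga t := a * ga1 t + a' * ga2 t.
have sphi : sq_integrable B phi.
  by apply: sq_integrableD; exact: sq_integrableZ.
have wphi : very_weak_solution V c phi m by exact: (very_weak_lin mV VM).
have mga : measurable_fun [set: measurableTypeR R] (ga : measurableTypeR R -> measurableTypeR R).
  by apply: measurable_funD; exact: measurable_funM.
have aega : {ae mu, forall x, B x -> phi x = ga (radial_volume x)}.
  have ae12 := ae_conj ae1 ae2.
  by apply: filterS ae12 => x [h1 h2] Bx; rewrite /phi /ga h1// h2.
have ptE t : E t -> approx_pt th ga t.
  by move=> [h1 h2]; exact: (approx_pt_lin th_bnd cth).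
have mu_ : measurable_fun [set: measurableTypeR R]
    ((fun t => ga t - m) : measurableTypeR R -> measurableTypeR R).
  exact: measurable_funB.
have [u2fin _] : (\int[lam]_(t in `]0%R, 1%R[) ((ga t - m) ^+ 2)%:E < +oo)%E /\
    lam.-integrable `]0%R, 1%R[ (EFin \o (fun t => ga t - m)).
  apply: (profile_sq_integrable n_gt0 (sq_integrable_center m sphi) mu_).
  by apply: filterS aega => x h Bx; rewrite h.
have volt x y : E x -> E y -> 0 < x -> x < y -> y < 1 ->
    (`|(ga x - m) - (ga y - m)|%:E <= (C * y `^ e)%:E *
      \int[lam]_(t in `]0%R, y[) (`|ga t - m| / Num.max x t)%:E)%E.
  move=> Ex Ey x0 xy y1.
  exact: (volterra_estimate n_gt0 sTh dTh Th0 Th1 Th_bnd th_bnd cth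
    mV VM M0 sphi wphi mga aega x0 xy y1 (ptE _ Ex) (ptE _ Ey)).
have ub0 : ga b - m = 0 by rewrite -au /ga /m /u1 /u2; ring.
have gam := volterra_uniqueness mu_ u2fin aeE C0 e0 volt (conj pt1 pt2) b0 b1 ub0 Cb.
have aegam : {ae lam, forall t, 0 < t < 1 -> ga t = m}.
  by apply: (ae_mono aeE) => t Et t01; apply/eqP; rewrite -subr_eq0 gam//; exact: Et.
have aeB := ae_conj aega (ae_unit_ball_radial n_gt0 aegam).
by apply: filterS aeB => x [h1 h2] Bx; rewrite -h2// -h1.
Qed.

End uniqueness.

Unset Implicit Arguments.

Theorem proposition1p8 (R : realType) (n : nat) (n_ge2 : (2 <= n)%N)
    (f : R -> R)
    (f_C2 : C2_nonneg f)
    (f_ge0 : forall t : R, 0 <= t -> 0 <= f t)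
    (f'_gt0 : forall t : R, 0 < t -> 0 < derive1 f t)
    (lambda : R) (lambda_ge0 : 0 <= lambda)
    (alpha : R) (psi : 'rV[R]_n -> R)
    (sol : constrained_solution (unit_ball R n) f lambda alpha psi)
    (sigma : R) (phi1 phi2 : 'rV[R]_n -> R) :
  let V := fun x : 'rV[R]_n => derive1 f (alpha + lambda * psi x) in
  eigenfunction (unit_ball R n) lambda V sigma phi1 ->
  radial (unit_ball R n) phi1 ->
  eigenfunction (unit_ball R n) lambda V sigma phi2 ->
  radial (unit_ball R n) phi2 ->
  exists a b : R, (a, b) != (0, 0) /\
    {ae lebesgue_rV R n, forall x, unit_ball R n x ->
       a * phi1 x + b * phi2 x = 0}.
Proof.
(* Writing the dimension as a successor provides the coordinate [ord0] along which
   [H10_combination_constant] integrates. *)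
case: n n_ge2 psi sol phi1 phi2 => [//|n] _ psi sol phi1 phi2 V [H1 _ w1] r1 [H2 _ w2] r2.
have [mV [M M0 VM]] := solution_weight f_C2 lambda_ge0 sol.
have [a [b [ab aek]]] := very_weak_unique (ltn0Sn n) mV M0 VM
  H1.1 r1 (weak_eigen_very_weak H1.1 w1) H2.1 r2 (weak_eigen_very_weak H2.1 w2).
exists a, b; split=> //.
by have k0 := H10_combination_constant H1 H2 aek; rewrite k0 in aek.
Qed.
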